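(* Suppose the family of $N\times N$ matrices $\{D_1^{(N)},\dots,D_p^{(N)}\}_N$ converges in distribution to $\{d_1,\dots,d_p\}$ in $(\mathcal D,\psi)$ and $(X_N)_{N\in\mathbb N}$ is a sequence of $N\times N$ complex Gaussian random matrices. Put $P_N(D_i):=X_N^*D_i^{(N)}X_N$ and let $p(d_i)$ be the operators on the full Fock space defined in the context. Then for all $m,n\in\mathbb N$ and all $i_1,\dots,i_{n+m}\in\{1,\dots,p\}$, $$\lim_{N\to\infty}k_2\{\mathrm{Tr}[P_N(D_{i_1})\cdots P_N(D_{i_n})],\ \overline{\mathrm{Tr}[P_N(D_{i_{n+1}})\cdots P_N(D_{i_{n+m}})]}\}=\langle\mathbf c\,p(d_{i_1})\cdots p(d_{i_n})\Omega,\ \mathbf c\,p(d_{i_{n+1}})\cdots p(d_{i_{n+m}})\Omega\rangle_{\mathrm{cyc}}.$$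
   Context: Random matrices: the entries of the complex Gaussian matrix $X_N$ are independent centered complex Gaussians with variance $1/N$. The $D_i^{(N)}$ are non-random complex $N\times N$ matrices. The family $\{D_1^{(N)},\dots,D_p^{(N)}\}_N$ converges in distribution to $\{d_1,\dots,d_p\}$ in $(\mathcal D,\psi)$ if $d_1,\dots,d_p$ are operators, $\mathcal D$ is the complex $*$-algebra generated by $\{1,d_1,\dots,d_p\}$, $\psi$ is a tracial state on $\mathcal D$, and $$\lim_{N\to\infty}\mathrm{tr}[D_{j_1}^{(N)}\cdots D_{j_k}^{(N)}]=\psi(d_{j_1}\cdots d_{j_k})\quad\text{for all } j_1,\dots,j_k\in\{1,\dots,p\},$$ where $\mathrm{Tr}$ is the un-normalized trace and $\mathrm{tr}=\frac1N\mathrm{Tr}$. With $E$ the expectation, $k_2\{a,b\}=E\{ab\}-E\{a\}E\{b\}$. Fock space: on $\mathcal D$ put $\langle d,d'\rangle=\psi(d'^*d)$. The algebraic (linear) Fock space is $\mathcal F_{\mathrm{lin}}(\mathcal D)=\mathbb C\Omega\oplus\bigoplus_{n\ge1}\mathcal D^{\otimes n}$. For $d\in\mathcal D$ define on it: $l(d)\Omega=d$, $l(d)f_1\otimes\cdots\otimes f_n=d\otimes f_1\otimes\cdots\otimes f_n$; $l^*(d)\Omega=0$, $l^*(d)f_1\otimes\cdots\otimes f_n=\langle f_1,d\rangle f_2\otimes\cdots\otimes f_n$ (empty tensor $=\Omega$); $\Lambda(d)\Omega=0$, $\Lambda(d)f_1\otimes\cdots\otimes f_n=(df_1)\otimes f_2\otimes\cdots\otimes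 f_n$; and $$p(d)=l(d)+l^*(d^* )+\Lambda(d)+\psi(d)1.$$ Cyclic Fock space: $\mathcal F_{\mathrm{cyc}}(\mathcal D)=\bigoplus_{n\ge0}\mathcal D^{\otimes n}_{\mathrm{cyc}}$ (algebraic direct sum), where $\mathcal D_{\mathrm{cyc}}^{\otimes n}$ is spanned by circular tensors $[d_1\otimes\cdots\otimes d_n]$ (the entries thought of as arranged around a circle), with inner product (linear in the first, antilinear in the second argument) determined by $$\langle[d_1\otimes\cdots\otimes d_n],[e_1\otimes\cdots\otimes e_m]\rangle_{\mathrm{cyc}}=\delta_{nm}\sum_{k=0}^{n-1}\langle d_1,e_{1+k}\rangle\cdots\langle d_n,e_{n+k}\rangle,$$ indices of $e$ modulo $n$. The linear map $\mathbf c:\mathcal F_{\mathrm{lin}}(\mathcal D)\to\mathcal F_{\mathrm{cyc}}(\mathcal D)$ is given recursively by $\mathbf c\,\Omega=0$, $\mathbf c(d)=[d]$, and for $n\ge2$ $$\mathbf c(d_1\otimes\cdots\otimes d_n)=[d_1\otimes\cdots\otimes d_n]+[d_nd_1\otimes d_2\otimes\cdots\otimes d_{n-1}]+\psi(d_1d_n)\,\mathbf c(d_2\otimes\cdots\otimes d_{n-1}),$$ where for $n=2$ the argument of the last $\mathbf c$ is $\Omega$.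
   Formalization: Convergence in distribution is taken as convergence of all *-moments (words in the D_i and their adjoints, to words in d_i and d_i^* ), since with words in the D_i alone the claim fails: nilpotent shifts, d=0, n=m=1 give limit 1 instead of 0. *)

(* Defs.v *)
From HB Require Import structures.
From mathcomp Require Import all_boot all_order all_algebra complex.
From mathcomp Require Import generic_quotient ring_quotient freeg.
From mathcomp Require Import all_classical all_reals all_analysis.

Set Implicit Arguments.
Unset Strict Implicit.
Unset Printing Implicit Defensive.

Import Order.TTheory GRing.Theory Num.Theory.
Import numFieldNormedType.Exports.

Local Open Scope classical_set_scope.
Local Open Scope ring_scope.
Local Open Scope quotient_scope.

(* Modules presented by generators and relations: the free F-module on K,     *)
(* divided by the submodule spanned by rel.                                   *)
Section Presented.
Variables (F : comNzRingType) (K : choiceType).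
Implicit Types (rel : {freeg K / F} -> Prop) (W : lmodType F).

Definition word (k : K) : {freeg K / F} := [freeg [:: (1, k)]].

Definition in_span rel (u : {freeg K / F}) : Prop :=
  forall S : {freeg K / F} -> Prop,
    S 0 -> (forall a x y, S x -> S y -> S (a *: x + y)) ->
    (forall r, rel r -> S r) -> S u.

Definition span_pred rel : {pred {freeg K / F}} := fun u => `[< in_span rel u >].

Lemma span_zmod_closed rel : zmod_closed (span_pred rel).
Proof.
split=> [|x y /asboolP Sx /asboolP Sy]; first by apply/asboolP => S S0.
apply/asboolP => S S0 SD Sr; rewrite addrC -scaleN1r.
by apply: (SD); [apply: Sy | apply: Sx].
Qed.

HB.instance Definition _ rel :=
  GRing.isZmodClosed.Build _ (span_pred rel) (span_zmod_closed rel).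

Lemma span_scale rel a u : u \in span_pred rel -> a *: u \in span_pred rel.
Proof.
move=> /asboolP Su; apply/asboolP => S S0 SD Sr.
by rewrite -[_ *: _]addr0; apply: (SD) => //; apply: Su.
Qed.

Definition presented rel : Type := (Quotient.quot (span_pred rel)).

HB.instance Definition _ rel := GRing.Zmodule.on (presented rel).

Definition pproj rel (u : {freeg K / F}) : presented rel :=
  \pi_(Quotient.quot (span_pred rel)) u.
Definition prepr rel (q : presented rel) : {freeg K / F} :=
  repr (q : (Quotient.quot (span_pred rel))).

Lemma pprojK rel (q : presented rel) : pproj rel (prepr q) = q.
Proof. exact: reprK. Qed.

Lemma pproj_eq rel u v : (pproj rel u == pproj rel v) = (u - v \in span_pred rel).
Proof. by rewrite -Quotient.idealrBE. Qed.

Lemma pprojD rel u v : pproj rel (u + v) = pproj rel u + pproj rel v.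
Proof. exact: raddfD. Qed.

Definition pscale rel (a : F) (q : presented rel) : presented rel :=
  pproj rel (a *: prepr q).

Lemma pproj_scale rel a u : pproj rel (a *: u) = pscale a (pproj rel u).
Proof.
apply/eqP; rewrite pproj_eq -scalerBr span_scale //.
by rewrite -pproj_eq pprojK.
Qed.

Lemma pscaleA rel a b (q : presented rel) :
  pscale a (pscale b q) = pscale (a * b) q.
Proof. by rewrite -[q]pprojK -!pproj_scale scalerA. Qed.

Lemma pscale1 rel : left_id 1 (@pscale rel).
Proof. by move=> q; rewrite -[q]pprojK -pproj_scale scale1r. Qed.

Lemma pscaleDr rel : right_distributive (@pscale rel) +%R.
Proof.
by move=> a x y; rewrite -[x]pprojK -[y]pprojK -pprojD -!pproj_scale scalerDr pprojD.
Qed.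

Lemma pscaleDl rel (q : presented rel) : {morph (@pscale rel)^~ q : a b / a + b}.
Proof. by move=> a b; rewrite -[q]pprojK -!pproj_scale scalerDl pprojD. Qed.

HB.instance Definition _ rel :=
  GRing.Zmodule_isLmodule.Build F (presented rel)
    (@pscaleA rel) (@pscale1 rel) (@pscaleDr rel) (@pscaleDl rel).

Definition pgen rel (k : K) : presented rel := pproj rel (word k).

(* The linear map sending pgen k to f k; meaningful when the linear extension *)
(* of f to the free module kills the relations (see plift_gen).               *)
Definition plift rel W (f : K -> W) (q : presented rel) : W := fglift f (prepr q).

Lemma fglift_linear W (f : K -> W) : linear (fglift f).
Proof.
have fB := lift_is_additive f.
have f0 : fglift f 0 = 0 by rewrite -[0 in LHS](subrr 0) fB subrr.
have fD x y : fglift f (x + y) = fglift f x + fglift f y.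
  have fN z : fglift f (- z) = - fglift f z by rewrite -sub0r fB f0 sub0r.
  by rewrite -[y in LHS]opprK fB fN opprK.
have fsum (s : seq K) (g : K -> {freeg K / F}) :
    fglift f (\sum_(x <- s) g x) = \sum_(x <- s) fglift f (g x).
  by elim: s => [|x s IH]; rewrite ?big_nil // !big_cons fD IH.
move=> a x y; rewrite fD; congr (_ + _).
rewrite -[x in RHS]freeg_sumE fsum scaler_sumr.
rewrite [_ *: _ in LHS]/(GRing.scale _ _)/= /fgscale fsum; apply: eq_bigr => k _.
by rewrite !liftU scalerA.
Qed.

Lemma fglift_word W (f : K -> W) k : fglift f (word k) = f k.
Proof. by rewrite liftU scale1r. Qed.

Lemma fgliftZ W (f : K -> W) a x : fglift f (a *: x) = a *: fglift f x.
Proof.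
have f0 : fglift f 0 = 0.
  by have := fglift_linear f (-1) 0 0; rewrite scaler0 addr0 scaleN1r addNr.
by have := fglift_linear f a x 0; rewrite f0 !addr0.
Qed.

Lemma fgliftD W (f : K -> W) x y : fglift f (x + y) = fglift f x + fglift f y.
Proof. by have := fglift_linear f 1 x y; rewrite !scale1r. Qed.

Lemma fgliftB W (f : K -> W) x y : fglift f (x - y) = fglift f x - fglift f y.
Proof. exact: lift_is_additive. Qed.

Section Lift.
Variables (rel : {freeg K / F} -> Prop) (W : lmodType F) (f : K -> W).
Hypothesis f_rel : forall r, rel r -> fglift f r = 0.

Lemma plift_pproj u : plift f (pproj rel u) = fglift f u.
Proof.
have : pproj rel (prepr (pproj rel u)) == pproj rel u by rewrite pprojK.
rewrite pproj_eq => /asboolP /(_ (fun v => fglift f v = 0)) H.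
apply/eqP; rewrite -subr_eq0 -fgliftB; apply/eqP; apply: H => //.
- by rewrite -[0](subrr 0) fgliftB subrr.
- by move=> a x y x0 y0; rewrite fglift_linear x0 y0 scaler0 addr0.
Qed.

Lemma plift_gen k : plift f (pgen rel k) = f k.
Proof. by rewrite plift_pproj fglift_word. Qed.

Lemma plift_linear : linear (plift f : presented rel -> W).
Proof.
move=> a x y; rewrite -[x]pprojK -[y]pprojK.
rewrite -[a *: _]pproj_scale -pprojD !plift_pproj.
exact: fglift_linear.
Qed.

End Lift.

Lemma pgen_rel (rel : {freeg K / F} -> Prop) r : rel r -> pproj rel r = 0.
Proof.
move=> rr; apply/eqP; rewrite -[0](_ : pproj rel 0 = 0); last exact: raddf0.
by rewrite pproj_eq subr0; apply/asboolP => S _ _; apply.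
Qed.

Lemma presented_ind (rel : {freeg K / F} -> Prop) (S : presented rel -> Prop) :
  S 0 -> (forall a k q, S q -> S (a *: pgen rel k + q)) -> forall q, S q.
Proof.
move=> S0 SD q; rewrite -[q]pprojK -[prepr q]freeg_sumE.
elim: (dom _) => [|k s IH]; first by rewrite big_nil [pproj _ _]raddf0.
rewrite big_cons pprojD.
have -> : << coeff k (prepr q) *g k >> = coeff k (prepr q) *: word k.
  apply/eqP/freeg_eqP => x.
  by rewrite coeff_fgscale !coeffU mul1r.
by rewrite pproj_scale; apply: SD.
Qed.

End Presented.

Definition star_algebra (C : numClosedFieldType) (A : algType C) (star : A -> A)
    : Prop :=
  [/\ involutive star,
      forall a x y, star (a *: x + y) = a^* *: star x + star y
    & forall x y, star (x * y) = star y * star x].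

(* The *-algebra A is generated by 1 and the d i. *)
Definition star_generated (C : numClosedFieldType) (A : algType C)
    (star : A -> A) (p : nat) (d : 'I_p -> A) : Prop :=
  forall S : A -> Prop,
    S 1 -> (forall i, S (d i)) ->
    (forall (a : C) x y, S x -> S y -> S (a *: x + y)) ->
    (forall x y, S x -> S y -> S (x * y)) ->
    (forall x, S x -> S (star x)) ->
  forall x, S x.

Definition tracial_state (C : numClosedFieldType) (A : algType C)
    (star : A -> A) (psi : {scalar A}) : Prop :=
  [/\ psi 1 = 1,
      forall x y, psi (x * y) = psi (y * x)
    & forall x, 0 <= psi (star x * x)].

Section FockSpaces.
Variables (C : numClosedFieldType) (A : algType C).

Definition multilinear (W : lmodType C) (f : seq A -> W) : Prop :=
  forall (u v : seq A) (a : C) (x y : A),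
    f (u ++ (a *: x + y) :: v) = a *: f (u ++ x :: v) + f (u ++ y :: v).

Definition tensor_rel (r : {freeg (seq A) / C}) : Prop :=
  exists (u v : seq A) (a : C) (x y : A),
    r = word C (u ++ (a *: x + y) :: v)
        - (a *: word C (u ++ x :: v) + word C (u ++ y :: v)).

Definition rotation_rel (r : {freeg (seq A) / C}) : Prop :=
  exists (x : A) (u : seq A), r = word C (x :: u) - word C (rcons u x).

Definition cyclic_rel (r : {freeg (seq A) / C}) : Prop :=
  tensor_rel r \/ rotation_rel r.

(* The relations preserve the length of words, so that these modules are the  *)
(* direct sums over n of the algebraic tensor powers of A, respectively of    *)
(* their quotients by cyclic rotation. The empty word is the vacuum.          *)
Definition fock : Type := presented tensor_rel.
Definition cyc_fock : Type := presented cyclic_rel.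

HB.instance Definition _ := GRing.Lmodule.on fock.
HB.instance Definition _ := GRing.Lmodule.on cyc_fock.

Definition tensor (w : seq A) : fock := pgen tensor_rel w.
Definition circ (w : seq A) : cyc_fock := pgen cyclic_rel w.
Definition vacuum : fock := tensor [::].

Lemma multilinear_rel (W : lmodType C) (f : seq A -> W) :
  multilinear f -> forall r, tensor_rel r -> fglift f r = 0.
Proof.
move=> fM r [u [v [a [x [y ->]]]]].
by rewrite fgliftB fgliftD fgliftZ !fglift_word fM subrr.
Qed.

Lemma cyclic_relE (W : lmodType C) (f : seq A -> W) :
  multilinear f -> (forall x u, f (x :: u) = f (rcons u x)) ->
  forall r, cyclic_rel r -> fglift f r = 0.
Proof.
move=> fM fR r [/(multilinear_rel fM)//|[x [u ->]]].
by rewrite fgliftB !fglift_word fR subrr.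
Qed.

Lemma tensor_multilinear : multilinear tensor.
Proof.
move=> u v a x y; apply/eqP; rewrite -subr_eq0; apply/eqP.
rewrite -(pgen_rel (rel := tensor_rel) (r := word C (u ++ (a *: x + y) :: v)
        - (a *: word C (u ++ x :: v) + word C (u ++ y :: v)))); last first.
  by exists u, v, a, x, y.
by rewrite [RHS]raddfB [X in _ = _ - X]pprojD pproj_scale.
Qed.

Lemma circ_multilinear : multilinear circ.
Proof.
move=> u v a x y; apply/eqP; rewrite -subr_eq0; apply/eqP.
rewrite -(pgen_rel (rel := cyclic_rel) (r := word C (u ++ (a *: x + y) :: v)
        - (a *: word C (u ++ x :: v) + word C (u ++ y :: v)))); last first.
  by left; exists u, v, a, x, y.
by rewrite [RHS]raddfB [X in _ = _ - X]pprojD pproj_scale.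
Qed.

Lemma circ_rot x u : circ (x :: u) = circ (rcons u x).
Proof.
apply/eqP; rewrite -subr_eq0; apply/eqP.
rewrite -(pgen_rel (rel := cyclic_rel) (r := word C (x :: u) - word C (rcons u x))).
  by rewrite [RHS]raddfB.
by right; exists x, u.
Qed.

Variables (star : A -> A) (psi : {scalar A}).

Definition ip (x y : A) : C := psi (star y * x).

Definition creation (d : A) : fock -> fock :=
  plift (fun w => tensor (d :: w)).
Definition annihilation (d : A) : fock -> fock :=
  plift (fun w => if w is f :: r then ip f d *: tensor r else 0).
Definition preservation (d : A) : fock -> fock :=
  plift (fun w => if w is f :: r then tensor (d * f :: r) else 0).

Definition pfock (d : A) (xi : fock) : fock :=
  creation d xi + annihilation (star d) xi + preservation d xi + psi d *: xi.

(* The first argument only bounds the recursion (see cyc_word2). *)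
Fixpoint cyc_word_rec (n : nat) (w : seq A) : cyc_fock :=
  match n, w with
  | n'.+1, x :: (y :: r) =>
      let m := belast y r in let z := last y r in
      circ w + circ (z * x :: m) + psi (x * z) *: cyc_word_rec n' m
  | _.+1, [:: x] => circ [:: x]
  | _, _ => 0
  end.
Definition cyc_word (w : seq A) : cyc_fock := cyc_word_rec (size w) w.
Definition cyc_map : fock -> cyc_fock := plift cyc_word.

Definition cyc_word_ip (v w : seq A) : C :=
  if size v == size w then
    \sum_(k < size v) \prod_(i < size v)
       ip (nth 0 v i) (nth 0 w ((i + k) %% size v))
  else 0.

(* The sesquilinear extension of cyc_word_ip: linear in xi, antilinear in eta. *)
Definition cyc_ip (xi eta : cyc_fock) : C :=
  plift (fun v => (plift (fun w => (cyc_word_ip v w)^* : C^o) eta)^* : C^o) xi.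

Fact creation_multilinear d : multilinear (fun w => tensor (d :: w)).
Proof. by move=> u v a x y; rewrite -!cat_cons tensor_multilinear. Qed.

Fact annihilation_multilinear d :
  multilinear (fun w => if w is f :: r then ip f d *: tensor r else 0).
Proof.
move=> [|z u] v a x y /=.
  by rewrite /ip mulrDr -scalerAr linearP scalerDl scalerA.
by rewrite tensor_multilinear scalerDr !scalerA [a * _]mulrC.
Qed.

Fact preservation_multilinear d :
  multilinear (fun w => if w is f :: r then tensor (d * f :: r) else 0).
Proof.
move=> [|z u] v a x y /=.
  by rewrite mulrDr -scalerAr -[_ :: _]cat0s tensor_multilinear.
by rewrite -!cat_cons tensor_multilinear.
Qed.

Lemma creation_linear d : linear (creation d).
Proof. exact: plift_linear (multilinear_rel (creation_multilinear d)). Qed.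

Lemma creation_tensor d w : creation d (tensor w) = tensor (d :: w).
Proof. by rewrite [LHS](plift_gen (multilinear_rel (creation_multilinear d))). Qed.

Lemma annihilation_linear d : linear (annihilation d).
Proof. exact: plift_linear (multilinear_rel (annihilation_multilinear d)). Qed.

Lemma annihilation_vacuum d : annihilation d vacuum = 0.
Proof. by rewrite [LHS](plift_gen (multilinear_rel (annihilation_multilinear d))). Qed.

Lemma annihilation_tensor d f w :
  annihilation d (tensor (f :: w)) = ip f d *: tensor w.
Proof. by rewrite [LHS](plift_gen (multilinear_rel (annihilation_multilinear d))). Qed.

Lemma preservation_linear d : linear (preservation d).
Proof. exact: plift_linear (multilinear_rel (preservation_multilinear d)). Qed.

Lemma preservation_vacuum d : preservation d vacuum = 0.
Proof. by rewrite [LHS](plift_gen (multilinear_rel (preservation_multilinear d))). Qed.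

Lemma preservation_tensor d f w :
  preservation d (tensor (f :: w)) = tensor (d * f :: w).
Proof. by rewrite [LHS](plift_gen (multilinear_rel (preservation_multilinear d))). Qed.

Fact cyc_word_recE n x y r : cyc_word_rec n.+1 (x :: y :: r) =
  circ (x :: y :: r) + circ (last y r * x :: belast y r)
  + psi (x * last y r) *: cyc_word_rec n (belast y r).
Proof. by []. Qed.

Fact cyc_word_rec_fuel n w : (size w <= n)%N -> cyc_word_rec n w = cyc_word w.
Proof.
elim: n {-2}n (leqnn n) w => [|k IH] [|n] nk [|x [|y r]] // sw.
rewrite /cyc_word [size _]/= !cyc_word_recE.
have sr : (size r < n)%N by [].
rewrite (IH n) ?size_belast //; last exact: ltnW.
by rewrite (IH (size r).+1) ?size_belast //; apply: leq_trans sr nk.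
Qed.

Lemma cyc_word0 : cyc_word [::] = 0. Proof. by []. Qed.

Lemma cyc_word1 x : cyc_word [:: x] = circ [:: x]. Proof. by []. Qed.

Lemma cyc_word2 x m y :
  cyc_word (x :: rcons m y) =
  circ (x :: rcons m y) + circ (y * x :: m) + psi (x * y) *: cyc_word m.
Proof.
rewrite [in LHS]/cyc_word; case: m => [|z m] //.
rewrite rcons_cons [size _]/= cyc_word_recE belast_rcons last_rcons.
by rewrite cyc_word_rec_fuel //= size_rcons.
Qed.

Fact addrACA6 (V : zmodType) (a b c d e f : V) :
  (a + b) + (c + d) + (e + f) = (a + c + e) + (b + d + f).
Proof. by rewrite (addrACA a) (addrACA (a + c)). Qed.

Fact cyc_word_multilinear : multilinear cyc_word.
Proof.
move=> u v; move: {2}(size u + size v)%N (leqnn (size u + size v)%N) => n.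
elim: n u v => [|n IH] u v suv a x y.
  case: u v suv => [|//] [|//] _; exact: (circ_multilinear [::] [::]).
case: u suv => [|b u]; case/lastP: v => [|v c] suv.
- exact: (circ_multilinear [::] [::]).
- rewrite /= !cyc_word2 mulrDl mulrDr -scalerAl -scalerAr linearP scalerDl.
  have := circ_multilinear [::] (rcons v c) a x y => /= ->.
  have := circ_multilinear [::] v a (c * x) (c * y) => /= ->.
  by rewrite !scalerDr !scalerA addrACA6.
- rewrite /= !cats1 !cyc_word2 mulrDl mulrDr -scalerAl -scalerAr linearP scalerDl.
  have := circ_multilinear (b :: u) [::] a x y; rewrite /= !cats1 => ->.
  have := circ_multilinear [::] u a (x * b) (y * b) => /= ->.
  by rewrite !scalerDr !scalerA addrACA6.
- rewrite /= -!rcons_cons -!rcons_cat !cyc_word2 IH; last first.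
    by move: suv; rewrite /= size_rcons addnS ltnS => /ltnW.
  have := circ_multilinear (b :: u) (rcons v c) a x y.
  rewrite /= -!rcons_cons -!rcons_cat => ->.
  have := circ_multilinear (c * b :: u) v a x y => /= ->.
  by rewrite !scalerDr !scalerA [psi _ * a]mulrC addrACA6.
Qed.

Lemma cyc_map_linear : linear cyc_map.
Proof. exact: plift_linear (multilinear_rel cyc_word_multilinear). Qed.

Lemma cyc_map_tensor w : cyc_map (tensor w) = cyc_word w.
Proof. by rewrite [LHS](plift_gen (multilinear_rel cyc_word_multilinear)). Qed.

Section InnerProduct.
Hypothesis star_alg : star_algebra star.

Let ipPl a x y z : ip (a *: x + y) z = a * ip x z + ip y z.
Proof. by rewrite /ip mulrDr -scalerAr linearP. Qed.

Let ipPr a x y z : ip z (a *: x + y) = a^* * ip z x + ip z y.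
Proof. by case: star_alg => _ sP _; rewrite /ip sP mulrDl -scalerAl linearP. Qed.

Fact cyc_word_ipE n v w : size v = n.+1 -> size w = n.+1 ->
  cyc_word_ip v w =
  \sum_(k : 'I_n.+1) \prod_(i : 'I_n.+1) ip (nth 0 v i) (nth 0 w (i + k)%R).
Proof. by move=> sv sw; rewrite /cyc_word_ip sv sw eqxx. Qed.

Let nth_slot (u v : seq A) z i :
  i != size u -> nth 0 (u ++ z :: v) i = nth 0 (u ++ 0 :: v) i.
Proof.
rewrite !nth_cat; case: ltngtP => // ui _.
by case: (i - size u)%N (subn_gt0 (size u) i) => [|k] //; rewrite ui.
Qed.

Let nth_slot1 (u v : seq A) z : nth 0 (u ++ z :: v) (size u) = z.
Proof. by rewrite nth_cat ltnn subnn. Qed.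

Fact cyc_word_ip_linl w u v a x y :
  cyc_word_ip (u ++ (a *: x + y) :: v) w =
  a * cyc_word_ip (u ++ x :: v) w + cyc_word_ip (u ++ y :: v) w.
Proof.
have s z : size (u ++ z :: v) = (size u + size v).+1 by rewrite size_cat addnS.
have [sw|sw] := eqVneq (size w) (size u + size v).+1; last first.
  by rewrite /cyc_word_ip !s ![_ == size w]eq_sym (negbTE sw) mulr0 addr0.
rewrite !(cyc_word_ipE (s _) sw) mulr_sumr -big_split /=; apply: eq_bigr => k _.
have uP : (size u < (size u + size v).+1)%N by rewrite ltnS leq_addr.
pose j := Ordinal uP.
have E z : \prod_(i : 'I_(size u + size v).+1)
    ip (nth 0 (u ++ z :: v) i) (nth 0 w (i + k)%R) =
    ip z (nth 0 w (j + k)%R) * \prod_(i : 'I_(size u + size v).+1 | i != j)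
      ip (nth 0 (u ++ 0 :: v) i) (nth 0 w (i + k)%R).
  rewrite (bigD1 j) //= nth_slot1; congr (_ * _).
  by apply: eq_bigr => i ij; rewrite nth_slot.
by rewrite !E ipPl mulrDl mulrA.
Qed.

Fact cyc_word_ip_linr w u v a x y :
  cyc_word_ip w (u ++ (a *: x + y) :: v) =
  a^* * cyc_word_ip w (u ++ x :: v) + cyc_word_ip w (u ++ y :: v).
Proof.
have s z : size (u ++ z :: v) = (size u + size v).+1 by rewrite size_cat addnS.
have [sw|sw] := eqVneq (size w) (size u + size v).+1; last first.
  by rewrite /cyc_word_ip !s (negbTE sw) mulr0 addr0.
rewrite !(cyc_word_ipE sw (s _)) mulr_sumr -big_split /=; apply: eq_bigr => k _.
have uP : (size u < (size u + size v).+1)%N by rewrite ltnS leq_addr.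
pose j := Ordinal uP.
have E z : \prod_(i : 'I_(size u + size v).+1)
    ip (nth 0 w i) (nth 0 (u ++ z :: v) (i + k)%R) =
    ip (nth 0 w (j - k)%R) z * \prod_(i : 'I_(size u + size v).+1 | i != j - k)
      ip (nth 0 w i) (nth 0 (u ++ 0 :: v) (i + k)%R).
  rewrite (bigD1 (j - k)) // subrK nth_slot1; congr (_ * _).
  apply: eq_bigr => i ij; rewrite nth_slot //.
  apply: contra ij => /eqP ij; rewrite -(addrK k i).
  by apply/eqP; congr (_ - _); apply: val_inj.
by rewrite !E ipPr mulrDl mulrA.
Qed.

Let nth_rcons_rot n x (u : seq A) (i : 'I_n.+1) : size u = n ->
  nth 0 (rcons u x) i = nth 0 (x :: u) (i + inord 1 : 'I_n.+1)%R.
Proof.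
case: n i => [|n] i su; first by case: u su => //; rewrite !ord1.
rewrite nth_rcons su /= inordK // addn1; have := ltn_ord i.
rewrite ltnS leq_eqVlt; case: eqP => [->|_] /=; first by rewrite ltnn modnn.
by move=> ii; rewrite ii modn_small.
Qed.

Fact cyc_word_ip_rotr w x u : cyc_word_ip w (x :: u) = cyc_word_ip w (rcons u x).
Proof.
have s1 : size (x :: u) = (size u).+1 by [].
have s2 : size (rcons u x) = (size u).+1 by rewrite size_rcons.
have [sw|sw] := eqVneq (size w) (size u).+1; last first.
  by rewrite /cyc_word_ip s1 s2 (negbTE sw).
rewrite (cyc_word_ipE sw s1) (cyc_word_ipE sw s2).
rewrite (reindex_inj (addIr (inord 1))); apply: eq_bigr => k _.
by apply: eq_bigr => i _; rewrite nth_rcons_rot // addrA.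
Qed.

Fact cyc_word_ip_rotl w x u : cyc_word_ip (x :: u) w = cyc_word_ip (rcons u x) w.
Proof.
have s1 : size (x :: u) = (size u).+1 by [].
have s2 : size (rcons u x) = (size u).+1 by rewrite size_rcons.
have [sw|sw] := eqVneq (size w) (size u).+1; last first.
  by rewrite /cyc_word_ip s1 s2 eq_sym (negbTE sw).
rewrite (cyc_word_ipE s1 sw) (cyc_word_ipE s2 sw).
rewrite [RHS](reindex_inj (addIr (inord 1))); apply: eq_bigr => k _.
rewrite (reindex_inj (addIr (inord 1))); apply: eq_bigr => i _.
by rewrite nth_rcons_rot // addrAC addrA.
Qed.

Let ip_relr v r : cyclic_rel r ->
  fglift (fun w => (cyc_word_ip v w)^* : C^o) r = 0.
Proof.
apply: cyclic_relE => [u w a x y|x u]; last by rewrite cyc_word_ip_rotr.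
by rewrite cyc_word_ip_linr rmorphD rmorphM /= conjCK.
Qed.

Let ip_rell eta r : cyclic_rel r ->
  fglift (fun v => (plift (fun w => (cyc_word_ip v w)^* : C^o)
                          (eta : cyc_fock))^* : C^o) r = 0.
Proof.
apply: cyclic_relE => [u w a x y|x u]; last first.
  congr (_ ^*); congr (plift _ _); apply/funext => w.
  by rewrite cyc_word_ip_rotl.
have -> : plift (fun w' => (cyc_word_ip (u ++ (a *: x + y) :: w) w')^* : C^o) eta
   = a^* * plift (fun w' => (cyc_word_ip (u ++ x :: w) w')^* : C^o) eta
     + plift (fun w' => (cyc_word_ip (u ++ y :: w) w')^* : C^o) eta.
  elim/presented_ind: eta => [|b k q IH].
    rewrite -[0](_ : pproj cyclic_rel 0 = 0); last exact: raddf0.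
    rewrite !(plift_pproj (ip_relr _)) -[0](subrr 0) !fgliftB !subrr.
    by rewrite mulr0 addr0.
  rewrite !(plift_linear (ip_relr _)) IH !(plift_gen (ip_relr _)).
  rewrite cyc_word_ip_linl rmorphD rmorphM /= !/(GRing.scale _ _) /=.
  by rewrite !mulrDr !mulrA [a^* * b]mulrC -!addrA; congr (_ + _); rewrite addrCA.
by rewrite rmorphD rmorphM /= conjCK.
Qed.

Lemma cyc_ip_linear_l eta a x y :
  cyc_ip (a *: x + y) eta = a * cyc_ip x eta + cyc_ip y eta.
Proof. exact: (plift_linear (ip_rell eta)). Qed.

Lemma cyc_ip_circ v w : cyc_ip (circ v) (circ w) = cyc_word_ip v w.
Proof.
rewrite /cyc_ip [LHS](plift_gen (ip_rell _)) [X in X^* = _](plift_gen (ip_relr _)).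
by rewrite conjCK.
Qed.

Lemma cyc_ip_antilinear_r xi a x y :
  cyc_ip xi (a *: x + y) = a^* * cyc_ip xi x + cyc_ip xi y.
Proof.
have E eta v : cyc_ip (circ v) eta = (plift (fun w => (cyc_word_ip v w)^* : C^o) eta)^*.
  by rewrite [LHS](plift_gen (ip_rell _)).
have Z eta : cyc_ip 0 eta = 0.
  by have := cyc_ip_linear_l eta (-1) 0 0; rewrite scaler0 addr0 mulN1r addNr.
elim/presented_ind: xi => [|b k q IH]; first by rewrite !Z mulr0 addr0.
rewrite !cyc_ip_linear_l IH !E (plift_linear (ip_relr _)) rmorphD rmorphM /=.
by rewrite !mulrDr !mulrA [a^* * b]mulrC -!addrA; congr (_ + _); rewrite addrCA.
Qed.

End InnerProduct.
End FockSpaces.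

Section Probability.
Variables (disp : measure_display) (T : measurableType disp) (R : realType).
Variable P : probability T R.

Definition mutually_independent (disp' : measure_display)
    (S : measurableType disp') (I : finType) (Y : I -> T -> S) : Prop :=
  forall (J : {set I}) (B : I -> set S), (forall i, measurable (B i)) ->
    P (\bigcap_(i in [set` J]) Y i @^-1` B i) =
    (\prod_(i in J) P (Y i @^-1` B i))%E.

(* Centered real normal law of variance v; the second argument of normal_prob *)
(* is the standard deviation.                                                 *)
Definition centered_normal (Y : T -> measurableTypeR R) (v : R) : Prop :=
  measurable_fun setT Y /\
  forall B : set (measurableTypeR R), measurable B ->
    P (Y @^-1` B) = normal_prob 0 (Num.sqrt v) B.

(* Complex numbers as pairs of reals, with the product (Borel) sigma-algebra. *)
Definition re_im (z : R[i]) : measurableTypeR R * measurableTypeR R :=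
  (complex.Re z, complex.Im z).

(* Centered (circular) complex Gaussian with E |Z|^2 = v.                     *)
Definition complex_gaussian (Z : T -> R[i]) (v : R) : Prop :=
  [/\ centered_normal (fun t => complex.Re (Z t)) (v / 2),
      centered_normal (fun t => complex.Im (Z t)) (v / 2)
    & mutually_independent (fun (b : bool) t =>
        (if b then complex.Re (Z t) else complex.Im (Z t)) : measurableTypeR R)].

Definition complex_gaussian_matrix (N : nat) (X : T -> 'M[R[i]]_N) : Prop :=
  (forall i j, complex_gaussian (fun t => X t i j) N%:R^-1) /\
  mutually_independent (fun (ij : 'I_N * 'I_N) t => re_im (X t ij.1 ij.2)).

Definition cexpectation (Z : T -> R[i]) : R[i] :=
  Complex (fine 'E_P[fun t => complex.Re (Z t)])
          (fine 'E_P[fun t => complex.Im (Z t)]).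

Definition k2 (a b : T -> R[i]) : R[i] :=
  cexpectation (fun t => a t * b t) - cexpectation a * cexpectation b.

End Probability.

Definition adjmx (C : numClosedFieldType) (N : nat) (M : 'M[C]_N) : 'M[C]_N :=
  map_mx Num.conj M^T.

Definition wishart (C : numClosedFieldType) (N : nat) (X D : 'M[C]_N) : 'M[C]_N :=
  adjmx X *m D *m X.

(* D is the family (D_i^(N)), indexed by N and i. Words run over the letters  *)
(* d_i and their adjoints, i.e. convergence of all *-moments: the right-hand  *)
(* side of the limit theorem involves psi (star d_j * d_i), which the moments *)
(* of words in the d_i alone do not determine.                                *)
Definition converges_in_distribution (R : realType) (p : nat)
    (D : forall N, 'I_p -> 'M[R[i]]_N)
    (A : algType R[i]) (star : A -> A) (psi : {scalar A}) (d : 'I_p -> A) : Prop :=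
  forall w : seq ('I_p * bool),
    (fun N => N%:R^-1 *
       \tr (\prod_(e <- w) (if e.2 then adjmx (D N e.1) else D N e.1)))
    @ \oo --> (psi (\prod_(e <- w) (if e.2 then star (d e.1) else d e.1)) : R[i]^o).

(* p(d_1) ... p(d_n) applied to the vacuum. *)
Definition pfock_vacuum (C : numClosedFieldType) (A : algType C)
    (star : A -> A) (psi : {scalar A}) (n : nat) (d : 'I_n -> A) : fock A :=
  foldr (fun k xi => pfock star psi (d k) xi) (vacuum A) (enum 'I_n).

(* Main.v *)
Require Import Defs.
From HB Require Import structures.
From mathcomp Require Import all_boot all_order all_algebra complex.
From mathcomp Require Import all_classical all_reals all_analysis.
From mathcomp Require Import measurable_realfun normal_distribution.
From mathcomp Require Import ring lra zify.

Import Order.TTheory GRing.Theory Num.Theory.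
Import numFieldNormedType.Exports.

Local Open Scope classical_set_scope.
Local Open Scope ring_scope.

(** Both sides of the limit are determined by one and the same recursion on the
    length of the first word, so no permutation or annular diagram is ever
    enumerated.

    Matrix side. Write T(w) for the trace of P(D_1)...P(D_n), w = D_1...D_n.
    Gaussian integration by parts in the factor X that follows D_1 contracts it
    with each adjoint X^* of the expression. Contraction inside T(w) splits the
    trace in two and merges D_1 with another letter; contraction with a second
    trace T(v) glues the two traces into a single one. All words so obtained are
    again products of matrices P(D), with one X fewer, and this closed system is
    loop_equation. For the traces centered at their means, induction on the total
    length shows that central moments of every order stay bounded and that the
    mean of T(w)/N stays bounded. Third central moments then contribute O(1/N),
    and the loop equation passes to the limit. With m(w) the limit of the mean of
    T(w)/N and k(w, v) the limit of the covariances, and with sums over the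
    splittings w = a x b or v = a x b,
      m(dw) = psi(d) m(w) + sum m(a) m(dx b),
      k(dw, v) = psi(d) k(w, v) + sum_w (m(a) k(dx b, v) + m(dx b) k(a, v))
                 + sum_v m(dx b a w)
    (cvg_covariance).

    Fock side. The vacuum moments of the operators p(d) obey the first recursion
    (vmoment_cons): decompose the vector p(w) Omega according to the letter that
    last touched its first leg (first_leg). For c p(w) Omega the same
    decomposition, together with the one along the last leg (last_leg), gives the
    first terms of the second recursion and leaves the vector
      r = [d (x) f_1 ... f_n] + [f_n d (x) f_1 ... f_(n-1)],  f = p(w) Omega
    (pval_cyc_cons). It remains to pair r with c p(v) Omega. The adjoint of
    f |-> r cuts a circular tensor open at each of its entries; applied to the
    cyclic reduction c f it equals a difference quotient of f, a sum of
    (left part) (x) (right part), followed by the Wick product that multiplies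
    the right part onto the left one (cyclic_reduction_diff_quot). Both maps
    intertwine the operators p(d) (pdual_diff_quot, pdual_wick), so on p(v) Omega
    they give the sum over the letters of v of rotated products of p's applied
    to the vacuum (pval_cyclic_reduction). Moving these products to the other
    side of the Fock space pairing produces the vacuum moments m(dx b a w)
    (fock_cov_cons). *)

Set Implicit Arguments.
Unset Strict Implicit.
Unset Printing Implicit Defensive.

(** * Words and vacuum moments on the full Fock space *)

Section Splits.
Variable T : Type.
Implicit Types w u : seq T.

(** Every recursion below sums over the ways to single out one letter of a word. *)
Fixpoint splits w : seq (seq T * T * seq T) :=
  if w is x :: w' then
    ([::], x, w') :: [seq (x :: s.1.1, s.1.2, s.2) | s <- splits w']
  else [::].

Lemma sum_splits_cons (V : nmodType) (F : seq T -> T -> seq T -> V) x w :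
  \sum_(s <- splits (x :: w)) F s.1.1 s.1.2 s.2 =
  F [::] x w + \sum_(s <- splits w) F (x :: s.1.1) s.1.2 s.2.
Proof. by rewrite /= big_cons big_map. Qed.

Lemma sum_splits_cat (V : nmodType) (F : seq T -> T -> seq T -> V) u w :
  \sum_(s <- splits (u ++ w)) F s.1.1 s.1.2 s.2 =
  \sum_(s <- splits u) F s.1.1 s.1.2 (s.2 ++ w) +
  \sum_(s <- splits w) F (u ++ s.1.1) s.1.2 s.2.
Proof.
elim: u F => [|x u IH] F; first by rewrite /= big_nil add0r.
rewrite cat_cons sum_splits_cons (IH (fun a => F (x :: a))) addrA.
by rewrite (sum_splits_cons (fun a y b => F a y (b ++ w))).
Qed.

Lemma sum_splits_rcons (V : nmodType) (F : seq T -> T -> seq T -> V) w z :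
  \sum_(s <- splits (rcons w z)) F s.1.1 s.1.2 s.2 =
  \sum_(s <- splits w) F s.1.1 s.1.2 (rcons s.2 z) + F w z [::].
Proof.
rewrite -cats1 sum_splits_cat /= big_seq1 /= cats0; congr (_ + _).
by apply: eq_bigr => s _; rewrite cats1.
Qed.

Lemma sum_splits_splits (V : nmodType)
    (F : seq T -> T -> seq T -> T -> seq T -> V) w :
  \sum_(s <- splits w) \sum_(t <- splits s.2) F s.1.1 s.1.2 t.1.1 t.1.2 t.2 =
  \sum_(s <- splits w) \sum_(t <- splits s.1.1) F t.1.1 t.1.2 t.2 s.1.2 s.2.
Proof.
elim: w F => [|x w IH] F; first by rewrite !big_nil.
rewrite (sum_splits_cons (fun a b c =>
  \sum_(t <- splits c) F a b t.1.1 t.1.2 t.2)).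
rewrite (IH (fun a b c d e => F (x :: a) b c d e)).
rewrite (sum_splits_cons (fun a b c =>
  \sum_(t <- splits a) F t.1.1 t.1.2 t.2 b c)) /= big_nil add0r -big_split.
apply: eq_bigr => s _.
by rewrite (sum_splits_cons (fun a b c => F a b c s.1.2 s.2)).
Qed.

Lemma eq_sum_splits (V : nmodType) (F G : seq T -> T -> seq T -> V) w :
  (forall a x b, (size a + size b < size w)%N -> F a x b = G a x b) ->
  \sum_(s <- splits w) F s.1.1 s.1.2 s.2 = \sum_(s <- splits w) G s.1.1 s.1.2 s.2.
Proof.
elim: w F G => [|x w IH] F G FG; first by rewrite !big_nil.
rewrite sum_splits_cons (sum_splits_cons G) FG ?(IH (fun a => F (x :: a)) (fun a => G (x :: a))) //.
by move=> a y b ab; apply: FG.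
Qed.

End Splits.

Lemma sum_splits_map (T U : Type) (V : nmodType) (h : T -> U)
    (F : seq U -> U -> seq U -> V) w :
  \sum_(s <- splits (map h w)) F s.1.1 s.1.2 s.2 =
  \sum_(s <- splits w) F (map h s.1.1) (h s.1.2) (map h s.2).
Proof.
elim: w F => [|x w IH] F; first by rewrite !big_nil.
rewrite map_cons sum_splits_cons (IH (fun a => F (h x :: a))).
by rewrite (sum_splits_cons (fun a y b => F (map h a) (h y) (map h b))).
Qed.

Lemma sum_splits_rev (T : Type) (V : nmodType)
    (F : seq T -> T -> seq T -> V) w :
  \sum_(s <- splits (rev w)) F s.1.1 s.1.2 s.2 =
  \sum_(s <- splits w) F (rev s.2) s.1.2 (rev s.1.1).
Proof.
elim: w F => [|x w IH] F; first by rewrite !big_nil.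
rewrite rev_cons sum_splits_rcons (IH (fun a y b => F a y (rcons b x)))
  (sum_splits_cons (fun a y b => F (rev b) y (rev a))) addrC; congr (_ + _).
by apply: eq_bigr => s _; rewrite rev_cons.
Qed.

Section DualFock.
Variables (C : numClosedFieldType) (A : algType C) (chi : A -> C).
Implicit Types (phi : seq A -> C) (d : A) (v w f : seq A).

(** Vectors of the Fock space are handled through functionals given by their
    values phi on elementary tensors: pdual d is the transpose of p(d), where chi
    is the state (or its conjugate, for antilinear functionals). All identities
    then concern functions on words, without any quotient. *)
Definition pdual d phi : seq A -> C := fun w =>
  phi (d :: w) + chi d * phi w
  + (if w is f :: r then phi (d * f :: r) + chi (d * f) * phi r else 0).

Definition pduals v phi : seq A -> C := foldl (fun phi d => pdual d phi) phi v.

(** The value of phi on p(d_1)...p(d_n) Omega. The letter d_1 acts last, so its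
    transpose comes first. *)
Definition pval v phi : C := pduals v phi [::].

Lemma pduals_cat u v phi : pduals (u ++ v) phi = pduals v (pduals u phi).
Proof. exact: foldl_cat. Qed.

Lemma pval_cat u v phi : pval (u ++ v) phi = pval v (pduals u phi).
Proof. by rewrite /pval pduals_cat. Qed.

Lemma pval_cons d v phi : pval (d :: v) phi = pval v (pdual d phi).
Proof. by []. Qed.

Lemma pval1 d phi : pval [:: d] phi = phi [:: d] + chi d * phi [::].
Proof. by rewrite /pval /= /pdual addr0. Qed.

Lemma eq_pval v phi phi' : phi =1 phi' -> pval v phi = pval v phi'.
Proof. by move=> /funext ->. Qed.

Lemma pduals_lin v (a : C) phi phi' :
  pduals v (fun f => a * phi f + phi' f) =
  fun f => a * pduals v phi f + pduals v phi' f.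
Proof.
elim: v phi phi' => [|d v IH] phi phi' //=.
rewrite -IH; congr (pduals v _); apply/funext => -[|g r]; rewrite /pdual; ring.
Qed.

Lemma pval_lin v (a : C) phi phi' :
  pval v (fun f => a * phi f + phi' f) = a * pval v phi + pval v phi'.
Proof. by rewrite /pval pduals_lin. Qed.

Lemma pval0 v : pval v (fun=> 0) = 0.
Proof.
transitivity (pval v (fun f => -1 * (fun=> 0) f + (fun=> 0) f)).
  by apply: eq_pval => f; rewrite mulr0 addr0.
by rewrite pval_lin; ring.
Qed.

Lemma pvalD v phi phi' : pval v (fun f => phi f + phi' f) = pval v phi + pval v phi'.
Proof. by rewrite -[pval v phi]mul1r -pval_lin; apply: eq_pval => f; rewrite mul1r. Qed.

Lemma pvalZ v (a : C) phi : pval v (fun f => a * phi f) = a * pval v phi.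
Proof.
by rewrite -[RHS]addr0 -(pval0 v) -pval_lin; apply: eq_pval => f; rewrite addr0.
Qed.

Lemma pdualsD v phi phi' :
  pduals v (fun f => phi f + phi' f) = fun f => pduals v phi f + pduals v phi' f.
Proof.
have := pduals_lin v 1 phi phi'; under eq_fun do rewrite mul1r.
by move=> ->; apply/funext => f; rewrite mul1r.
Qed.

Lemma pduals0 v : pduals v (fun=> 0) = fun=> 0.
Proof.
elim: v => [//|d v IH] /=; rewrite -[RHS]IH; congr (pduals v _).
by apply/funext => -[|g f]; rewrite /pdual; ring.
Qed.

Lemma pdualsZ v (a : C) phi :
  pduals v (fun f => a * phi f) = fun f => a * pduals v phi f.
Proof.
have := pduals_lin v a phi (fun=> 0); under eq_fun do rewrite addr0.
by move=> ->; apply/funext => f; rewrite pduals0 addr0.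
Qed.

Lemma pval_sum v (I : Type) (r : seq I) (F : I -> seq A -> C) :
  pval v (fun f => \sum_(i <- r) F i f) = \sum_(i <- r) pval v (F i).
Proof.
elim: r => [|i r IH].
  by rewrite big_nil -[RHS](pval0 v); apply: eq_pval => f; rewrite big_nil.
by rewrite big_cons -IH -pvalD; apply: eq_pval => f; rewrite big_cons.
Qed.

Definition vac : seq A -> C := fun f => (f == [::])%:R.

Lemma vac_nil : vac [::] = 1. Proof. by rewrite /vac eqxx. Qed.

Lemma vac_cons x f : vac (x :: f) = 0. Proof. by []. Qed.

Definition vmoment v : C := pval v vac.

Lemma vmoment_nil : vmoment [::] = 1. Proof. by rewrite /vmoment /pval /= /vac eqxx. Qed.

(** The transpose of l(d) + Lambda(d); lower_dual is that of l^*(star d) + psi(d).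
    The first part touches the first leg without closing it, the second one
    leaves the remaining legs as they are. *)
Definition raise_dual d phi : seq A -> C := fun w =>
  phi (d :: w) + (if w is f :: r then phi (d * f :: r) else 0).

Definition lower_dual d phi : seq A -> C := fun w =>
  chi d * phi w + (if w is f :: r then chi (d * f) * phi r else 0).

Lemma pdualE d phi : pdual d phi = fun w => raise_dual d phi w + lower_dual d phi w.
Proof. by apply/funext => -[|g r]; rewrite /pdual /raise_dual /lower_dual; ring. Qed.

(** After a leg has been touched by x, closing it with d has the effect of the
    single letter d x: this is why letters merge. *)
Lemma raise_lower_dual x d phi f :
  raise_dual x (lower_dual d phi) f = lower_dual (d * x) phi f + chi d * raise_dual x phi f.
Proof. by case: f => [|g r]; rewrite /raise_dual /lower_dual ?mulrA; ring. Qed.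

Lemma pval_lower_dual d w phi : pval w (lower_dual d phi) = pval (d :: w) phi - pval w (raise_dual d phi).
Proof. by rewrite pval_cons pdualE pvalD addrC addKr. Qed.

Lemma raise_dual_vac d : raise_dual d vac = fun=> 0.
Proof. by apply/funext => -[|g r]; rewrite /raise_dual /vac ?addr0. Qed.

Let first_leg_at w := forall phi, pval w phi = vmoment w * phi [::] +
    \sum_(s <- splits w) vmoment s.1.1 * pval s.2 (raise_dual s.1.2 phi).

Let vmoment_rec_at w := forall d, vmoment (d :: w) = chi d * vmoment w +
    \sum_(s <- splits w) vmoment s.1.1 * vmoment (d * s.1.2 :: s.2).

(** The closing part of p(d) acts on the first-leg decomposition of p(u) Omega by
    merging d with the letter that last touched the leg. The double sums on both
    sides agree by sum_splits_splits. *)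
Let first_leg_step u phi d :
  (forall v, (size v <= size u)%N -> first_leg_at v) ->
  (forall v, (size v < size u)%N -> vmoment_rec_at v) ->
  pval (d :: u) phi =
    (chi d * vmoment u + \sum_(s <- splits u) vmoment s.1.1 * vmoment (d * s.1.2 :: s.2)) * phi [::]
    + (pval u (raise_dual d phi)
    + \sum_(s <- splits u) vmoment (d :: s.1.1) * pval s.2 (raise_dual s.1.2 phi)).
Proof.
move=> IH1 IH2; rewrite pval_cons pdualE pvalD addrC [pval u (lower_dual d phi)]IH1 //.
have -> : lower_dual d phi [::] = chi d * phi [::] by rewrite /lower_dual addr0.
have -> : \sum_(s <- splits u) vmoment s.1.1 * pval s.2 (raise_dual s.1.2 (lower_dual d phi)) =
  \sum_(s <- splits u) (vmoment s.1.1 * vmoment (d * s.1.2 :: s.2) * phi [::]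
    + (vmoment s.1.1 * (chi d * pval s.2 (raise_dual s.1.2 phi))
    + \sum_(t <- splits s.2)
      vmoment s.1.1 * vmoment (d * s.1.2 :: t.1.1) * pval t.2 (raise_dual t.1.2 phi))).
  apply: (eq_sum_splits (F := fun a x b => vmoment a * pval b (raise_dual x (lower_dual d phi)))
   (G := fun a x b => vmoment a * vmoment (d * x :: b) * phi [::]
     + (vmoment a * (chi d * pval b (raise_dual x phi)) + \sum_(t <- splits b)
      vmoment a * vmoment (d * x :: t.1.1) * pval t.2 (raise_dual t.1.2 phi)))) => a x b ab.
  rewrite (eq_pval _ (raise_lower_dual _ _ _)) pvalD pvalZ pval_lower_dual.
  rewrite (IH1 (d * x :: b)) /=; last by apply: leq_ltn_trans ab; exact: leq_addl.
  rewrite (sum_splits_cons (fun a x' b' => vmoment a * pval b' (raise_dual x' phi))) vmoment_nil.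
  rewrite [in RHS](eq_bigr (fun t => vmoment a * (vmoment (d * x :: t.1.1) * pval t.2 (raise_dual t.1.2 phi))));
    last by move=> *; rewrite mulrA.
  by rewrite -[in RHS]mulr_sumr; ring.
rewrite !big_split /= -mulr_suml.
rewrite (sum_splits_splits (fun a x c y e =>
  vmoment a * vmoment (d * x :: c) * pval e (raise_dual y phi))).
have -> : \sum_(s <- splits u) vmoment (d :: s.1.1) * pval s.2 (raise_dual s.1.2 phi) =
  \sum_(s <- splits u) (vmoment s.1.1 * (chi d * pval s.2 (raise_dual s.1.2 phi)) +
    \sum_(t <- splits s.1.1)
    vmoment t.1.1 * vmoment (d * t.1.2 :: t.2) * pval s.2 (raise_dual s.1.2 phi)).
  apply: (eq_sum_splits (F := fun a x b => vmoment (d :: a) * pval b (raise_dual x phi))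
   (G := fun a x b => vmoment a * (chi d * pval b (raise_dual x phi)) +
    \sum_(t <- splits a)
    vmoment t.1.1 * vmoment (d * t.1.2 :: t.2) * pval b (raise_dual x phi))) => a x b ab.
  rewrite IH2; last by apply: leq_ltn_trans ab; exact: leq_addr.
  by rewrite -mulr_suml; ring.
by rewrite big_split /=; ring.
Qed.

Let first_leg_vmoment n : forall w, (size w <= n)%N -> first_leg_at w /\ vmoment_rec_at w.
Proof.
elim: n => [|n IH].
  case=> // _; split=> [phi|d]; rewrite big_nil addr0 vmoment_nil ?mul1r ?mulr1 //.
  by rewrite /vmoment pval1 /vac eqxx /=; ring.
have P1 w : (size w <= n.+1)%N -> first_leg_at w.
  case: w => [|d u] wn phi; first by rewrite big_nil vmoment_nil addr0 mul1r.
  rewrite first_leg_step.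
  - rewrite (sum_splits_cons (fun a x' b' => vmoment a * pval b' (raise_dual x' phi))) vmoment_nil mul1r.
    by rewrite (IH u wn).2.
  - by move=> v vu; apply: (IH v _).1; exact: leq_trans vu wn.
  - by move=> v vu; apply: (IH v _).2; apply: leq_trans (ltnW vu) wn.
move=> w wn; split; first exact: P1.
move=> d; rewrite {1}/vmoment first_leg_step.
- rewrite raise_dual_vac pval0 add0r [X in _ + X]big1 ?addr0 ?mulr1 // => s _.
  by rewrite raise_dual_vac pval0 mulr0.
- by move=> v vw; apply: P1; exact: leq_trans vw wn.
- by move=> v vw; apply: (IH v _).2; rewrite -ltnS; exact: leq_trans vw wn.
Qed.

(** Either every leg of p(w) Omega is closed, or its first leg was last touched by
    some letter x of w = a x b. The first leg is the outermost one, so the letters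
    of a create nothing that survives and contribute the scalar vmoment a. *)
Lemma first_leg w phi : pval w phi = vmoment w * phi [::] +
    \sum_(s <- splits w) vmoment s.1.1 * pval s.2 (raise_dual s.1.2 phi).
Proof. by have [P _] := first_leg_vmoment (leqnn (size w)); exact: P. Qed.

Lemma vmoment_cons d w : vmoment (d :: w) = chi d * vmoment w +
    \sum_(s <- splits w) vmoment s.1.1 * vmoment (d * s.1.2 :: s.2).
Proof. by have [_ P] := first_leg_vmoment (leqnn (size w)); exact: P. Qed.

(** The transpose of annihilation of the last leg by d, multiplied on its left. *)
Definition last_dual d phi : seq A -> C := fun w =>
  if w is x :: r then chi (d * last x r) * phi (belast x r) else 0.

Lemma last_dual_rcons d phi f z : last_dual d phi (rcons f z) = chi (d * z) * phi f.
Proof. by case: f => [|g f] //=; rewrite last_rcons belast_rcons. Qed.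

(** p(d') commutes with annihilation of the last leg, except when the leg that it
    closes is also the last one, and then only the vacuum component is changed. *)
Lemma pdual_last_dual d d' phi f :
  pdual d' (last_dual d phi) f =
  phi [::] * pdual (d * d') vac f + last_dual d (pdual d' phi) f.
Proof.
case/lastP: f => [|f z].
  by rewrite /pdual /last_dual vac_cons vac_nil /=; ring.
rewrite last_dual_rcons; case: f => [|g f].
  by rewrite /pdual /= !vac_cons vac_nil /= (mulrA d); ring.
rewrite rcons_cons /pdual -!rcons_cons !last_dual_rcons !rcons_cons !vac_cons.
by case: f => [|h f]; rewrite /= vac_cons; ring.
Qed.

(** Mirror image of first_leg: after the letter x of w = a x b the last leg is not
    touched any more, so the letters of a act freely above it. *)
Lemma last_leg d w phi : pval w (last_dual d phi) =
  \sum_(s <- splits w) vmoment (d * s.1.2 :: s.2) * pval s.1.1 phi.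
Proof.
elim: w phi => [|x w IH] phi; first by rewrite big_nil.
rewrite pval_cons (eq_pval _ (pdual_last_dual _ _ _)) pvalD pvalZ IH.
rewrite (sum_splits_cons (fun a y b => vmoment (d * y :: b) * pval a phi)).
by rewrite [vmoment (d * x :: w)]pval_cons mulrC.
Qed.

End DualFock.

(** * Cyclic reduction, Wick product and difference quotient *)

Lemma pduals_pdual (C : numClosedFieldType) (A : algType C) (chi chi' : A -> C)
    v d (B : seq A -> seq A -> C) h :
  pduals chi v (fun f => pdual chi' d (B f) h) =
  fun f => pdual chi' d (fun g => pduals chi v (B^~ g) f) h.
Proof.
apply/funext => f; rewrite /pdual; case: h => [|g r].
  rewrite (_ : (fun f => _ + 0) = fun f => B f [:: d] + chi' d * B f [::]).
    by rewrite pdualsD pdualsZ addr0.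
  by apply/funext => f'; rewrite addr0.
by rewrite !pdualsD !pdualsZ.
Qed.

Lemma pval_comm (C : numClosedFieldType) (A : algType C) (chi chi' : A -> C)
    v w (B : seq A -> seq A -> C) :
  pval chi v (fun f => pval chi' w (B f)) = pval chi' w (fun g => pval chi v (B^~ g)).
Proof.
elim: w B => [//|d w IH] B; rewrite pval_cons -[RHS]/(pval chi' w _).
rewrite [LHS](IH (fun f => pdual chi' d (B f))); apply: eq_pval => h.
by rewrite /pval pduals_pdual.
Qed.

Section DualFock2.
Variables (C : numClosedFieldType) (A : algType C) (chi : A -> C).
Implicit Types (phi psi : seq A -> C) (d x y z : A) (v w f g : seq A).

Local Notation pdual := (pdual chi).
Local Notation pduals := (pduals chi).
Local Notation pval := (pval chi).
Local Notation vmoment := (vmoment chi).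
Local Notation last_dual := (last_dual chi).

Section CyclicReduction.
Variables kappa phi : seq A -> C.

(** The recursion that defines the map c, for a functional phi of the linear
    tensor and a functional kappa of the circular one. *)
Definition cyclic_reduction : Prop :=
  [/\ phi [::] = 0, forall x, phi [:: x] = kappa [:: x] &
    forall x m z, phi (x :: rcons m z) =
      kappa (x :: rcons m z) + kappa (z * x :: m) + chi (x * z) * phi m].

(** The transpose of f |-> [d (x) f_1 ... f_n] + [f_n d (x) f_1 ... f_(n-1)]. *)
Definition ring_dual d : seq A -> C := fun f =>
  kappa (d :: f) + (if f is x :: r then kappa (last x r * d :: belast x r) else 0).

(** The tensor created by d is read on the circle: it stays next to the last leg,
    is multiplied by it, or annihilates it. The first two cases form ring_dual and
    the third is computed by last_leg; the action of d on the first leg merges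
    letters as in first_leg. *)
Lemma pval_cyc_cons d w : cyclic_reduction ->
  pval (d :: w) phi = chi d * pval w phi +
    \sum_(s <- splits w) (vmoment s.1.1 * pval (d * s.1.2 :: s.2) phi +
      vmoment (d * s.1.2 :: s.2) * pval s.1.1 phi) + pval w (ring_dual d).
Proof.
case=> phi0 phi1 phi2.
pose q f := if f is g :: r then phi (d * g :: r) + chi (d * g) * phi r else 0.
have E f : pdual d phi f = chi d * phi f + (q f + (last_dual d phi f + ring_dual d f)).
  rewrite /pdual -/(q f); suff -> : phi (d :: f) = last_dual d phi f + ring_dual d f.
    by ring.
  case/lastP: f => [|f z]; first by rewrite phi1 /ring_dual addr0 -[LHS]add0r.
  rewrite phi2 last_dual_rcons /ring_dual.
  by case: f => [|x f] /=; rewrite ?last_rcons ?belast_rcons; ring.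
(* q is the part of p(d) that acts on the first leg without creating one. *)
rewrite pval_cons (eq_pval _ _ E) !pvalD pvalZ last_leg (first_leg _ _ q) mulr0 add0r.
have -> : \sum_(s <- splits w) vmoment s.1.1 * pval s.2 (raise_dual s.1.2 q) =
    \sum_(s <- splits w) vmoment s.1.1 * pval (d * s.1.2 :: s.2) phi.
  apply: eq_bigr => s _; rewrite pval_cons; congr (_ * _); apply: eq_pval => -[|g r].
    by rewrite /raise_dual /pdual.
  by rewrite /raise_dual /pdual /= !mulrA addrA.
by rewrite big_split /=; ring.
Qed.

End CyclicReduction.

(** The product of Wick words f and g, evaluated by psi: the last letters of f may
    be contracted with the first letters of g, innermost pair first, the outermost
    contraction being either complete or a merging. The left factor is stored in
    reverse so that the contracted letters are at hand. *)
Fixpoint wick_rev psi rf g : C :=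
  psi (catrev rf g) + match rf, g with
  | z :: rf', x :: g' => psi (catrev rf' (z * x :: g')) + chi (z * x) * wick_rev psi rf' g'
  | _, _ => 0
  end.

Definition wick psi f g := wick_rev psi (rev f) g.

Lemma wick0l psi g : wick psi [::] g = psi g.
Proof. by rewrite /wick /= addr0. Qed.

Lemma wick0r psi f : wick psi f [::] = psi f.
Proof.
rewrite /wick; case: (rev f) (revK f) => [|z rf] <-; first by rewrite /= addr0.
by rewrite /= addr0.
Qed.

Lemma wick_rcons_cons psi f z x g : wick psi (rcons f z) (x :: g) =
  psi (f ++ z :: x :: g) + (psi (f ++ z * x :: g) + chi (z * x) * wick psi f g).
Proof.
by rewrite /wick rev_rcons /= !catrevE revK.
Qed.

Lemma wick1_cons psi z x g :
  wick psi [:: z] (x :: g) = psi [:: z, x & g] + (psi (z * x :: g) + chi (z * x) * psi g).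
Proof. by rewrite (wick_rcons_cons psi [::]) wick0l. Qed.

Lemma wick2_cons psi c z x g : wick psi [:: c; z] (x :: g) =
  psi [:: c, z, x & g] + (psi [:: c, z * x & g] + chi (z * x) * wick psi [:: c] g).
Proof. exact: (wick_rcons_cons psi [:: c]). Qed.

(** The Wick product is the action of the algebra generated by the p(d) on the
    Fock space, hence it commutes with left multiplication by p(d). *)
Lemma pdual_wick psi d f g :
  pdual d (fun f => wick psi f g) f = wick (pdual d psi) f g.
Proof.
case/lastP: f => [|f z].
  rewrite /pdual !wick0l; case: g => [|x g]; first by rewrite wick0r.
  by rewrite wick1_cons; ring.
elim/last_ind: f z g => [|f c IH] z [|x g].
- by rewrite /pdual /= !wick0r.
- rewrite /pdual /= wick2_cons !wick1_cons wick0l.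
  case: g => [|x' g]; first by rewrite wick0r /= !mulrA; ring.
  by rewrite wick1_cons /= !mulrA; ring.
- by rewrite /pdual; case: f {IH} => [|h f]; rewrite /= !wick0r.
have {IH} := IH c g; case: f => [|h f] IH.
  rewrite wick2_cons -IH /pdual /=.
  rewrite (wick_rcons_cons psi [:: d; c]) !wick2_cons wick1_cons /=.
  by rewrite wick0l; ring.
rewrite [RHS]wick_rcons_cons -IH /pdual /= -!rcons_cons.
by rewrite !wick_rcons_cons /=; ring.
Qed.

(** Wick multiplication by the vector p(u) Omega is the operator p(u_1)...p(u_n). *)
Lemma pval_wick psi u g : pval u (fun f => wick psi f g) = pduals u psi g.
Proof.
elim: u psi => [|d u IH] psi; first by rewrite [LHS]wick0l.
by rewrite pval_cons (eq_pval _ _ (fun f => pdual_wick psi d f g)) IH.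
Qed.

Variable y : A.

(** The transpose of the map that cuts f at each letter x and keeps on the left of
    the cut f_1 ... f_(k-1) (x) p(x y) Omega and on its right the letters after x. *)
Definition diff_quot (B : seq A -> seq A -> C) : seq A -> C := fun f =>
  \sum_(s <- splits f) (B (rcons s.1.1 (s.1.2 * y)) s.2 + chi (s.1.2 * y) * B s.1.1 s.2).

Lemma diff_quot_cons B d f : diff_quot B (d :: f) =
  pval [:: d * y] (fun k => B k f) + diff_quot (fun k h => B (d :: k) h) f.
Proof. by rewrite /diff_quot /= big_cons big_map pval1. Qed.

(** A noncommutative Leibniz rule: p(d) is either cut itself, or acts on the left
    part of the cut. The terms where it acts on the leg that is being cut cancel
    against the scalar part of p(x y) Omega. *)
Lemma pdual_diff_quot d B f : pdual d (diff_quot B) f =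
  pval [:: d * y] (fun k => B k f) + diff_quot (fun k h => pdual d (fun k => B k h) k) f.
Proof.
have nil0 B' : diff_quot B' [::] = 0 by rewrite /diff_quot big_nil.
case: f => [|g r]; first by rewrite /pdual diff_quot_cons !nil0; ring.
rewrite /pdual !diff_quot_cons.
have -> : diff_quot (fun k h => pdual d (B^~ h) (g :: k)) r =
  diff_quot (fun k h => B [:: d, g & k] h) r + chi d * diff_quot (fun k h => B (g :: k) h) r
  + (diff_quot (fun k h => B (d * g :: k) h) r + chi (d * g) * diff_quot B r).
  rewrite /diff_quot !mulr_sumr -!big_split; apply: eq_bigr => s _.
  by rewrite /pdual /=; ring.
by rewrite !pval1 /pdual /= !mulrA; ring.
Qed.

Lemma pval_diff_quot v B : pval v (diff_quot B) =
  \sum_(s <- splits v) pval s.2 (fun h => pval (rcons s.1.1 (s.1.2 * y)) (fun k => B k h)).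
Proof.
elim: v B => [|d v IH] B; first by rewrite /= big_nil /pval /= /diff_quot big_nil.
rewrite pval_cons (eq_pval _ _ (pdual_diff_quot _ _)) pvalD IH.
by rewrite (sum_splits_cons (fun a x b =>
  pval b (fun h => pval (rcons a (x * y)) (fun k => B k h)))).
Qed.

Hypothesis chi_tr : forall x z, chi (x * z) = chi (z * x).

(** The contractions of a Wick product across the cut join the last and the first
    letter of f. They are exactly those that c performs on the circle, so opening
    the circular tensor c f at every letter is the difference quotient of f
    followed by the Wick product of the right part with the left part. *)
Lemma cyclic_reduction_diff_quot psi phi :
  cyclic_reduction
    (fun g => \sum_(s <- splits g)
      (psi (s.2 ++ rcons s.1.1 (s.1.2 * y)) + chi (s.1.2 * y) * psi (s.2 ++ s.1.1)))
    phi ->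
  phi =1 diff_quot (fun k h => wick psi h k).
Proof.
case=> phi0 phi1 phi2 g.
move: {2}(size g) (leqnn (size g)) => n; elim: n g => [|n IH] g.
  by case: g => // _; rewrite phi0 /diff_quot big_nil.
case: g => [|x g]; first by rewrite phi0 /diff_quot big_nil.
case/lastP: g => [|m z] sg.
  by rewrite phi1 /diff_quot !big_seq1 /= !wick0l.
rewrite phi2 IH; last by move: sg; rewrite /= size_rcons ltnS => /ltnW.
rewrite /diff_quot.
rewrite (sum_splits_cons (fun a x b =>
  psi (b ++ rcons a (x * y)) + chi (x * y) * psi (b ++ a))).
rewrite (sum_splits_rcons (fun a x' b =>
  psi (b ++ rcons (x :: a) (x' * y)) + chi (x' * y) * psi (b ++ x :: a))).
rewrite (sum_splits_cons (fun a x b =>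
  psi (b ++ rcons a (x * y)) + chi (x * y) * psi (b ++ a))).
rewrite (sum_splits_cons (fun a x b =>
  wick psi b (rcons a (x * y)) + chi (x * y) * wick psi b a)).
rewrite (sum_splits_rcons (fun a x' b =>
  wick psi b (rcons (x :: a) (x' * y)) + chi (x' * y) * wick psi b (x :: a))).
rewrite wick_rcons_cons !wick0r !wick0l.
have -> : \sum_(s <- splits m) (wick psi (rcons s.2 z) (rcons (x :: s.1.1) (s.1.2 * y))
    + chi (s.1.2 * y) * wick psi (rcons s.2 z) (x :: s.1.1)) =
  \sum_(s <- splits m) (psi (rcons s.2 z ++ rcons (x :: s.1.1) (s.1.2 * y)) +
     chi (s.1.2 * y) * psi (rcons s.2 z ++ x :: s.1.1)) +
  \sum_(s <- splits m) (psi (s.2 ++ rcons (z * x :: s.1.1) (s.1.2 * y)) +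
     chi (s.1.2 * y) * psi (s.2 ++ z * x :: s.1.1)) +
  chi (z * x) * \sum_(s <- splits m) (wick psi s.2 (rcons s.1.1 (s.1.2 * y)) +
     chi (s.1.2 * y) * wick psi s.2 s.1.1).
  rewrite mulr_sumr -!big_split; apply: eq_bigr => s _ /=.
  by rewrite !wick_rcons_cons !cat_rcons; ring.
by rewrite (chi_tr x z) /= !cats0 -!cats1 -!catA /= !mulrA; ring.
Qed.

Lemma pval_cyclic_reduction psi phi v :
  cyclic_reduction
    (fun g => \sum_(s <- splits g)
      (psi (s.2 ++ rcons s.1.1 (s.1.2 * y)) + chi (s.1.2 * y) * psi (s.2 ++ s.1.1)))
    phi ->
  pval v phi = \sum_(s <- splits v) pval (s.2 ++ rcons s.1.1 (s.1.2 * y)) psi.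
Proof.
move=> /cyclic_reduction_diff_quot E; rewrite (eq_pval _ _ E) pval_diff_quot.
apply: eq_bigr => s _; rewrite pval_comm pval_cat; apply: eq_pval => k.
exact: pval_wick.
Qed.

End DualFock2.

(** * The pairing on the full Fock space *)

Lemma sum_rot (T : Type) (V : nmodType) (F : seq T -> V) (g : seq T) :
  \sum_(k < size g) F (rot k g) = \sum_(s <- splits g) F (s.1.2 :: s.2 ++ s.1.1).
Proof.
suff E (G : seq T -> seq T -> V) : \sum_(k < size g) G (take k g) (drop k g) =
    \sum_(s <- splits g) G s.1.1 (s.1.2 :: s.2).
  exact: (E (fun a b => F (b ++ a))).
elim: g G => [|x g IH] G; first by rewrite big_ord0 big_nil.
by rewrite big_ord_recl /= big_cons big_map (IH (fun a => G (x :: a))).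
Qed.

Lemma nth_rot_mod (T : Type) (x0 : T) (g : seq T) (k i : nat) :
  (k < size g)%N -> (i < size g)%N ->
  nth x0 g ((i + k) %% size g) = nth x0 (rot k g) i.
Proof.
move=> kg ig; rewrite /rot nth_cat size_drop nth_drop ltn_subRL.
case: ltnP => ikg; first by rewrite addnC modn_small // addnC.
rewrite nth_take; last by lia.
have -> : (i + k = (i + k - size g) + size g)%N by lia.
rewrite modnDr modn_small; last by lia.
by congr nth; lia.
Qed.

Lemma pval_conj (C : numClosedFieldType) (A : algType C) (chi : A -> C) v phi :
  (pval chi v phi)^* = pval (fun x => (chi x)^*) v (fun f => (phi f)^*).
Proof.
elim: v phi => [//|d v IH] phi; rewrite !pval_cons IH; apply: eq_pval => -[|f r].
  by rewrite /pdual !addr0 rmorphD rmorphM.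
by rewrite /pdual !(rmorphD, rmorphM).
Qed.

Section Pairing.
Variables (C : numClosedFieldType) (A : algType C) (star : A -> A) (psi : {scalar A}).
Hypothesis star_alg : star_algebra star.
Hypothesis psi_tr : tracial_state star psi.
Implicit Types (d x y z : A) (v w f g e : seq A).

Let starK : involutive star. Proof. by case: star_alg. Qed.
Let starM x y : star (x * y) = star y * star x. Proof. by case: star_alg. Qed.
Let psiC x y : psi (x * y) = psi (y * x). Proof. by case: psi_tr. Qed.

(** Positivity of psi on (a + x)^*(a + x), for a = 1 and a = i, forces psi to be
    hermitian. *)
Lemma psi_star x : psi (star x) = (psi x)^*.
Proof.
case: star_alg => _ starP _; case: psi_tr => psi1 _ psi_ge0.
have star1 : star 1 = 1 by rewrite -[LHS]mulr1 -{2}[1]starK -starM mulr1 starK.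
have key (a : C) : (a * psi x + a^* * psi (star x))^* = a * psi x + a^* * psi (star x).
  have /CrealP := ger0_real (psi_ge0 (a^* *: 1 + x)).
  have /CrealP xx := ger0_real (psi_ge0 x).
  have -> : psi (star (a^* *: 1 + x) * (a^* *: 1 + x)) =
     a * a^* + (a * psi x + a^* * psi (star x)) + psi (star x * x).
    rewrite starP star1 conjCK mulrDl mulrDr -!scalerAl mul1r !mulrDr -scalerAr mulr1.
    by rewrite !linearD /= !linearZ /= psi1 mul1r; ring.
  rewrite [LHS]rmorphD /= xx [(_ + (_ + _))^*]rmorphD /= [(a * a^*)^*]rmorphM /= conjCK.
  by rewrite [a^* * a]mulrC => /addIr/addrI.
have := key 1; rewrite conjC1 !mul1r rmorphD /= => e1.
have := key 'i; rewrite rmorphD !rmorphM /= !conjCi rmorphN /= conjCi opprK => e2.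
apply: (mulfI (x := 2)); first by rewrite pnatr_eq0.
have {}e2 : - (psi x)^* + (psi (star x))^* = psi x - psi (star x).
  apply: (mulfI (x := 'i)); first exact: neq0Ci.
  by rewrite mulrDr mulrN -mulNr e2; ring.
transitivity ((psi x + psi (star x)) - (psi x - psi (star x))); first by ring.
by rewrite -e1 -e2; ring.
Qed.

Fixpoint pairing f g : C :=
  match f, g with
  | x :: f', y :: g' => ip star psi x y * pairing f' g'
  | [::], [::] => 1
  | _, _ => 0
  end.

Lemma pairing_rcons f g x y :
  pairing (rcons f x) (rcons g y) = pairing f g * ip star psi x y.
Proof.
elim: f g => [|a f IH] [|b g] /=; first by rewrite mulrC.
- by case: g => [|c g]; rewrite mulr0 mul0r.
- by case: f {IH} => [|c f]; rewrite mulr0 mul0r.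
- by rewrite IH mulrA.
Qed.

Lemma pairing_size f g : size f != size g -> pairing f g = 0.
Proof. by elim: f g => [|a f IH] [|b g] //= E; rewrite IH ?mulr0. Qed.

Lemma pairing_prod f g : size f = size g ->
  pairing f g = \prod_(i < size f) ip star psi (nth 0 f i) (nth 0 g i).
Proof.
elim: f g => [|a f IH] [|b g] //=; first by rewrite big_ord0.
by case=> E; rewrite big_ord_recl /= IH.
Qed.

Lemma pairing_nil_r f : pairing f [::] = vac f.
Proof. by case: f => [|x f]; rewrite /vac. Qed.

Lemma cyc_word_ip_pairing d f g : cyc_word_ip star psi (d :: f) g =
  \sum_(s <- splits g) ip star psi d s.1.2 * pairing f (s.2 ++ s.1.1).
Proof.
rewrite -(sum_rot (fun u => pairing (d :: f) u)) /cyc_word_ip.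
case: eqP => [E|/eqP E]; last first.
  by rewrite big1 // => k _; rewrite pairing_size // size_rot.
rewrite -E; apply: eq_bigr => k _; rewrite pairing_prod ?size_rot //.
apply: eq_bigr => i _; congr (ip _ _ _ _).
by rewrite -nth_rot_mod -?E // E.
Qed.

Let psic (x : A) : C := (psi x)^*.

(** The adjoint of f |-> [d (x) f] + [f_n d (x) f_1 ... f_(n-1)] opens a circular
    tensor at each entry x and replaces that entry by p(x (star d)) Omega; traciality
    moves d from one side of f_n to the other. *)
Lemma ring_dual_pairing d f g :
  ring_dual (fun u => cyc_word_ip star psi u g) d f =
  \sum_(s <- splits g) (pairing f (s.2 ++ rcons s.1.1 (s.1.2 * star d)) +
     psic (s.1.2 * star d) * pairing f (s.2 ++ s.1.1)).
Proof.
have E1 x : ip star psi d x = psic (x * star d).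
  by rewrite /psic -psi_star starM starK /ip psiC.
have E2 x z : ip star psi (z * d) x = ip star psi z (x * star d).
  by rewrite /ip starM starK mulrA [LHS]psiC mulrA.
rewrite /ring_dual cyc_word_ip_pairing [RHS]big_split [LHS]addrC /=.
congr (_ + _); last by apply: eq_bigr => s _; rewrite E1.
case/lastP: f => [|m z].
  by rewrite big1 // => s _; case: (s.2) => //; case: (s.1.1).
have -> : (if rcons m z is x :: r
    then cyc_word_ip star psi (last x r * d :: belast x r) g else 0) =
    cyc_word_ip star psi (z * d :: m) g.
  by case: m => [|x m] //=; rewrite last_rcons belast_rcons.
rewrite cyc_word_ip_pairing; apply: eq_bigr => s _.
by rewrite E2 -rcons_cat pairing_rcons mulrC.
Qed.

(** Creation and annihilation exchange roles across the pairing; the state turns into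
    the conjugate one, the second slot being antilinear. *)
Lemma pdual_pairing d f g :
  pdual psi d (fun f => pairing f g) f = pdual psic (star d) (pairing f) g.
Proof.
have E1 x : psi (star x * d) = psic (star d * x).
  by rewrite /psic -psi_star starM starK.
have E2 : psi d = psic (star d) by rewrite /psic -psi_star starK.
have E3 x : ip star psi d x = psic (star d * x) by rewrite /ip E1.
case: f => [|x f]; case: g => [|y g]; rewrite /pdual /= ?E2 ?E3.
- by ring.
- by case: g => [|z g] /=; ring.
- by rewrite /ip starK; case: f => [|z f] /=; rewrite ?[psi (_ * x)]psiC; ring.
rewrite /ip starM starK !mulrA; ring.
Qed.

Lemma pairing_adjoint w u : pval psi w (fun f => pval psic u (pairing f)) =
  vmoment psi (map star (rev u) ++ w).
Proof.
rewrite /vmoment pval_cat; apply: eq_pval => f.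
have -> : @vac C A = pairing^~ [::] by apply/funext => h; rewrite pairing_nil_r.
have E h : pduals psi (map star (rev u)) (pairing^~ h) =
    fun f => pduals psic u (pairing f) h.
  elim/last_ind: u h {f} => [//|u d IH] h; apply/funext => f.
  rewrite rev_rcons map_cons -[pduals _ (_ :: _) _]/(pduals psi _ (pdual psi (star d) _)).
  rewrite (_ : pdual psi (star d) (pairing^~ h) =
    fun f => pdual psic d (pairing f) h); last first.
    by apply/funext => f'; rewrite pdual_pairing starK.
  rewrite pduals_pdual -cats1 pduals_cat /=; congr (pdual _ _ _ _).
  by apply/funext => g; rewrite IH.
by rewrite E.
Qed.

End Pairing.

(** * Recursion for the covariance on the cyclic Fock space *)

Section LimitCovariance.
Variables (C : numClosedFieldType) (A : algType C) (star : A -> A) (psi : {scalar A}).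
Hypothesis star_alg : star_algebra star.
Hypothesis psi_tr : tracial_state star psi.
Implicit Types (d : A) (v w f g e : seq A).

Definition pvec v : fock A := foldr (fun d xi => pfock star psi d xi) (vacuum A) v.

(** The second argument is the reversed adjoint word, in accordance with the
    conjugate of the trace of a product. *)
Definition fock_cov w e : C :=
  cyc_ip star psi (cyc_map psi (pvec w)) (cyc_map psi (pvec (map star (rev e)))).

Lemma pfock_tensor d w : pfock star psi d (tensor w) =
  tensor (d :: w) + psi d *: tensor w +
  (if w is f :: r then tensor (d * f :: r) + psi (d * f) *: tensor r else 0).
Proof.
have starK : involutive star by case: star_alg.
have psiC x y : psi (x * y) = psi (y * x) by case: psi_tr.
rewrite /pfock creation_tensor; case: w => [|f r].
  rewrite -[tensor [::]]/(vacuum A) annihilation_vacuum preservation_vacuum.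
  by rewrite !addr0.
rewrite annihilation_tensor preservation_tensor /ip starK -!addrA; congr (_ + _).
by rewrite addrC -addrA [RHS]addrCA; congr (_ + _); exact: addrC.
Qed.

Lemma pfock_linear d a xi eta :
  pfock star psi d (a *: xi + eta) = a *: pfock star psi d xi + pfock star psi d eta.
Proof.
rewrite /pfock creation_linear annihilation_linear preservation_linear.
rewrite !scalerDr !scalerA [psi d * a]mulrC.
rewrite (addrACA (a *: creation d xi)) (addrACA (a *: creation d xi + _)).
by rewrite [LHS]addrACA.
Qed.

(** Links linear functionals on the Fock space with their values on words. *)
Lemma pvec_eval (L : fock A -> C) :
  (forall a x y, L (a *: x + y) = a * L x + L y) ->
  forall v, L (pvec v) = pval psi v (fun w => L (tensor w)).
Proof.
move=> + v; elim: v L => [|d v IH] L LP; first by [].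
rewrite -[LHS]/((L \o pfock star psi d) (pvec v)) IH /=; last first.
  by move=> a x y /=; rewrite pfock_linear LP.
rewrite pval_cons; apply: eq_pval => w; rewrite pfock_tensor.
have L0 : L 0 = 0 by have := LP (-1) 0 0; rewrite scaler0 addr0 mulN1r addNr.
have LD x y : L (x + y) = L x + L y by rewrite -[x]scale1r LP mul1r scale1r.
have LZ a x : L (a *: x) = a * L x by rewrite -[a *: x]addr0 LP L0 addr0.
by case: w => [|f r]; rewrite !LD ?LD !LZ ?LZ ?L0.
Qed.

Lemma pvec_eval_anti (L : fock A -> C) :
  (forall a x y, L (a *: x + y) = a^* * L x + L y) ->
  forall v, L (pvec v) = pval (fun x => (psi x)^*) v (fun w => L (tensor w)).
Proof.
move=> LP v; rewrite -[LHS]conjCK.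
rewrite (pvec_eval (L := fun xi => (L xi)^*)); last first.
  by move=> a x y; rewrite LP rmorphD rmorphM /= conjCK.
by rewrite pval_conj; apply: eq_pval => w; rewrite conjCK.
Qed.

Let psiC x y : psi (x * y) = psi (y * x). Proof. by case: psi_tr. Qed.

Let ipZ a x eta : cyc_ip star psi (a *: x) eta = a * cyc_ip star psi x eta.
Proof.
have P := cyc_ip_linear_l psi star_alg eta.
have P0 : cyc_ip star psi 0 eta = 0.
  by have := P (-1) 0 0; rewrite scaler0 addr0 mulN1r addNr.
by rewrite -[a *: x]addr0 P P0 addr0.
Qed.

Let ipD x y eta : cyc_ip star psi (x + y) eta = cyc_ip star psi x eta + cyc_ip star psi y eta.
Proof. by rewrite -[x in LHS]scale1r cyc_ip_linear_l // mul1r. Qed.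

Let ip0 eta : cyc_ip star psi 0 eta = 0.
Proof. by rewrite -(scale0r 0) ipZ mul0r. Qed.

Let ipPr xi a x y :
  cyc_ip star psi xi (a *: x + y) = a^* * cyc_ip star psi xi x + cyc_ip star psi xi y.
Proof. exact: cyc_ip_antilinear_r. Qed.

Let cyc_ip_reduction eta : cyclic_reduction psi
  (fun w => cyc_ip star psi (circ w) eta) (fun w => cyc_ip star psi (cyc_word psi w) eta).
Proof.
split=> [|x|x m z]; first by rewrite cyc_word0 ip0.
  by rewrite cyc_word1.
by rewrite cyc_word2 !ipD ipZ.
Qed.

Lemma cyc_ip_pvec w eta : cyc_ip star psi (cyc_map psi (pvec w)) eta =
  pval psi w (fun f => cyc_ip star psi (cyc_word psi f) eta).
Proof.
rewrite (pvec_eval (L := fun xi => cyc_ip star psi (cyc_map psi xi) eta)).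
  by apply: eq_pval => f; rewrite cyc_map_tensor.
by move=> a x y; rewrite (cyc_map_linear psi a x y); exact: cyc_ip_linear_l.
Qed.

Let psic (x : A) : C := (psi x)^*.

Let anti_ring_dual f d (H := fun eta =>
  ring_dual (fun u => cyc_ip star psi (circ u) eta) d f) :
  forall a x y, H (a *: x + y) = a^* * H x + H y.
Proof.
move=> a x y; rewrite /H /ring_dual; case: f {H} => [|c f]; rewrite !ipPr; first by ring.
by ring.
Qed.

(** The pairing with c p(v) Omega is a cyclic reduction for the conjugate state, to
    which pval_cyclic_reduction applies with y = d^*. *)
Lemma ring_dual_pvec d f v :
  ring_dual (fun u => cyc_ip star psi (circ u) (cyc_map psi (pvec v))) d f =
  \sum_(s <- splits v) pval psic (s.2 ++ rcons s.1.1 (s.1.2 * star d)) (pairing star psi f).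
Proof.
pose H eta := ring_dual (fun u => cyc_ip star psi (circ u) eta) d f.
have HP := anti_ring_dual f d; rewrite -/H in HP.
have H0 : H 0 = 0.
  by have := HP (-1) 0 0; rewrite scaler0 addr0 rmorphN1 mulN1r addNr.
have HD x y : H (x + y) = H x + H y.
  by rewrite -[x in LHS]scale1r HP conjC1 mul1r.
have HZ a x : H (a *: x) = a^* * H x by rewrite -[a *: x]addr0 HP H0 addr0.
rewrite -/(H _) (pvec_eval_anti (L := fun xi => H (cyc_map psi xi))); last first.
  by move=> a x y; rewrite (cyc_map_linear psi a x y); exact: HP.
rewrite (eq_pval _ _ (phi' := fun w => H (cyc_word psi w))); last first.
  by move=> w; rewrite cyc_map_tensor.
apply: (pval_cyclic_reduction (y := star d)).
  by move=> x z; rewrite psiC.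
have E g : \sum_(s <- splits g) (pairing star psi f (s.2 ++ rcons s.1.1 (s.1.2 * star d)) +
     psic (s.1.2 * star d) * pairing star psi f (s.2 ++ s.1.1)) = H (circ g).
  rewrite -ring_dual_pairing // /H /ring_dual.
  by congr (_ + _); [|case: f {H HP H0 HD HZ} => // c f]; rewrite cyc_ip_circ.
split=> [|x|x m z]; rewrite ?E; first by rewrite cyc_word0.
  by rewrite cyc_word1.
by rewrite cyc_word2 !HD HZ.
Qed.

Lemma fock_cov_nil e : fock_cov [::] e = 0.
Proof. by rewrite /fock_cov cyc_ip_pvec [LHS]ip0. Qed.

Lemma fock_cov_cons d w e : fock_cov (d :: w) e = psi d * fock_cov w e +
  \sum_(s <- splits w) (vmoment psi s.1.1 * fock_cov (d * s.1.2 :: s.2) e +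
     vmoment psi (d * s.1.2 :: s.2) * fock_cov s.1.1 e) +
  \sum_(s <- splits e) vmoment psi (d * s.1.2 :: s.2 ++ s.1.1 ++ w).
Proof.
have starK : involutive star by case: star_alg.
have starM x y : star (x * y) = star y * star x by case: star_alg.
rewrite /fock_cov; set eta := cyc_map psi (pvec (map star _)).
rewrite cyc_ip_pvec (pval_cyc_cons _ _ (cyc_ip_reduction eta)) -cyc_ip_pvec.
congr (_ + _ + _).
  by apply: eq_bigr => s _; rewrite -!cyc_ip_pvec.
rewrite (eq_pval _ _ (fun f => ring_dual_pvec d f _)) pval_sum.
rewrite (sum_splits_map star (fun a x b =>
  pval psi w (fun f => pval psic (b ++ rcons a (x * star d)) (pairing star psi f)))).
rewrite (sum_splits_rev (fun a x b => pval psi w (fun f =>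
   pval psic (map star b ++ rcons (map star a) (star x * star d)) (pairing star psi f)))).
apply: eq_bigr => s _; rewrite pairing_adjoint //; congr (vmoment psi _).
rewrite rev_cat rev_rcons -!map_rev !revK /= starM !starK map_cat -!map_comp.
by rewrite !(eq_map (f := star \o star) (g := id)) // !map_id -catA.
Qed.

End LimitCovariance.

(** * Integrals against weighted image laws *)

Section Weighted.
Import HBNNSimple.
Context d1 d2 (T : measurableType d1) (S : measurableType d2) (R : realType).
Variables (m : {measure set T -> \bar R}) (Y : T -> S) (G : T -> R).
Hypotheses (mY : measurable_fun setT Y) (mG : measurable_fun setT G).
Hypothesis G0 : forall t, 0 <= G t.

Let mfY (f : S -> R) : measurable_fun setT f -> measurable_fun setT (f \o Y).
Proof. by move=> mf; exact: measurableT_comp. Qed.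

Lemma weighted_nnsfun (f : {nnsfun S >-> R}) :
  (\int[m]_x (f (Y x) * G x)%:E =
  \sum_(k \in range f) (k%:E * \int[m]_x (\1_(f @^-1` [set k]) (Y x) * G x)%:E))%E.
Proof.
have f0 k y : 0 <= k * \1_(f @^-1` [set k]) y :> R.
  by have := nnfun_muleindic_ge0 f k y; rewrite lee_fin.
have mi k : measurable_fun setT (fun x => \1_(f @^-1` [set k]) (Y x) * G x : R).
  by apply: measurable_funM => //; apply: (mfY (f := \1__)); exact: measurable_indic.
transitivity (\int[m]_x (\sum_(k \in range f) (k * (\1_(f @^-1` [set k]) (Y x) * G x))%:E))%E.
  apply: eq_integral => x _; rewrite fsumEFin // {1}fimfunE; congr EFin.
  by rewrite mulrC mulr_fsumr //; apply: eq_fsbigr => i _; rewrite mulrC mulrA.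
rewrite ge0_integral_fsum //=.
- apply: eq_fsbigr => k _; have [k0|k0] := ltP k 0.
    rewrite !integral0_eq ?mule0 // => x _; rewrite preimage_nnfun0 // indic0;
    by rewrite mul0r ?mulr0.
  under eq_integral do rewrite EFinM.
  rewrite ge0_integralZl //; first exact/measurable_EFinP.
  by move=> x _; rewrite lee_fin mulr_ge0.
- by move=> k; apply/measurable_EFinP; exact: measurable_funM.
- by move=> k x _; rewrite lee_fin mulrA mulr_ge0.
Qed.

Lemma weighted_approx (f : S -> R) (mf : measurable_fun setT (EFin \o f)) :
  (forall y, 0 <= f y) ->
  (\int[m]_x (f (Y x) * G x)%:E = limn (fun n =>
    \int[m]_x (nnsfun_approx measurableT mf n (Y x) * G x)%:E))%E.
Proof.
move=> f0; rewrite -monotone_convergence //.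
- apply: eq_integral => x _; apply/esym/cvg_lim => //.
  under eq_fun do rewrite EFinM.
  rewrite EFinM; apply: cvgeZr => //.
  by apply: (cvg_nnsfun_approx measurableT mf) => // y _; rewrite lee_fin.
- by move=> n; apply/measurable_EFinP/measurable_funM => //; exact: mfY.
- by move=> n x _; rewrite lee_fin mulr_ge0.
- move=> x _ k n kn; rewrite lee_fin ler_wpM2r //.
  exact/lefP/nd_nnsfun_approx.
Qed.

End Weighted.

Section WeightedTransfer.
Import HBNNSimple.

(** The identity on indicators extends to nonnegative simple functions by
    additivity and then to measurable ones by monotone convergence. With a density
    for one of the weights this computes means from a law; with a constant weight
    it is the factorization step for independent variables. *)
Lemma weighted_transfer d1 d2 d3 (T1 : measurableType d1) (T2 : measurableType d2)
  (S : measurableType d3) (R : realType)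
  (m1 : {measure set T1 -> \bar R}) (m2 : {measure set T2 -> \bar R})
  (Y1 : T1 -> S) (Y2 : T2 -> S) (G1 : T1 -> R) (G2 : T2 -> R) (f : S -> R) :
  measurable_fun setT Y1 -> measurable_fun setT Y2 ->
  measurable_fun setT G1 -> measurable_fun setT G2 ->
  (forall t, 0 <= G1 t) -> (forall t, 0 <= G2 t) ->
  (forall B, measurable B ->
    (\int[m1]_x (\1_B (Y1 x) * G1 x)%:E = \int[m2]_x (\1_B (Y2 x) * G2 x)%:E)%E) ->
  measurable_fun setT f -> (forall y, 0 <= f y) ->
  (\int[m1]_x (f (Y1 x) * G1 x)%:E = \int[m2]_x (f (Y2 x) * G2 x)%:E)%E.
Proof.
move=> mY1 mY2 mG1 mG2 G10 G20 E /measurable_EFinP mf f0.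
rewrite (weighted_approx _ mY1 mG1 G10 mf f0) (weighted_approx _ mY2 mG2 G20 mf f0).
congr (limn _); apply/funext => n.
rewrite !weighted_nnsfun //; apply: eq_fsbigr => k _; congr (_ * _)%E.
by apply: E.
Qed.

End WeightedTransfer.

(** * Means of products of independent variables *)

Section RealExpectation.
Context d (T : measurableType d) (R : realType) (P : probability T R).
Implicit Types f g : T -> R.

Definition mean_integrable (f : T -> R) := P.-integrable setT (EFin \o f).

Definition mean (f : T -> R) : R := fine (\int[P]_t (f t)%:E)%E.

Lemma meanE f : mean_integrable f -> (\int[P]_t (f t)%:E = (mean f)%:E)%E.
Proof. by move=> fi; rewrite /mean fineK //; exact: integrable_fin_num. Qed.

Lemma mean_integrable_ge0 f (c : R) : measurable_fun setT f -> (forall t, 0 <= f t) ->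
  (\int[P]_t (f t)%:E = c%:E)%E -> mean_integrable f.
Proof.
move=> mf f0 fc; apply/integrableP; split; first exact/measurable_EFinP.
by under eq_integral do rewrite /= ger0_norm //; rewrite fc ltry.
Qed.

Lemma mean_integrable_cst (c : R) : mean_integrable (fun=> c).
Proof. exact: finite_measure_integrable_cst. Qed.

Lemma mean_integrableD f g : mean_integrable f -> mean_integrable g -> mean_integrable (fun t => f t + g t).
Proof.
by move=> fi gi; have := integrableD measurableT fi gi; apply: eq_integrable.
Qed.

Lemma mean_integrableZ c f : mean_integrable f -> mean_integrable (fun t => c * f t).
Proof.
by move=> fi; have := integrableZl measurableT c fi; apply: eq_integrable.
Qed.

Lemma mean_cst c : mean (fun=> c) = c.
Proof. by rewrite /mean integral_cst //= probability_setT mule1. Qed.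

Lemma meanD f g : mean_integrable f -> mean_integrable g -> mean (fun t => f t + g t) = mean f + mean g.
Proof.
move=> fi gi; apply: EFin_inj; rewrite -meanE; last exact: mean_integrableD.
under eq_integral do rewrite EFinD.
by rewrite integralD //= !meanE.
Qed.

Lemma meanZ c f : mean_integrable f -> mean (fun t => c * f t) = c * mean f.
Proof.
move=> fi; apply: EFin_inj; rewrite -meanE; last exact: mean_integrableZ.
under eq_integral do rewrite EFinM.
by rewrite integralZl //= meanE.
Qed.

Section Independence.
Variables (I : finType) (g : I -> T -> measurableTypeR R).
Hypothesis mg : forall i, measurable_fun setT (g i).
Hypothesis ind : mutually_independent P g.

Let mean_indic i (B : set (measurableTypeR R)) : measurable B ->
  (\int[P]_t (\1_B (g i t))%:E = P (g i @^-1` B))%E.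
Proof.
move=> mB; have mgB : measurable (g i @^-1` B).
  by rewrite -(setTI (_ @^-1` _)); exact: mg.
by rewrite -(setIT (_ @^-1` _)) -integral_indic.
Qed.

(** The factors outside s are indicators. Indicators are replaced one at a time: for
    the variable j the product of the other factors is a weight, and the case of an
    indicator in position j is the induction hypothesis. *)
Let indep_prod_ge0 (s : seq I) (H : I -> R -> R) :
  (forall i, measurable_fun setT (H i)) -> (forall i y, 0 <= H i y) ->
  (forall i, mean_integrable (fun t => H i (g i t))) ->
  (forall i, i \notin s ->
     exists2 B : set (measurableTypeR R), measurable B & H i = \1_B) ->
  (\int[P]_t (\prod_i H i (g i t))%:E =
  (\prod_i mean (fun t => H i (g i t)))%:E)%E.
Proof.
elim: s H => [|j s IH] H mH H0 iH Hs.
  have {}Hs i : {B : set (measurableTypeR R) | measurable B & H i = \1_B}.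
    by apply: cid2; apply: Hs.
  pose B i := s2val (Hs i).
  have mB i : measurable (B i) by exact: (s2valP (Hs i)).
  have HB i : H i = \1_(B i) by exact: (s2valP' (Hs i)).
  have := ind (finset.setT : {set I}) mB.
  set S := \bigcap_(i in _) _ => PS.
  have mS : measurable S.
    apply: fin_bigcap_measurable => // i _.
    by rewrite -(setTI (_ @^-1` _)); exact: mg.
  transitivity (P S).
    rewrite -(setIT S) -integral_indic //; apply: eq_integral => t _; congr EFin.
    rewrite indicE; have [tS|tS] := boolP (t \in S).
      rewrite big1 // => i _; rewrite HB indicE mem_set //.
      by move: tS; rewrite inE; apply; rewrite /= inE.
    have /existsNP[i /not_implyP[_ it]] : ~ S t by move=> St; rewrite mem_set in tS.
    by rewrite (bigD1 i) //= HB indicE memNset // mul0r.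
  rewrite PS -prodEFin; apply: eq_big => [i|i _]; first by rewrite inE.
  by rewrite -meanE //; under eq_integral do rewrite HB; rewrite mean_indic.
pose c := \prod_(i | i != j) mean (fun t => H i (g i t)).
have c0 : 0 <= c.
  apply: prodr_ge0 => i _; rewrite /mean fine_ge0 // integral_ge0 // => t _.
  by rewrite lee_fin.
pose G t := \prod_(i | i != j) H i (g i t).
have mHg i : measurable_fun setT (fun t => H i (g i t)).
  exact: (measurableT_comp (mH i) (mg i)).
transitivity (\int[P]_t (H j (g j t) * G t)%:E)%E.
  by apply: eq_integral => t _; rewrite (bigD1 j).
have mG : measurable_fun setT G.
  by rewrite /G; under eq_fun do rewrite -big_filter; apply: measurable_prod => i _.
have G0 t : 0 <= G t by apply: prodr_ge0.
have E (B : set (measurableTypeR R)) : measurable B ->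
    (\int[P]_t (\1_B (g j t) * G t)%:E = \int[P]_t (\1_B (g j t) * c)%:E)%E.
  move=> mB; pose H' i := if i == j then \1_B else H i.
  have iB : mean_integrable (fun t => \1_B (g j t)).
    apply: (@mean_integrable_ge0 _ (fine (P (g j @^-1` B)))).
    - exact: (measurableT_comp (measurable_indic mB) (mg j)).
    - by move=> t.
    - by rewrite mean_indic // fineK // fin_num_measure // -(setTI (_ @^-1` _)); exact: mg.
  have := IH H'; rewrite /H'.
  have -> : (\int[P]_t (\prod_i (if i == j then \1_B else H i) (g i t))%:E =
      \int[P]_t (\1_B (g j t) * G t)%:E)%E.
    apply: eq_integral => t _; rewrite (bigD1 j) //= eqxx; congr (_ * _)%:E.
    by apply: eq_bigr => i /negbTE ->.
  move=> ->; first last.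
  + move=> i iNs; case: eqP => [_|/eqP ij]; first by exists B.
    by apply: Hs; rewrite inE negb_or ij.
  + by move=> i; case: eqP => // ->.
  + by move=> i y; case: eqP.
  + by move=> i; case: eqP => // _; exact: measurable_indic.
  under [RHS]eq_integral do rewrite mulrC.
  rewrite meanE; last exact: mean_integrableZ.
  rewrite meanZ // (bigD1 j) //= eqxx mulrC; congr (_ * _)%:E.
  by apply: eq_bigr => i /negbTE ->.
rewrite (weighted_transfer (mg j) (mg j) mG (measurable_cst c) G0 (fun=> c0) E
  (mH j) (H0 j)).
under eq_integral do rewrite mulrC.
rewrite meanE; last exact: mean_integrableZ.
by rewrite meanZ // [in RHS](bigD1 j) //= mulrC.
Qed.

(** Nonnegative factors are replaced one at a time by signed ones, by splitting
    into positive and negative parts. *)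
Lemma indep_prod (s : seq I) (H : I -> R -> R) :
  (forall i, measurable_fun setT (H i)) ->
  (forall i, mean_integrable (fun t => H i (g i t))) ->
  (forall i, i \notin s -> forall y, 0 <= H i y) ->
  mean_integrable (fun t => \prod_i H i (g i t)) /\
  mean (fun t => \prod_i H i (g i t)) = \prod_i mean (fun t => H i (g i t)).
Proof.
elim: s H => [|j s IH] H mH iH H0.
  have {}H0 i y : 0 <= H i y by apply: H0.
  have E : (\int[P]_t (\prod_i H i (g i t))%:E =
      (\prod_i mean (fun t => H i (g i t)))%:E)%E.
    by apply: (indep_prod_ge0 (s := enum I)) => // i; rewrite mem_enum.
  split; last by rewrite /mean E.
  apply: mean_integrable_ge0 E; last by move=> t; exact: prodr_ge0.
  apply: measurable_prod => i _; exact: (measurableT_comp (mH i) (mg i)).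
pose Hp (h : R -> R) i := if i == j then h else H i.
have P1 (h : R -> R) : measurable_fun setT h -> (forall y, 0 <= h y) ->
    mean_integrable (fun t => h (g j t)) ->
    mean_integrable (fun t => h (g j t) * \prod_(i | i != j) H i (g i t)) /\
    mean (fun t => h (g j t) * \prod_(i | i != j) H i (g i t)) =
    mean (fun t => h (g j t)) * \prod_(i | i != j) mean (fun t => H i (g i t)).
  move=> mh h0 ih; have := IH (Hp h); rewrite /Hp.
  have -> : (fun t => \prod_i (if i == j then h else H i) (g i t)) =
      (fun t => h (g j t) * \prod_(i | i != j) H i (g i t)).
    apply/funext => t; rewrite (bigD1 j) //= eqxx; congr (_ * _).
    by apply: eq_bigr => i /negbTE ->.
  rewrite [\prod_i mean _](bigD1 j) //= eqxx.
  rewrite (eq_bigr (fun i => mean (fun t => H i (g i t)))); last by move=> i /negbTE ->.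
  apply.
  - by move=> i; case: eqP.
  - by move=> i; case: eqP => // ->.
  - by move=> i iNs y; case: eqP => // /eqP ij; apply: H0; rewrite inE negb_or ij.
have [ip Ep] : _ := P1 (H j)^\+ (measurable_funrpos (mH j)) (funrpos_ge0 _)
  (integrable_funrpos measurableT (iH j)).
have [im Em] : _ := P1 (H j)^\- (measurable_funrneg (mH j)) (funrneg_ge0 _)
  (integrable_funrneg measurableT (iH j)).
have Hpn y : H j y = (H j)^\+ y + -1 * (H j)^\- y.
  by rewrite mulN1r; have /(congr1 (@^~ y)) <- := funrposBneg (H j).
have E : (fun t => \prod_i H i (g i t)) = (fun t =>
    (H j)^\+ (g j t) * \prod_(i | i != j) H i (g i t) +
    (-1) * ((H j)^\- (g j t) * \prod_(i | i != j) H i (g i t))).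
  by apply/funext => t; rewrite (bigD1 j) //= Hpn; ring.
have E2 : (fun t => H j (g j t)) = (fun t => (H j)^\+ (g j t) + (-1) * (H j)^\- (g j t)).
  by apply/funext => t; rewrite Hpn.
rewrite E; split; first by apply: mean_integrableD => //; exact: mean_integrableZ.
rewrite meanD //; last exact: mean_integrableZ.
rewrite meanZ // Ep Em [RHS](bigD1 j) //= E2 meanD ?meanZ; first by ring.
- exact: (integrable_funrneg measurableT (iH j)).
- exact: (integrable_funrpos measurableT (iH j)).
- exact/mean_integrableZ/(integrable_funrneg measurableT (iH j)).
Qed.

End Independence.
End RealExpectation.

(** * Moments of a centered Gaussian *)

Section NormalMoments.
Variables (R : realType) (s : R).
Hypothesis s0 : s != 0.
Local Notation mu := (@lebesgue_measure R).
Local Notation pdf := (normal_pdf 0 s).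

Let expR_ge_pow (u : R) k : 0 <= u -> u ^+ k <= k`!%:R * expR u.
Proof.
move=> u0; case: k => [|k].
  by rewrite expr0 fact0 mul1r -[1]expR0 ler_expR.
have f0 : 0 < k.+1`!%:R :> R by rewrite ltr0n fact_gt0.
rewrite mulrC -ler_pdivrMr //; apply: le_trans (expR_ge1Dxn k u0).
by rewrite lerDr.
Qed.

(** Half of the exponent absorbs the power of x; the other half is the normal
    density of twice the variance, which is known to be integrable. *)
Let pdf_dom k : exists K, forall x, `|x ^+ k * pdf x| <= K * normal_pdf 0 (s * Num.sqrt 2) x.
Proof.
have s2 : s * Num.sqrt 2 != 0 by rewrite mulf_neq0 // gt_eqF // sqrtr_gt0.
have peak0 := normal_peak_gt0 s2.
pose K0 := 1 + k`!%:R * (4 * s ^+ 2) ^+ k.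
exists (K0 * normal_peak s / normal_peak (s * Num.sqrt 2)) => x.
rewrite normrM (ger0_norm (normal_pdf_ge0 _ _ _)) !normal_pdfE //.
rewrite -!mulrA (mulrA (normal_peak (s * Num.sqrt 2))^-1) mulVf ?gt_eqF // mul1r.
rewrite !(mulrCA _ (normal_peak s)) ler_wpM2l ?normal_peak_ge0 // /normal_fun.
rewrite subr0 exprMn sqr_sqrtr //.
pose u := x ^+ 2 / (4 * s ^+ 2).
have s20 : 0 < s ^+ 2 by rewrite exprn_even_gt0.
have u0 : 0 <= u by rewrite divr_ge0 ?sqr_ge0 // mulr_ge0 // ltW.
have -> : - x ^+ 2 / (s ^+ 2 *+ 2) = - u - u by rewrite /u; field.
have -> : - x ^+ 2 / ((s ^+ 2 * 2) *+ 2) = - u by rewrite /u; field.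
rewrite expRD mulrA ler_wpM2r ?expR_ge0 //.
rewrite expRN ler_pdivrMr ?expR_gt0 //.
have xk : `|x ^+ k| <= 1 + x ^+ 2 ^+ k.
  rewrite -exprM mulnC exprM; set y := x ^+ k.
  by rewrite ler_norml; apply/andP; split; nra.
apply: le_trans xk _.
have -> : x ^+ 2 = u * (4 * s ^+ 2) by rewrite /u; field.
rewrite /K0; set a := 4 * s ^+ 2; have a0 : 0 <= a by rewrite mulr_ge0 // ltW.
rewrite exprMn [leRHS]mulrDl mul1r lerD //; first by rewrite -[1]expR0 ler_expR.
rewrite [leRHS]mulrAC ler_wpM2r ?exprn_ge0 //.
exact: expR_ge_pow.
Qed.

Let mpow k : measurable_fun setT (fun x : R => x ^+ k).
Proof. by apply: measurable_funX; exact: measurable_id. Qed.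

Lemma integrable_pow_pdf k : mu.-integrable setT (fun x => (x ^+ k * pdf x)%:E).
Proof.
have [K HK] := pdf_dom k.
apply: (le_integrable measurableT _ _ (integrableZl measurableT K
  (integrable_normal_pdf 0 (s * Num.sqrt 2)))).
  apply/measurable_EFinP; apply: measurable_funM => //.
  exact: measurable_normal_pdf.
move=> x _ /=; rewrite lee_fin; apply: le_trans (HK x) _.
exact: ler_norm.
Qed.

Let dpow k (x : R) : is_derive x 1 (fun x : R => x ^+ k * pdf x)
  (k%:R * x ^+ k.-1 * pdf x - x ^+ k.+1 / s ^+ 2 * pdf x).
Proof.
rewrite normal_pdfE // /normal_fun.
have D1 : is_derive x 1 (fun x : R => x ^+ k) (k%:R * x ^+ k.-1).
  have h := is_deriveX k (is_derive_id x (1 : R)).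
  rewrite exprfctE in h; apply: (is_derive_eq h).
  by rewrite /GRing.scale /= mulr1.
have D2 : is_derive x 1 (fun x : R => - (x - 0) ^+ 2 / (s ^+ 2 *+ 2)) (- x / s ^+ 2).
  have -> : (fun x : R => - (x - 0) ^+ 2 / (s ^+ 2 *+ 2)) =
     (- (s ^+ 2 *+ 2)^-1) \*: (id : R -> R) ^+ 2.
    by apply/funext => y; rewrite subr0 exprfctE /= /GRing.scale /= mulrC mulrN -mulNr.
  have h := is_deriveZ (- (s ^+ 2 *+ 2)^-1) (is_deriveX 2 (is_derive_id x (1 : R))).
  by apply: (is_derive_eq h); rewrite /= /GRing.scale /=; field.
have D3 := @is_derive1_comp R expR (fun x => - (x - 0) ^+ 2 / (s ^+ 2 *+ 2)) x _ _
  (is_derive_expR _) D2.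
have D4 := is_deriveM D1 (is_deriveZ (normal_peak s) D3).
apply: (is_derive_eq D4).
rewrite (exprS x k) /GRing.scale /= -[normal_peak s *: _]/(normal_peak s * _).
set e := expR _; set a := x ^+ k; set b := x ^+ k.-1; move: (normal_peak s) => c.
by move: e a b => e a b; field.
Qed.

Let cpow k : continuous (fun x : R => x ^+ k * pdf x).
Proof.
move=> x; apply: cvgM; last exact: continuous_normal_pdf.
exact: exprn_continuous.
Qed.

Let stein_fun k := fun x : R => k%:R * x ^+ k.-1 * pdf x - x ^+ k.+1 / s ^+ 2 * pdf x.

Let stein_funE k : stein_fun k = fun x =>
  k%:R * (x ^+ k.-1 * pdf x) + (- (s ^+ 2)^-1) * (x ^+ k.+1 * pdf x).
Proof. by apply/funext => x; rewrite /stein_fun; field. Qed.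

Let cstein k : continuous (stein_fun k).
Proof.
rewrite stein_funE => x; apply: cvgD; apply: cvgM; try exact: cvg_cst; exact: cpow.
Qed.

Let istein k : mu.-integrable setT (EFin \o stein_fun k).
Proof.
rewrite stein_funE.
have h1 := integrableZl measurableT k%:R (integrable_pow_pdf k.-1).
have h2 := integrableZl measurableT (- (s ^+ 2)^-1) (integrable_pow_pdf k.+1).
by have := integrableD measurableT h1 h2; apply: eq_integrable.
Qed.

Let pow_cvg0 k : (fun n => n.+1%:R ^+ k * pdf n.+1%:R) @ \oo --> (0 : R) /\
  (fun n => (- n.+1%:R) ^+ k * pdf (- n.+1%:R)) @ \oo --> (0 : R).
Proof.
have [K HK] := pdf_dom k.+1.
have s2 : s * Num.sqrt 2 != 0 by rewrite mulf_neq0 // gt_eqF // sqrtr_gt0.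
pose M := `|K| * normal_peak (s * Num.sqrt 2).
have B x : x != 0 -> `|x ^+ k * pdf x| <= M / `|x|.
  move=> x0; rewrite ler_pdivlMr ?normr_gt0 // -normrM.
  have -> : x ^+ k * pdf x * x = x ^+ k.+1 * pdf x by rewrite exprSr; ring.
  apply: le_trans (HK x) _; apply: le_trans (ler_norm _) _.
  rewrite normrM (ger0_norm (normal_pdf_ge0 _ _ _)) ler_wpM2l //.
  exact: normal_pdf_ub.
have Z : (fun n => M / n.+1%:R) @ \oo --> (0 : R).
  rewrite -[X in _ --> X](mulr0 M); apply: cvgM; first exact: cvg_cst.
  exact: cvg_harmonic.
have N0 : (fun n => - (M / n.+1%:R)) @ \oo --> (0 : R).
  by rewrite -[X in _ --> X]oppr0; exact: cvgN.
split; apply: (squeeze_cvgr _ N0 Z); apply: nearW => n.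
  by rewrite -ler_norml; apply: le_trans (B _ _) _; rewrite ?pnatr_eq0 // normr_nat.
rewrite -ler_norml; apply: le_trans (B _ _) _; rewrite ?oppr_eq0 ?pnatr_eq0 //.
by rewrite normrN normr_nat.
Qed.

(** The integrand is the derivative of x^k times the density, which vanishes at
    infinity. *)
Lemma integral_stein k : (\int[mu]_x (stein_fun k x)%:E = 0)%E.
Proof.
pose D n := `[- n.+1%:R, n.+1%:R]%classic : set R.
have F n : (\int[mu]_(x in D n) (stein_fun k x)%:E =
    (n.+1%:R ^+ k * pdf n.+1%:R - (- n.+1%:R) ^+ k * pdf (- n.+1%:R))%:E)%E.
  rewrite EFinB (continuous_FTC2 (f := stein_fun k) (F := fun x => x ^+ k * pdf x)) //.
  - by rewrite ltrNl; apply: lt_trans (ltr0Sn _ _); rewrite oppr_lt0.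
  - exact/continuous_subspaceT/cstein.
  - split.
    + by move=> x _; have [] := dpow k x.
    + by apply: cvg_at_right_filter; exact: cpow.
    + by apply: cvg_at_left_filter; exact: cpow.
  - by move=> x _; rewrite derive1E; apply: derive_val.
(* Both sides of the fundamental theorem of calculus on [-n-1, n+1] are followed as n grows. *)
have L1 : (fun n => \int[mu]_(x in D n) (stein_fun k x)%:E)%E @ \oo --> 0%E.
  under eq_fun do rewrite F.
  apply: cvg_EFin; first by near=> n.
  rewrite -[X in _ --> X]subr0; have [c1 c2] := pow_cvg0 k.
  exact: cvgB.
have /measurable_int mst := istein k.
have mD n : measurable (D n) by exact: measurable_itv.
have [] := @dominated_convergence _ _ _ mu setT measurableT
  (fun n => (EFin \o stein_fun k) \_ (D n)) (EFin \o stein_fun k)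
  (abse \o (EFin \o stein_fun k)).
- move=> n; apply/(measurable_restrict _ (mD n) measurableT).
  exact: measurable_funTS.
- exact: mst.
- apply: aeW => x _; apply: cvg_near_cst.
  near=> n; rewrite /patch mem_set // /D /= in_itv /= -ler_norml.
  near: n; exists (Num.bound x) => // n /= xn.
  apply: ltW; apply: lt_le_trans (archi_boundP (normr_ge0 x)) _.
  by rewrite /Num.bound normr_id ler_nat; apply: leq_trans xn _.
- exact: integrable_abse (istein k).
- apply: aeW => x n _ /=; rewrite /patch; case: ifP => _ //.
  by rewrite abse0 lee_fin.
move=> _ _ L2.
rewrite -(cvg_lim _ L2) // -(cvg_lim _ L1) //.
congr (limn _); apply/funext => n.
by rewrite [RHS]integral_mkcond.
Unshelve. all: by end_near.
Qed.

End NormalMoments.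

Section GaussianVariable.
Context d (T : measurableType d) (R : realType) (P : probability T R).
Variables (g : T -> measurableTypeR R) (v : R).
Hypotheses (v0 : 0 < v) (gN : centered_normal P g v).

Let s := Num.sqrt v.
Let s0 : s != 0. Proof. by rewrite gt_eqF // sqrtr_gt0. Qed.
Let s2 : s ^+ 2 = v. Proof. by rewrite sqr_sqrtr // ltW. Qed.
Let mg : measurable_fun setT g. Proof. by case: gN. Qed.
Local Notation mu := (@lebesgue_measure R).

Let transfer (f : R -> R) : measurable_fun setT f -> (forall x, 0 <= f x) ->
  (\int[P]_t (f (g t))%:E = \int[mu]_x (f x * normal_pdf 0 s x)%:E)%E.
Proof.
move=> mf f0; transitivity (\int[P]_t (f (g t) * 1)%:E)%E.
  by apply: eq_integral => t _; rewrite mulr1.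
apply: (@weighted_transfer _ _ _ _ _ (measurableTypeR R) R P mu g idfun (fun=> 1)
  (normal_pdf 0 s) f mg) => //.
- exact: measurable_id.
- exact: measurable_normal_pdf.
- exact: normal_pdf_ge0.
move=> B mB.
have [_ /(_ B mB)] := gN; rewrite /normal_prob => PB.
transitivity (P (g @^-1` B)).
  have mgB : measurable (g @^-1` B) by rewrite -(setTI (_ @^-1` _)); exact: mg.
  rewrite -(setIT (_ @^-1` _)) -integral_indic //.
  by apply: eq_integral => t _; rewrite mulr1.
rewrite PB [LHS]integral_mkcond; apply: eq_integral => x _.
by rewrite /patch indicE; case: ifP => _; rewrite ?mul1r ?mul0r.
Qed.

Lemma gaussian_pow k : mean_integrable P (fun t => g t ^+ k) /\
  mean P (fun t => g t ^+ k) = fine (\int[mu]_x (x ^+ k * normal_pdf 0 s x)%:E)%E.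
Proof.
have mpow : measurable_fun setT (fun x : R => x ^+ k).
  by apply: measurable_funX; exact: measurable_id.
have h (f : R -> R) : measurable_fun setT f -> (forall x, 0 <= f x) ->
    (forall x, f x <= `|x ^+ k|) ->
    [/\ mean_integrable P (fun t => f (g t)),
      mu.-integrable setT (fun x => (f x * normal_pdf 0 s x)%:E) &
      mean P (fun t => f (g t)) = fine (\int[mu]_x (f x * normal_pdf 0 s x)%:E)%E].
  move=> mf f0 fk; rewrite /mean transfer //.
  have fi : mu.-integrable setT (fun x => (f x * normal_pdf 0 s x)%:E).
    apply: (le_integrable measurableT _ _ (integrable_pow_pdf s0 k)).
      apply/measurable_EFinP; apply: measurable_funM => //.
      exact: measurable_normal_pdf.
    by move=> x _; rewrite /= lee_fin !normrM ler_wpM2r // ger0_norm.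
  split=> //.
  apply: (@mean_integrable_ge0 _ _ _ _ _ (fine (\int[mu]_x (f x * normal_pdf 0 s x)%:E)%E)).
  - exact: (measurableT_comp mf mg).
  - by move=> t.
  - by rewrite transfer // fineK //; exact: integrable_fin_num.
pose h1 (x : R) := x ^+ k.
have [|ip lp Ep] := h h1^\+ (measurable_funrpos mpow) (funrpos_ge0 _).
  by move=> x; rewrite /funrpos /h1 ge_max normr_ge0 ler_norm.
have [|im lm Em] := h h1^\- (measurable_funrneg mpow) (funrneg_ge0 _).
  by move=> x; rewrite /funrneg /h1 ge_max normr_ge0 -normrN ler_norm.
have Hpn y : y ^+ k = h1^\+ y + -1 * h1^\- y.
  by rewrite mulN1r -[LHS]/(h1 y); have /(congr1 (@^~ y)) <- := funrposBneg h1.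
have E : (fun t => g t ^+ k) = (fun t => h1^\+ (g t) + -1 * h1^\- (g t)).
  by apply/funext => t; rewrite Hpn.
rewrite E; split; first by apply: mean_integrableD => //; exact: mean_integrableZ.
rewrite meanD //; last exact: mean_integrableZ.
rewrite meanZ // Ep Em mulN1r -fineB ?integrable_fin_num // -integralB //.
by congr fine; apply: eq_integral => x _; rewrite -EFinB Hpn; congr EFin; ring.
Qed.

(** Stein identity for the powers. For k = 0 the right-hand side vanishes, whatever
    the value of the truncated exponent. *)
Lemma gaussian_moment_rec k :
  mean P (fun t => g t ^+ k.+1) = k%:R * v * mean P (fun t => g t ^+ k.-1).
Proof.
have [_ ->] := gaussian_pow k.+1; have [_ ->] := gaussian_pow k.-1.
have i1 := integrable_pow_pdf s0 k.+1; have i2 := integrable_pow_pdf s0 k.-1.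
have := integral_stein s0 k; rewrite s2.
have -> : (\int[mu]_x (k%:R * x ^+ k.-1 * normal_pdf 0 s x -
     x ^+ k.+1 / v * normal_pdf 0 s x)%:E =
  \int[mu]_x (k%:R%:E * (x ^+ k.-1 * normal_pdf 0 s x)%:E +
    (- v^-1)%:E * (x ^+ k.+1 * normal_pdf 0 s x)%:E))%E.
  by apply: eq_integral => x _; rewrite -!EFinM -EFinD; congr EFin; ring.
rewrite integralD //; [|exact: integrableZl|exact: integrableZl].
rewrite !integralZl // => /(congr1 fine).
rewrite fineD ?fin_numM ?integrable_fin_num // !fineM ?integrable_fin_num //=.
set a := fine _; set b := fine _ => /eqP.
rewrite mulNr subr_eq0 => /eqP e; rewrite -[LHS](mulVKf (x := v)) ?gt_eqF //.
by rewrite -e; ring.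
Qed.
End GaussianVariable.

(** * Real coordinates of a complex Gaussian matrix *)

Section RealCoordinates.
Context d (T : measurableType d) (R : realType) (P : probability T R).
Variables (N : nat) (X : T -> 'M[R[i]]_N).
Hypotheses (N0 : (0 < N)%N) (hX : complex_gaussian_matrix P X).

Let I : finType := (('I_N * 'I_N) * bool)%type.
Let v : R := N%:R^-1 / 2.
Let v0 : 0 < v. Proof. by rewrite divr_gt0 // invr_gt0 ltr0n. Qed.

(** Real and imaginary parts of all entries form one independent family, which is
    what reduces the complex Wick rule to real moments. *)
Definition gcoord (a : I) (t : T) : measurableTypeR R :=
  if a.2 then complex.Re (X t a.1.1 a.1.2) else complex.Im (X t a.1.1 a.1.2).

Lemma gcoord_normal a : centered_normal P (gcoord a) v.
Proof. by case: hX => /(_ a.1.1 a.1.2) [] hr hi _ _; rewrite /gcoord; case: a.2. Qed.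

Let mcoord a : measurable_fun setT (gcoord a).
Proof. by case: (gcoord_normal a). Qed.

(** Independence of the entries, applied to rectangles, combines with independence
    of the two parts of each entry. *)
Lemma gcoord_indep : mutually_independent P gcoord.
Proof.
move=> J B mB; case: hX => hXe hXi.
pose B' a : set (measurableTypeR R) := if a \in J then B a else setT.
have mB' a : measurable (B' a) by rewrite /B'; case: ifP.
pose K ij : set (measurableTypeR R * measurableTypeR R) :=
  B' (ij, true) `*` B' (ij, false).
have mK ij : measurable (K ij) by exact: measurableX.
have -> : \bigcap_(i in [set` J]) gcoord i @^-1` B i =
    \bigcap_(ij in [set` (finset.setT : {set 'I_N * 'I_N})])
       (fun t => re_im (X t ij.1 ij.2)) @^-1` K ij.
  apply/seteqP; split=> t /= H.
    move=> ij _; split; rewrite /= /B'; case: ifP => // aJ; exact: (H _ aJ).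
  move=> [ij b] aJ; have [] := H ij; first by rewrite /= inE.
  by rewrite /= /B' /gcoord; case: b aJ => /= aJ; [move=> + _ | move=> _]; rewrite aJ.
rewrite hXi //.
transitivity (\prod_(ij : 'I_N * 'I_N) \prod_(b : bool) P (gcoord (ij, b) @^-1` B' (ij, b)))%E.
  apply: eq_big => [ij|ij _]; first by rewrite inE.
  case: (hXe ij.1 ij.2) => _ _ /(_ (finset.setT : {set bool}) (fun b => B' (ij, b))).
  move=> /(_ (fun b => mB' (ij, b))) => E.
  transitivity (\prod_(b in (finset.setT : {set bool})) P (gcoord (ij, b) @^-1` B' (ij, b)))%E.
    rewrite -[RHS]E; congr (P _); apply/seteqP; split=> t /=.
      by case=> ht hf [] _.
    by move=> H; split; [apply: (H true) | apply: (H false)]; rewrite /= inE.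
  by apply: eq_bigl => b; rewrite inE.
rewrite pair_bigA /= [RHS]big_mkcond; apply: eq_bigr => -[ij b] _.
by rewrite /B' /=; case: ifP => // _; rewrite preimage_setT probability_setT.
Qed.

Definition mval (m : seq I) (t : T) : R := \prod_(a <- m) gcoord a t.

Lemma mval_cons a m t : mval (a :: m) t = gcoord a t * mval m t.
Proof. by rewrite /mval big_cons. Qed.

Let mval_count m t : mval m t = \prod_a gcoord a t ^+ count_mem a m.
Proof.
elim: m => [|a m IH]; first by rewrite /mval big_nil big1.
rewrite mval_cons IH [RHS](bigD1 a) //= eqxx exprS -mulrA; congr (_ * _).
rewrite (bigD1 a) //=; congr (_ * _); apply: eq_bigr => b ba.
by rewrite eq_sym (negbTE ba).
Qed.

Let moment a k := mean P (fun t => gcoord a t ^+ k).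

Let mval_ind m : mean_integrable P (mval m) /\ mean P (mval m) = \prod_a moment a (count_mem a m).
Proof.
rewrite (_ : mval m = fun t => \prod_a (gcoord a t) ^+ count_mem a m); last first.
  by apply/funext => t; rewrite mval_count.
apply: (indep_prod mcoord gcoord_indep (s := enum I)
   (H := fun a y => y ^+ count_mem a m)).
- by move=> a; apply: measurable_funX; exact: measurable_id.
- by move=> a; have [] := gaussian_pow v0 (gcoord_normal a) (count_mem a m).
- by move=> a; rewrite mem_enum.
Qed.

Lemma mean_integrable_mval m : mean_integrable P (mval m). Proof. by case: (mval_ind m). Qed.

(** Independence isolates the powers of the coordinate a, to which the moment
    recursion applies: a is contracted with each of its other occurrences. *)
Lemma mean_mval_cons a m :
  mean P (mval (a :: m)) = v * (count_mem a m)%:R * mean P (mval (rem a m)).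
Proof.
rewrite (mval_ind _).2 (mval_ind (rem a m)).2 (bigD1 a) //= [in RHS](bigD1 a) //=.
rewrite eqxx add1n {1}/moment (gaussian_moment_rec v0 (gcoord_normal a)) -/(moment _ _).
rewrite count_mem_rem eqxx subn1 [v * _]mulrC -!mulrA; congr (_ * (_ * (_ * _))).
congr (_ * _); apply: eq_bigr => b ba; rewrite count_mem_rem eq_sym (negbTE ba).
by rewrite add0n subn0.
Qed.

End RealCoordinates.

(** * Gaussian integration by parts for polynomial functions *)

Section ComplexExpectation.
Context d (T : measurableType d) (R : realType) (P : probability T R).
Implicit Types (f g : T -> R[i]) (c : R[i]).

Local Notation Re := complex.Re.
Local Notation Im := complex.Im.
Local Notation E := (cexpectation P).

Definition cintegrable f :=
  mean_integrable P (fun t => Re (f t)) /\ mean_integrable P (fun t => Im (f t)).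

Local Notation cint := cintegrable.

Lemma cexpectationE f : E f = Complex (mean P (fun t => Re (f t))) (mean P (fun t => Im (f t))).
Proof. by rewrite /cexpectation unlock. Qed.

Let ReD (x y : R[i]) : Re (x + y) = Re x + Re y. Proof. by case: x; case: y. Qed.
Let ImD (x y : R[i]) : Im (x + y) = Im x + Im y. Proof. by case: x; case: y. Qed.
Let ReM (x y : R[i]) : Re (x * y) = Re x * Re y + (- Im x) * Im y.
Proof. by case: x => a b; case: y => a' b' /=; ring. Qed.
Let ImM (x y : R[i]) : Im (x * y) = Re x * Im y + Im x * Re y.
Proof. by case: x => a b; case: y. Qed.

Lemma cint_cst c : cint (fun=> c). Proof. by split; exact: mean_integrable_cst. Qed.

Lemma cintD f g : cint f -> cint g -> cint (fun t => f t + g t).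
Proof.
move=> [rf jf] [rg jg]; split.
  by under eq_fun do rewrite ReD; exact: mean_integrableD.
by under eq_fun do rewrite ImD; exact: mean_integrableD.
Qed.

Lemma cintZ c f : cint f -> cint (fun t => c * f t).
Proof.
move=> [rf jf]; split.
  by under eq_fun do rewrite ReM; apply: mean_integrableD; exact: mean_integrableZ.
by under eq_fun do rewrite ImM; apply: mean_integrableD; exact: mean_integrableZ.
Qed.

Lemma cexp_cst c : E (fun=> c) = c.
Proof. by rewrite cexpectationE !mean_cst; case: c. Qed.

Lemma cexpD f g : cint f -> cint g -> E (fun t => f t + g t) = E f + E g.
Proof.
move=> [rf jf] [rg jg]; rewrite !cexpectationE.
under eq_fun do rewrite ReD; under [X in Complex _ (mean _ X)]eq_fun do rewrite ImD.
by rewrite !meanD.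
Qed.

Lemma cexpZ c f : cint f -> E (fun t => c * f t) = c * E f.
Proof.
move=> [rf jf]; rewrite !cexpectationE.
under eq_fun do rewrite ReM; under [X in Complex _ (mean _ X)]eq_fun do rewrite ImM.
rewrite !meanD ?meanZ //; try exact: mean_integrableZ.
by case: c => a b; apply/eqP; rewrite eq_complex /=; apply/andP; split; apply/eqP; ring.
Qed.

Lemma cint_real (h : T -> R) : mean_integrable P h -> cint (fun t => (h t)%:C%C).
Proof. by move=> hi; split=> //; exact: mean_integrable_cst. Qed.

Lemma cexp_real (h : T -> R) : E (fun t => (h t)%:C%C) = (mean P h)%:C%C.
Proof. by rewrite cexpectationE /= mean_cst. Qed.

End ComplexExpectation.

Section ComplexCoordinates.
Context d (T : measurableType d) (R : realType) (N : nat) (X : T -> 'M[R[i]]_N).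

(** Locked, so that unification never unfolds complex numbers into pairs. *)
Definition gcoordC (a : ('I_N * 'I_N) * bool) t : R[i] :=
  locked ((gcoord X a t : R)%:C)%C.

Definition mvalC m t : R[i] := locked ((mval X m t)%:C)%C.

Lemma gcoordCE a t : gcoordC a t = ((gcoord X a t : R)%:C)%C.
Proof. by rewrite /gcoordC -lock. Qed.

Lemma mvalCE m t : mvalC m t = ((mval X m t)%:C)%C.
Proof. by rewrite /mvalC -lock. Qed.

Lemma mvalC_cons a m t : mvalC (a :: m) t = gcoordC a t * mvalC m t.
Proof. by rewrite !mvalCE gcoordCE mval_cons rmorphM. Qed.

Lemma mvalC0 t : mvalC [::] t = 1.
Proof. by rewrite mvalCE /mval big_nil. Qed.

End ComplexCoordinates.

(* Ring normalisation compares atoms up to conversion; making them variables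
   keeps it from unfolding complex numbers into pairs. *)
Ltac generalize_atoms := repeat
  match goal with
  | |- context [gcoordC ?X ?a ?t] => generalize (gcoordC X a t)
  | |- context [mvalC ?X ?m ?t] => generalize (mvalC X m t)
  | |- context [@real_complex_def ?F ?ph ?x] => generalize (@real_complex_def F ph x)
  | |- context [Complex 0 1] => generalize (Complex 0 1)
  | |- context [count ?a ?m] => generalize (count a m)
  end; intros.

Section Calculus.
Context d (T : measurableType d) (R : realType) (P : probability T R).
Variables (N : nat) (X : T -> 'M[R[i]]_N).
Hypotheses (N0 : (0 < N)%N) (hX : complex_gaussian_matrix P X).
Implicit Types (f g : T -> R[i]) (c : R[i]).

Local Notation E := (cexpectation P).
Local Notation cint := (cintegrable P).
Let I : finType := (('I_N * 'I_N) * bool)%type.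
Local Notation coordC := (gcoordC X).
Local Notation mvalC := (mvalC X).

Lemma entry_coord i j t : X t i j = coordC (i, j, true) t + 'i%C * coordC (i, j, false) t.
Proof. by rewrite !gcoordCE; exact: complexE. Qed.

Lemma entry_conj_coord i j t :
  (X t i j)^* = coordC (i, j, true) t - 'i%C * coordC (i, j, false) t.
Proof.
rewrite !gcoordCE /gcoord /=; case: (X t i j) => a b.
by rewrite -[(Complex a b)^*]/(Complex a (- b)); apply/eqP; rewrite eq_complex /=;
  apply/andP; split; apply/eqP; ring.
Qed.

Definition absorbable f := forall m, cint (fun t => f t * mvalC m t).

(** Polynomial functions of the matrix entries, described by what is needed of
    them: multiplication by f preserves integrability against all monomials. In
    this form closure under sums and products is immediate. *)
Definition polyfun f := forall g, absorbable g -> absorbable (fun t => f t * g t).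

Lemma absorbable1 : absorbable (fun=> 1).
Proof.
by move=> m; under eq_fun do rewrite mul1r mvalCE; exact/cint_real/(mean_integrable_mval N0 hX).
Qed.

Lemma absorbableD f g : absorbable f -> absorbable g -> absorbable (fun t => f t + g t).
Proof.
by move=> fi gi m; under eq_fun do rewrite mulrDl; apply: cintD.
Qed.

Lemma absorbableZ c f : absorbable f -> absorbable (fun t => c * f t).
Proof.
by move=> fi m; under eq_fun do rewrite -mulrA; apply: cintZ.
Qed.

Lemma absorbable_coord a f : absorbable f -> absorbable (fun t => coordC a t * f t).
Proof.
move=> fi m; have := fi (a :: m).
by congr (cintegrable P _); apply/funext => t; rewrite mvalC_cons; generalize_atoms; ring.
Qed.

Lemma absorbable_cint f : absorbable f -> cint f.
Proof.
move=> /(_ [::]); congr (cintegrable P _); apply/funext => t.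
by rewrite mvalC0 mulr1.
Qed.

Lemma polyfun_absorbable f : polyfun f -> absorbable f.
Proof. by move=> /(_ _ absorbable1); under eq_fun do rewrite mulr1. Qed.

Lemma polyfun_cint f : polyfun f -> cint f.
Proof. by move=> /polyfun_absorbable/absorbable_cint. Qed.

Lemma polyfun_cst c : polyfun (fun=> c).
Proof. by move=> g gi; apply: absorbableZ. Qed.

Lemma polyfunD f g : polyfun f -> polyfun g -> polyfun (fun t => f t + g t).
Proof.
move=> fp gp h hi; under eq_fun do rewrite mulrDl.
by apply: absorbableD; [apply: fp | apply: gp].
Qed.

Lemma polyfunM f g : polyfun f -> polyfun g -> polyfun (fun t => f t * g t).
Proof.
by move=> fp gp h hi; under eq_fun do rewrite -mulrA; apply/fp/gp.
Qed.

Lemma polyfun_coord a : polyfun (fun t => coordC a t).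
Proof. by move=> g; exact: absorbable_coord. Qed.

Lemma polyfun_sum (J : Type) (r : seq J) (Q : pred J) (F : J -> T -> R[i]) :
  (forall j, polyfun (F j)) -> polyfun (fun t => \sum_(j <- r | Q j) F j t).
Proof.
move=> FP; elim: r => [|j r IH].
  by under eq_fun do rewrite big_nil; exact: polyfun_cst.
under eq_fun do rewrite big_cons; case: (Q j) => //.
exact: polyfunD.
Qed.

Lemma polyfun_prod (J : Type) (r : seq J) (F : J -> T -> R[i]) :
  (forall j, polyfun (F j)) -> polyfun (fun t => \prod_(j <- r) F j t).
Proof.
move=> FP; elim: r => [|j r IH].
  by under eq_fun do rewrite big_nil; exact: polyfun_cst.
by under eq_fun do rewrite big_cons; exact: polyfunM.
Qed.

Section Derivation.
Variables (i0 j0 : 'I_N).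
Let v : R := N%:R^-1 / 2.
Let ar : I := (i0, j0, true).
Let ai : I := (i0, j0, false).
Let x t := X t i0 j0.

Let xE t : x t = coordC ar t + 'i%C * coordC ai t.
Proof. exact: entry_coord. Qed.

Let cc (a : I) : R[i] := (v%:C)%C * ((a == ar)%:R + 'i%C * (a == ai)%:R).

(** The sum over the letters of a monomial of its contraction with X i0 j0, where
    the covariance of X i0 j0 with the coordinate a is cc a. *)
Fixpoint dmon (m : seq I) (t : T) : R[i] :=
  if m is a :: m' then cc a * mvalC m' t + coordC a t * dmon m' t else 0.

Let dmonE m t : dmon m t = (v%:C)%C * ((count_mem ar m)%:R * mvalC (rem ar m) t
   + 'i%C * ((count_mem ai m)%:R * mvalC (rem ai m) t)).
Proof.
have key (a b : I) m' : (count_mem a (b :: m'))%:R * mvalC (rem a (b :: m')) t =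
   (b == a)%:R * mvalC m' t + coordC b t * ((count_mem a m')%:R * mvalC (rem a m') t).
  rewrite /= natrD mulrDl; have [->|ba] := eqVneq b a; last first.
    by rewrite !mul0r !add0r mvalC_cons; generalize_atoms; ring.
  congr (_ + _); have [am|am] := boolP (a \in m'); last first.
    by have /count_memPn -> := am; rewrite !mul0r mulr0.
  rewrite mulrCA -mvalC_cons; congr (_ * _); rewrite !mvalCE; congr (_%:C)%C.
  by rewrite /mval; apply: perm_big; exact: perm_to_rem.
elim: m => [|b m IH]; first by rewrite /= !mul0r mulr0 addr0 mulr0.
by rewrite [LHS]/= IH !key /cc; generalize_atoms; ring.
Qed.

(** f' is the derivative of f in the weak sense of integration by parts against all
    monomials. *)
Definition wick_pair f f' := [/\ absorbable f, absorbable f' &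
  forall m, E (fun t => x t * (f t * mvalC m t)) =
    E (fun t => f' t * mvalC m t) + E (fun t => f t * dmon m t)].

Let cint_dmon f m : absorbable f -> cint (fun t => f t * dmon m t).
Proof.
move=> fi; have := cintZ ((v%:C)%C) (cintD (cintZ (count_mem ar m)%:R (fi (rem ar m)))
   (cintZ ('i%C * (count_mem ai m)%:R) (fi (rem ai m)))).
by congr (cintegrable P _); apply/funext => t; rewrite dmonE; generalize_atoms; ring.
Qed.

Let cint_x f m : absorbable f -> cint (fun t => x t * (f t * mvalC m t)).
Proof.
move=> fi; have := cintD (fi (ar :: m)) (cintZ 'i%C (fi (ai :: m))).
congr (cintegrable P _); apply/funext => t.
by rewrite xE !mvalC_cons; generalize_atoms; ring.
Qed.

Lemma wick_pair1 : wick_pair (fun=> 1) (fun=> 0).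
Proof.
split; [exact: absorbable1 | |].
  by move=> m; under eq_fun do rewrite mul0r; exact: cint_cst.
(* For f = 1 this is the Wick rule for a single monomial. *)
move=> m; under [in RHS]eq_fun do rewrite mul0r.
rewrite cexp_cst add0r.
have -> : (fun t => x t * (1 * mvalC m t)) =
    (fun t => mvalC (ar :: m) t + 'i%C * mvalC (ai :: m) t).
  by apply/funext => t; rewrite xE !mvalC_cons; generalize_atoms; ring.
have -> : (fun t => 1 * dmon m t) = (fun t => (v%:C)%C * (count_mem ar m)%:R * mvalC (rem ar m) t
   + (v%:C)%C * 'i%C * (count_mem ai m)%:R * mvalC (rem ai m) t).
  by apply/funext => t; rewrite dmonE; generalize_atoms; ring.
have ci m' : cint (fun t => mvalC m' t).
  by under eq_fun do rewrite mvalCE; exact/cint_real/(mean_integrable_mval N0 hX).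
have Em m' : E (mvalC m') = (mean P (mval X m'))%:C%C.
  by rewrite -cexp_real; congr (cexpectation P _); apply/funext => t; rewrite mvalCE.
have Ec a m' : (mean P (mval X (a :: m')))%:C%C =
    v%:C%C * (count_mem a m')%:R * (mean P (mval X (rem a m')))%:C%C.
  rewrite (mean_mval_cons N0 hX) rmorphM rmorphM /=; congr (_ * _ * _).
  by rewrite rmorph_nat.
transitivity (E (mvalC (ar :: m)) + 'i%C * E (mvalC (ai :: m))).
  rewrite cexpD; [congr (_ + _)|exact: ci|exact/cintZ/ci].
  exact: cexpZ (ci _).
transitivity (v%:C%C * (count_mem ar m)%:R * E (mvalC (rem ar m)) +
    v%:C%C * 'i%C * (count_mem ai m)%:R * E (mvalC (rem ai m))); last first.
  symmetry; rewrite cexpD; [congr (_ + _)|exact/cintZ/ci|exact/cintZ/ci].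
    exact: cexpZ (ci _).
  exact: cexpZ (ci _).
rewrite (Em (ar :: m)) (Em (ai :: m)) (Em (rem ar m)) (Em (rem ai m)) !Ec.
have h (V J a A b B : R[i]) : V * a * A + J * (V * b * B) = V * a * A + V * J * b * B.
  by ring.
exact: h.
Qed.

(** f' is the contraction of f with X i0 j0. As for polyfun, the definition by
    multipliers makes the Leibniz rule a composition, and integration by parts
    itself is the case of the constant 1. *)
Definition gderiv f f' := [/\ polyfun f, polyfun f' & forall g g',
  wick_pair g g' -> wick_pair (fun t => f t * g t) (fun t => f' t * g t + f t * g' t)].

Lemma gderiv_cst c : gderiv (fun=> c) (fun=> 0).
Proof.
split; [exact: polyfun_cst | exact: polyfun_cst |].
move=> g g' [gi g'i gg']; split; first exact: absorbableZ.
  by under eq_fun do rewrite mul0r add0r; exact: absorbableZ.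
move=> m; under [X in _ = E X + _]eq_fun do rewrite mul0r add0r -mulrA.
under [X in E X = _]eq_fun do rewrite -mulrA mulrCA.
under [X in _ = _ + E X]eq_fun do rewrite -mulrA.
by rewrite (cexpZ c (cint_x m gi)) (cexpZ c (g'i m)) (cexpZ c (cint_dmon m gi)) gg' mulrDr.
Qed.

Lemma gderivD f f' g g' : gderiv f f' -> gderiv g g' ->
  gderiv (fun t => f t + g t) (fun t => f' t + g' t).
Proof.
move=> [fp f'p fd] [gp g'p gd]; split; [exact: polyfunD | exact: polyfunD |].
move=> h h' hh'; have [fi f'i fE] := fd _ _ hh'; have [gi g'i gE] := gd _ _ hh'.
split; first by under eq_fun do rewrite mulrDl; exact: absorbableD.
  by under eq_fun do rewrite !mulrDl addrACA; exact: absorbableD.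
move=> m.
have -> : (fun t => x t * ((f t + g t) * h t * mvalC m t)) =
    (fun t => x t * (f t * h t * mvalC m t) + x t * (g t * h t * mvalC m t)).
  by apply/funext => t; generalize_atoms; ring.
have -> : (fun t => ((f' t + g' t) * h t + (f t + g t) * h' t) * mvalC m t) =
   (fun t => (f' t * h t + f t * h' t) * mvalC m t + (g' t * h t + g t * h' t) * mvalC m t).
  by apply/funext => t; generalize_atoms; ring.
have -> : (fun t => (f t + g t) * h t * dmon m t) =
    (fun t => f t * h t * dmon m t + g t * h t * dmon m t).
  by apply/funext => t; generalize_atoms; ring.
rewrite !cexpD ?fE ?gE; [by ring|exact: cint_dmon|exact: cint_dmon| | | |] => //.
- exact: cint_x.
- exact: cint_x.
Qed.

Lemma gderivM f f' g g' : gderiv f f' -> gderiv g g' ->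
  gderiv (fun t => f t * g t) (fun t => f' t * g t + f t * g' t).
Proof.
move=> [fp f'p fd] [gp g'p gd]; split; first exact: polyfunM.
  by apply: polyfunD; exact: polyfunM.
move=> h h' hh'; have := fd _ _ (gd _ _ hh').
by congr wick_pair; apply/funext => t; generalize_atoms; ring.
Qed.

Let gderiv_coord a : gderiv (fun t => coordC a t) (fun=> cc a).
Proof.
split; [exact: polyfun_coord | exact: polyfun_cst |].
move=> g g' [gi g'i gg']; split; first exact: absorbable_coord.
  by apply: absorbableD; [exact: absorbableZ | exact: absorbable_coord].
move=> m; have := gg' (a :: m).
have -> : (fun t => x t * (g t * mvalC (a :: m) t)) =
    (fun t => x t * (coordC a t * g t * mvalC m t)).
  by apply/funext => t; rewrite mvalC_cons; generalize_atoms; ring.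
move=> ->.
have -> : (fun t => (cc a * g t + coordC a t * g' t) * mvalC m t) =
   (fun t => cc a * (g t * mvalC m t) + g' t * mvalC (a :: m) t).
  by apply/funext => t; rewrite mvalC_cons; generalize_atoms; ring.
have -> : (fun t => g t * dmon (a :: m) t) =
   (fun t => cc a * (g t * mvalC m t) + coordC a t * g t * dmon m t).
  by apply/funext => t; rewrite /=; generalize_atoms; ring.
rewrite (cexpD (cintZ (cc a) (gi m)) (g'i (a :: m))).
rewrite (cexpD (cintZ (cc a) (gi m)) (cint_dmon m (absorbable_coord a gi))).
by rewrite addrCA addrA.
Qed.

(** The contributions of the real and the imaginary part cancel: a circular Gaussian
    is uncorrelated with itself, and correlated only with its conjugate. *)
Lemma gderiv_entry i j : gderiv (fun t => X t i j) (fun=> 0).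
Proof.
have := gderivD (gderiv_coord (i, j, true)) (gderivM (gderiv_cst 'i%C) (gderiv_coord (i, j, false))).
congr gderiv; apply/funext => t; first by rewrite entry_coord.
rewrite /cc /ar /ai !xpair_eqE !andbT !andbF !mulr0 !addr0 !add0r mul0r add0r.
have := sqr_i R; set J := Complex 0 1 => J2.
transitivity ((v%:C)%C * ((i == i0) && (j == j0))%:R * (1 + J ^+ 2)); first by generalize_atoms; ring.
by rewrite J2 subrr mulr0.
Qed.

Lemma gderiv_conj_entry i j : gderiv (fun t => (X t i j)^*)
  (fun=> N%:R^-1 * ((i == i0) && (j == j0))%:R).
Proof.
have := gderivD (gderiv_coord (i, j, true)) (gderivM (gderiv_cst (- 'i%C)) (gderiv_coord (i, j, false))).
congr gderiv; apply/funext => t; first by rewrite entry_conj_coord mulNr.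
rewrite /cc /ar /ai !xpair_eqE !andbT !andbF !mulr0 !addr0 !add0r mul0r add0r.
have := sqr_i R; set J := Complex 0 1 => J2.
transitivity ((v%:C)%C * ((i == i0) && (j == j0))%:R * (1 - J ^+ 2)); first by generalize_atoms; ring.
rewrite J2 opprK mulrAC; congr (_ * _).
by rewrite /v rmorphM /= !fmorphV !rmorph_nat -mulrA mulVf ?mulr1 // pnatr_eq0.
Qed.

Lemma gaussian_by_parts f f' : gderiv f f' ->
  E (fun t => X t i0 j0 * f t) = E f'.
Proof.
case=> fp f'p /(_ _ _ wick_pair1) [_ _ /(_ [::])].
have -> : (fun t => x t * (f t * 1 * mvalC [::] t)) = (fun t => X t i0 j0 * f t).
  by apply/funext => t; rewrite mvalC0 !mulr1.
have -> : (fun t => (f' t * 1 + f t * 0) * mvalC [::] t) = f'.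
  by apply/funext => t; rewrite mvalC0 !mulr1 mulr0 addr0.
move=> ->; under [X in _ + E X = _]eq_fun do rewrite mulr0.
by rewrite cexp_cst addr0.
Qed.

End Derivation.
End Calculus.

(** * Loop equation for traces of Wishart words *)

Section WishartWords.
Variables (C : numClosedFieldType) (N : nat).
Implicit Types (X D : 'M[C]_N) (w : seq 'M[C]_N).

Definition wword X w : 'M[C]_N := \prod_(D <- w) wishart X D.

Lemma wword_nil X : wword X [::] = 1%:M. Proof. by rewrite /wword big_nil. Qed.

Lemma wword_cons X D w : wword X (D :: w) = wishart X D *m wword X w.
Proof. by rewrite /wword big_cons. Qed.

Lemma wword_cat X w w' : wword X (w ++ w') = wword X w *m wword X w'.
Proof. by rewrite /wword big_cat. Qed.

Definition wtrace X w : C := \tr (wword X w).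

Lemma wtrace_nil X : wtrace X [::] = N%:R.
Proof. by rewrite /wtrace wword_nil mxtrace1. Qed.

Lemma wtrace_cons X D w : wtrace X (D :: w) =
  \sum_a \sum_b X a b * (wword X w *m adjmx X *m D) b a.
Proof.
rewrite /wtrace wword_cons /wishart mxtrace_mulC mulmxA mulmxA mxtrace_mulC.
by rewrite /mxtrace; apply: eq_bigr => a _; rewrite mxE.
Qed.

(** With sum_mul_delta_diag and sum_mul_entries, the index sums by which a
    contraction splits one trace into two or glues two traces into one. *)
Lemma mxtrace_delta (A B : 'M[C]_N) i j :
  \tr (A *m delta_mx j i *m B) = (B *m A) i j.
Proof.
rewrite mxtrace_mulC mulmxA /mxtrace (bigD1 i) //= big1 ?addr0 => [|k ki].
  rewrite mxE (bigD1 j) //= big1 ?addr0 => [|k kj].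
    by rewrite [delta_mx _ _ _ _]mxE !eqxx mulr1.
  by rewrite [delta_mx _ _ _ _]mxE (negbTE kj) mulr0.
rewrite mxE big1 // => l _; rewrite [delta_mx _ _ _ _]mxE (negbTE ki).
by rewrite andbF mulr0.
Qed.

Lemma sum_mul_delta_diag (A B : 'M[C]_N) :
  \sum_a \sum_b (A *m delta_mx b a *m B) b a = \tr A * \tr B.
Proof.
have E a b : (A *m delta_mx b a *m B) b a = A b b * B a a.
  rewrite mxE (bigD1 a) //= big1 ?addr0 => [|k ka].
    congr (_ * _); rewrite mxE (bigD1 b) //= big1 ?addr0 => [|k kb].
      by rewrite [delta_mx _ _ _ _]mxE !eqxx mulr1.
    by rewrite [delta_mx _ _ _ _]mxE (negbTE kb) mulr0.
  rewrite mxE big1 ?mul0r // => l _; rewrite [delta_mx _ _ _ _]mxE (negbTE ka).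
  by rewrite andbF mulr0.
under eq_bigr => a _ do (under eq_bigr => b _ do rewrite E).
by rewrite exchange_big /= mulr_suml; apply: eq_bigr => b _; rewrite mulr_sumr.
Qed.

Lemma sum_mul_entries (A B : 'M[C]_N) : \sum_a \sum_b A b a * B a b = \tr (A *m B).
Proof.
rewrite exchange_big /mxtrace; apply: eq_bigr => b _ /=; rewrite mxE.
by apply: eq_bigr.
Qed.

(** Closing up the factors around a contracted pair X X^* merges the letters on its
    two sides. *)
Lemma wtrace_merge X D x (u v : seq 'M[C]_N) :
  \tr (x *m X *m wword X u *m (wword X v *m adjmx X *m D)) = wtrace X (D *m x :: u ++ v).
Proof.
rewrite /wtrace wword_cons /wishart wword_cat !mulmxA.
by rewrite [LHS]mxtrace_mulC !mulmxA [LHS]mxtrace_mulC !mulmxA.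
Qed.

End WishartWords.

Section LoopEquation.
Context d (T : measurableType d) (R : realType) (P : probability T R).
Variables (N : nat) (X : T -> 'M[R[i]]_N).
Hypotheses (N0 : (0 < N)%N) (hX : complex_gaussian_matrix P X).
Local Notation C := R[i].
Local Notation E := (cexpectation P).
Local Notation polyfun := (polyfun P X).
Local Notation cint := (cintegrable P).
Implicit Types (D x : 'M[C]_N) (w e : seq 'M[C]_N) (F G : T -> 'M[C]_N).

Lemma cexp_sum (J : Type) (r : seq J) (F : J -> T -> C) : (forall j, cint (F j)) ->
  E (fun t => \sum_(j <- r) F j t) = \sum_(j <- r) E (F j).
Proof.
move=> Fi; have Si (r' : seq J) : cint (fun t => \sum_(j <- r') F j t).
  elim: r' => [|j r' IH]; first by under eq_fun do rewrite big_nil; exact: cint_cst.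
  by under eq_fun do rewrite big_cons; exact: cintD.
elim: r => [|j r IH].
  by rewrite big_nil; under eq_fun do rewrite big_nil; rewrite cexp_cst.
by rewrite big_cons -IH -cexpD //; under eq_fun do rewrite big_cons.
Qed.

Section OneEntry.
Variables (i0 j0 : 'I_N).
Local Notation gderiv := (gderiv P X i0 j0).

Lemma gderiv_sum (J : Type) (r : seq J) (F F' : J -> T -> C) :
  (forall j, gderiv (F j) (F' j)) ->
  gderiv (fun t => \sum_(j <- r) F j t) (fun t => \sum_(j <- r) F' j t).
Proof.
move=> FD; elim: r => [|j r IH].
  under eq_fun do rewrite big_nil; under [X in gderiv _ X]eq_fun do rewrite big_nil.
  exact: gderiv_cst.
under eq_fun do rewrite big_cons; under [X in gderiv _ X]eq_fun do rewrite big_cons.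
exact: gderivD.
Qed.

Definition mderiv F F' := forall i j, gderiv (fun t => F t i j) (fun t => F' t i j).

Lemma mderiv_cst A : mderiv (fun=> A) (fun=> 0).
Proof.
move=> i j; under [X in gderiv _ X]eq_fun do rewrite mxE; exact: gderiv_cst.
Qed.

Lemma mderivM F F' G G' : mderiv F F' -> mderiv G G' ->
  mderiv (fun t => F t *m G t) (fun t => F' t *m G t + F t *m G' t).
Proof.
move=> FD GD i j; under eq_fun do rewrite mxE.
under [X in gderiv _ X]eq_fun do rewrite 3!mxE -big_split /=.
by apply: gderiv_sum => k; exact: gderivM.
Qed.

Lemma mderiv_gauss : mderiv X (fun=> 0).
Proof.
by move=> i j; under [X in gderiv _ X]eq_fun do rewrite mxE; exact: gderiv_entry.
Qed.

Lemma mderiv_adj : mderiv (fun t => adjmx (X t)) (fun=> N%:R^-1 *: delta_mx j0 i0).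
Proof.
move=> i j; under eq_fun do rewrite !mxE.
under [X in gderiv _ X]eq_fun do rewrite !mxE.
by rewrite andbC; exact: gderiv_conj_entry.
Qed.

Lemma mderiv_wishart D : mderiv (fun t => wishart (X t) D)
  (fun t => N%:R^-1 *: (delta_mx j0 i0 *m D *m X t)).
Proof.
have := mderivM (mderivM mderiv_adj (mderiv_cst D)) mderiv_gauss.
congr mderiv; apply/funext => t.
by rewrite !mulmx0 !addr0 -!scalemxAl.
Qed.

Lemma mderiv_wword w : mderiv (fun t => wword (X t) w) (fun t => \sum_(s <- splits w)
  N%:R^-1 *: (wword (X t) s.1.1 *m delta_mx j0 i0 *m (s.1.2 *m X t *m wword (X t) s.2))).
Proof.
elim: w => [|D w IH].
  have := mderiv_cst 1%:M; congr mderiv; apply/funext => t; first by rewrite wword_nil.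
  by rewrite /= big_nil.
have := mderivM (mderiv_wishart D) IH; congr mderiv; apply/funext => t.
  by rewrite wword_cons.
rewrite (sum_splits_cons (fun a x b => N%:R^-1 *:
  (wword (X t) a *m delta_mx j0 i0 *m (x *m X t *m wword (X t) b)))).
rewrite wword_nil mul1mx -scalemxAl !mulmxA; congr (_ + _).
rewrite mulmx_sumr; apply: eq_bigr => s _.
by rewrite wword_cons -scalemxAr !mulmxA.
Qed.

Lemma gderiv_wtrace w : gderiv (fun t => wtrace (X t) w) (fun t => \sum_(s <- splits w)
  N%:R^-1 * (s.1.2 *m X t *m wword (X t) (s.2 ++ s.1.1)) i0 j0).
Proof.
have := @gderiv_sum _ (index_enum 'I_N) _ _ (fun i => mderiv_wword w i i).
congr gderiv; apply/funext => t.
transitivity (\tr (\sum_(s <- splits w) N%:R^-1 *: (wword (X t) s.1.1 *m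
  delta_mx j0 i0 *m (s.1.2 *m X t *m wword (X t) s.2)))); first by [].
rewrite raddf_sum /=; apply: eq_bigr => s _.
by rewrite mxtraceZ mxtrace_delta wword_cat !mulmxA.
Qed.

(** The second component of a pair is the constant at which its trace is centered. *)
Definition centered_prod (es : seq (seq 'M[C]_N * C)) t : C :=
  \prod_(e <- es) (wtrace (X t) e.1 - e.2).

Lemma gderiv_centered_prod es : gderiv (centered_prod es) (fun t =>
  \sum_(u <- splits es) \sum_(s <- splits u.1.2.1)
    N%:R^-1 * (s.1.2 *m X t *m wword (X t) (s.2 ++ s.1.1)) i0 j0 *
    (centered_prod u.1.1 t * centered_prod u.2 t)).
Proof.
elim: es => [|e es IH].
  have : gderiv (fun=> 1) (fun=> 0) by exact: gderiv_cst.
  congr gderiv; apply/funext => t.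
    by rewrite /centered_prod big_nil.
  by rewrite /= big_nil.
have dc : gderiv (fun=> - e.2) (fun=> 0) by exact: gderiv_cst.
have := gderivM (gderivD (gderiv_wtrace e.1) dc) IH.
congr gderiv; apply/funext => t; first by rewrite /centered_prod big_cons.
rewrite (sum_splits_cons (fun a (y : seq 'M[C]_N * C) b => \sum_(s <- splits y.1)
    N%:R^-1 * (s.1.2 *m X t *m wword (X t) (s.2 ++ s.1.1)) i0 j0 *
    (centered_prod a t * centered_prod b t))) addr0 mulr_suml.
congr (_ + _).
  by apply: eq_bigr => s _; rewrite [centered_prod [::] t]/centered_prod big_nil mul1r.
rewrite mulr_sumr; apply: eq_bigr => u _; rewrite mulr_sumr; apply: eq_bigr => s _.
rewrite [centered_prod (e :: _) t]/centered_prod big_cons -/(centered_prod _ t).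
by ring.
Qed.

Lemma mderiv_wword_adj w D : mderiv (fun t => wword (X t) w *m adjmx (X t) *m D)
  (fun t => \sum_(s <- splits w)
     N%:R^-1 *: (wword (X t) s.1.1 *m delta_mx j0 i0 *m
       (s.1.2 *m X t *m wword (X t) s.2 *m adjmx (X t) *m D))
     + N%:R^-1 *: (wword (X t) w *m delta_mx j0 i0 *m D)).
Proof.
have := mderivM (mderivM (mderiv_wword w) mderiv_adj) (mderiv_cst D).
congr mderiv; apply/funext => t.
rewrite mulmx0 addr0 mulmxDl -scalemxAr -scalemxAl !mulmx_suml; congr (_ + _).
by apply: eq_bigr => s _; rewrite -!scalemxAl !mulmxA.
Qed.

Lemma gderiv_entry_centered w D es :
  gderiv (fun t => (wword (X t) w *m adjmx (X t) *m D) j0 i0 * centered_prod es t)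
  (fun t => (\sum_(s <- splits w)
     N%:R^-1 * (wword (X t) s.1.1 *m delta_mx j0 i0 *m
       (s.1.2 *m X t *m wword (X t) s.2 *m adjmx (X t) *m D)) j0 i0
     + N%:R^-1 * (wword (X t) w *m delta_mx j0 i0 *m D) j0 i0) * centered_prod es t +
   (wword (X t) w *m adjmx (X t) *m D) j0 i0 *
   \sum_(u <- splits es) \sum_(s <- splits u.1.2.1)
    N%:R^-1 * (s.1.2 *m X t *m wword (X t) (s.2 ++ s.1.1)) i0 j0 *
    (centered_prod u.1.1 t * centered_prod u.2 t)).
Proof.
have := gderivM (mderiv_wword_adj w D j0 i0) (gderiv_centered_prod es).
congr gderiv; apply/funext => t; congr (_ * _ + _).
by rewrite mxE summxE mxE; congr (_ + _); apply: eq_bigr => s _; rewrite mxE.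
Qed.

End OneEntry.

(** Integration by parts in the first factor X. The contraction with the adjoint of
    the same letter D gives the trace of D, the other adjoints of the same trace
    split it, and the adjoints of the remaining traces are glued to it. *)
Lemma loop_equation D w es :
  E (fun t => wtrace (X t) (D :: w) * centered_prod es t) =
  E (fun t => N%:R^-1 * \tr D * (wtrace (X t) w * centered_prod es t) +
    (\sum_(s <- splits w) N%:R^-1 *
       (wtrace (X t) s.1.1 * wtrace (X t) (D *m s.1.2 :: s.2) * centered_prod es t) +
     \sum_(u <- splits es) \sum_(s <- splits u.1.2.1) N%:R^-1 *
       (wtrace (X t) (D *m s.1.2 :: s.2 ++ s.1.1 ++ w) *
        (centered_prod u.1.1 t * centered_prod u.2 t)))).
Proof.
pose F a b t := (wword (X t) w *m adjmx (X t) *m D) b a * centered_prod es t.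
have dF a b := gderiv_entry_centered a b w D es.
have pF a b : polyfun (fun t => X t a b * F a b t).
  apply: polyfunM; last by case: (dF a b).
  by case: (gderiv_entry P X a b a b).
have -> : (fun t => wtrace (X t) (D :: w) * centered_prod es t) =
    (fun t => \sum_a \sum_b X t a b * F a b t).
  apply/funext => t; rewrite wtrace_cons mulr_suml; apply: eq_bigr => a _.
  by rewrite mulr_suml; apply: eq_bigr => b _; rewrite mulrA.
rewrite cexp_sum; last by move=> a; apply: (polyfun_cint N0 hX); apply: polyfun_sum.
under eq_bigr => a _.
  rewrite cexp_sum; last by move=> b; apply: (polyfun_cint N0 hX); exact: pF.
  under eq_bigr => b _ do rewrite (gaussian_by_parts N0 hX (dF a b)).
  rewrite -cexp_sum; last by move=> b; apply: (polyfun_cint N0 hX); case: (dF a b).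
  over.
rewrite -cexp_sum; last first.
  by move=> a; apply: (polyfun_cint N0 hX); apply: polyfun_sum => b; case: (dF a b).
congr (cexpectation P _); apply/funext => t.
under eq_bigr => a _ do rewrite big_split -mulr_suml big_split /=.
rewrite big_split -mulr_suml big_split /= mulrDl [X in X + _ = _]addrC -addrA.
congr (_ + (_ + _)).
- under eq_bigr => a _ do rewrite -mulr_sumr.
  rewrite -mulr_sumr sum_mul_delta_diag /wtrace; ring.
- under eq_bigr => a _ do rewrite exchange_big /=.
  rewrite exchange_big /= mulr_suml; apply: eq_bigr => s _.
  under eq_bigr => a _ do rewrite -mulr_sumr.
  rewrite -mulr_sumr sum_mul_delta_diag -mulrA; congr (_ * (_ * _ * _)).
  have := wtrace_merge (X t) D s.1.2 s.2 [::].
  by rewrite wword_nil mul1mx cats0 !mulmxA.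
under eq_bigr => a _.
  under eq_bigr => b _.
    rewrite mulr_sumr; under eq_bigr => u _ do rewrite mulr_sumr.
    over.
  rewrite exchange_big /=; under eq_bigr => u _ do rewrite exchange_big /=.
  over.
rewrite exchange_big /=; apply: eq_bigr => u _.
rewrite exchange_big /=; apply: eq_bigr => s _.
rewrite catA -(wtrace_merge (X t) D s.1.2 (s.2 ++ s.1.1) w) mxtrace_mulC.
rewrite -sum_mul_entries mulr_suml mulr_sumr; apply: eq_bigr => a _.
rewrite mulr_suml mulr_sumr; apply: eq_bigr => b _.
by ring.
Qed.

Lemma polyfun_wtrace w : polyfun (fun t => wtrace (X t) w).
Proof.
by pose i := Ordinal N0; case: (gderiv_wtrace i i w).
Qed.

Lemma polyfun_centered_prod es : polyfun (centered_prod es).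
Proof.
apply: polyfun_prod => e; apply: polyfunD; first exact: polyfun_wtrace.
exact: polyfun_cst.
Qed.

End LoopEquation.

(** * Limits of sequences that satisfy loop equations *)

Section Asymptotics.
Variables (C : numFieldType).
Implicit Types (u v : nat -> C).

Definition evbounded u : Prop := exists K, \forall N \near \oo, `|u N| <= K.

Lemma evbounded_near u v : (\forall N \near \oo, u N = v N) -> evbounded v -> evbounded u.
Proof.
move=> uv [K vK]; exists K; near=> N.
have E : u N = v N by near: N.
by rewrite E; near: N.
Unshelve. all: by end_near. Qed.

Lemma cvg_near_eq u v (l : C^o) : (\forall N \near \oo, u N = v N) ->
  (v : nat -> C^o) @ \oo --> l -> (u : nat -> C^o) @ \oo --> l.
Proof.
move=> uv; apply: cvg_trans; apply: near_eq_cvg; near=> N; symmetry.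
by near: N.
Unshelve. all: by end_near. Qed.

Lemma evbounded_cst (a : C) : evbounded (fun=> a).
Proof. by exists `|a|; apply: nearW => N. Qed.

Lemma evboundedD u v : evbounded u -> evbounded v -> evbounded (fun N => u N + v N).
Proof.
move=> [K uK] [L vL]; exists (K + L); near=> N.
apply: le_trans (ler_normD _ _) _; apply: lerD; [by near: N | by near: N].
Unshelve. all: by end_near. Qed.

Lemma evboundedM u v : evbounded u -> evbounded v -> evbounded (fun N => u N * v N).
Proof.
move=> [K uK] [L vL]; exists (K * L); near=> N.
by rewrite normrM; apply: ler_pM => //; near: N.
Unshelve. all: by end_near. Qed.

Lemma evbounded_cvg u (l : C^o) : (u : nat -> C^o) @ \oo --> l -> evbounded u.
Proof.
move=> /cvgrPdist_lt/(_ 1 ltr01) ul; exists (`|l| + 1); near=> N.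
have h : `|l - u N| < 1 by near: N.
rewrite -[u N](subrK l) addrC; apply: le_trans (ler_normD _ _) _.
by rewrite lerD2l distrC ltW.
Unshelve. all: by end_near. Qed.

(** The hypothesis gives the splitting itself, since the lengths of its parts are
    what the inductions below use. *)
Lemma evbounded_splits (L : Type) (F : nat -> seq L -> L -> seq L -> C) w :
  (forall a x b, w = a ++ x :: b -> evbounded (fun N => F N a x b)) ->
  evbounded (fun N => \sum_(s <- splits w) F N s.1.1 s.1.2 s.2).
Proof.
elim: w F => [|y w IH] F FP.
  by under eq_fun do rewrite big_nil; exact: evbounded_cst.
under eq_fun do rewrite (sum_splits_cons (F _)).
apply: evboundedD; first exact: (FP [::]).
by apply: (IH (fun N a x b => F N (y :: a) x b)) => a x b ab; apply: FP; rewrite ab.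
Qed.

Lemma cvg_splits (L : Type) (F : nat -> seq L -> L -> seq L -> C)
    (G : seq L -> L -> seq L -> C) w :
  (forall a x b, w = a ++ x :: b ->
     (fun N => F N a x b : C^o) @ \oo --> (G a x b : C^o)) ->
  (fun N => \sum_(s <- splits w) F N s.1.1 s.1.2 s.2 : C^o) @ \oo -->
  (\sum_(s <- splits w) G s.1.1 s.1.2 s.2 : C^o).
Proof.
elim: w F G => [|y w IH] F G FP.
  by under eq_fun do rewrite big_nil; rewrite big_nil; exact: cvg_cst.
under eq_fun do rewrite (sum_splits_cons (F _)); rewrite (sum_splits_cons G).
apply: cvgD; first exact: (FP [::]).
by apply: (IH (fun N a x b => F N (y :: a) x b) (fun a => G (y :: a))) => a x b ab; apply: FP; rewrite ab.
Qed.

Hypothesis inv0 : (fun N : nat => N%:R^-1 : C^o) @ \oo --> (0 : C^o).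

Lemma cvg0_inv_bounded u : evbounded u -> (fun N : nat => N%:R^-1 * u N : C^o) @ \oo --> (0 : C^o).
Proof.
move=> [K uK]; apply/cvgrPdist_le => e e0.
move/cvgrPdist_le: inv0 => inv0'.
have K1 : 0 < `|K| + 1 by rewrite ltr_wpDl.
near=> N; rewrite sub0r normrN normrM.
have h1 : `|N%:R^-1| <= e / (`|K| + 1).
  rewrite -[N%:R^-1]subr0 distrC; near: N; apply: inv0'.
  by rewrite divr_gt0.
have h2 : `|u N| <= `|K| + 1.
  have uNK : `|u N| <= K by near: N.
  have K0 : 0 <= K := le_trans (normr_ge0 _) uNK.
  by apply: le_trans uNK _; rewrite ger0_norm ?lerDl.
apply: le_trans (ler_pM _ _ h1 h2) _ => //.
by rewrite divfK // gt_eqF.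
Unshelve. all: by end_near. Qed.

Variable L : Type.
Implicit Types (w : seq (seq L)) (ws : seq (seq (seq L))).
Variables (t : nat -> seq L -> C) (f : nat -> seq (seq L) -> C)
  (c : nat -> seq (seq (seq L)) -> C).

Hypothesis f_nil : \forall N \near \oo, f N [::] = 1.
Hypothesis c_nil : \forall N \near \oo, c N [::] = 1.
Hypothesis c_nil_cons : forall ws, \forall N \near \oo, c N ([::] :: ws) = 0.
Hypothesis f_cons : forall l w, \forall N \near \oo, f N (l :: w) =
  t N l * f N w + \sum_(s <- splits w) (f N s.1.1 * f N ((l ++ s.1.2) :: s.2) +
    N%:R^-1 * (N%:R^-1 * c N [:: s.1.1; (l ++ s.1.2) :: s.2])).
Hypothesis c_cons : forall l w ws, \forall N \near \oo, c N ((l :: w) :: ws) =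
  t N l * c N (w :: ws) + \sum_(s <- splits w)
    (N%:R^-1 * c N (s.1.1 :: ((l ++ s.1.2) :: s.2) :: ws) +
     (f N s.1.1 * c N (((l ++ s.1.2) :: s.2) :: ws) +
      f N ((l ++ s.1.2) :: s.2) * c N (s.1.1 :: ws)) +
     - (N%:R^-1 * c N [:: s.1.1; (l ++ s.1.2) :: s.2]) * c N ws) +
  \sum_(u <- splits ws) \sum_(s <- splits u.1.2)
    (N%:R^-1 * c N (((l ++ s.1.2) :: s.2 ++ s.1.1 ++ w) :: u.1.1 ++ u.2) +
     f N ((l ++ s.1.2) :: s.2 ++ s.1.1 ++ w) * c N (u.1.1 ++ u.2)).

Variable tau : seq L -> C.
Hypothesis t_cvg : forall l, (fun N => t N l : C^o) @ \oo --> (tau l : C^o).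

Let invb : evbounded (fun N : nat => N%:R^-1). Proof. exact: evbounded_cvg inv0. Qed.
Let tb l : evbounded (t ^~ l). Proof. exact: evbounded_cvg (@t_cvg l). Qed.

Let size2 ws : nat := sumn (map size ws).

(** Every term on the right of the loop equations has total length one less. A
    product of two traces, both expanded around their means, keeps at most one
    factor of order N, which the prefactor 1/N absorbs. *)
Let bounded n : (forall w, (size w <= n)%N -> evbounded (f ^~ w)) /\
  (forall ws, (size2 ws <= n)%N -> evbounded (c ^~ ws)).
Proof.
elim: n => [|n [IHf IHc]].
  split=> [[|//] _|ws]; first by apply: evbounded_near f_nil _; exact: evbounded_cst.
  case: ws => [|[|//] ws] _; first by apply: evbounded_near c_nil _; exact: evbounded_cst.
  by apply: evbounded_near (c_nil_cons ws) _; exact: evbounded_cst.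
split=> [w|ws].
  case: w => [_|l w /= wn]; first by apply: IHf.
  apply: evbounded_near (f_cons l w) _.
  apply: evboundedD; first by apply: evboundedM => //; exact: IHf.
  apply: (evbounded_splits (F := fun N a x b => f N a * f N ((l ++ x) :: b) +
    N%:R^-1 * (N%:R^-1 * c N [:: a; (l ++ x) :: b]))) => a x b wE.
  have ab : (size a + size b < size w)%N by rewrite wE size_cat /=; lia.
  apply: evboundedD; first by apply: evboundedM; apply: IHf => /=; lia.
  by do 2 apply: evboundedM => //; apply: IHc; rewrite /size2 /=; lia.
case: ws => [_|w ws]; first by apply: IHc.
case: w => [_|l w]; first by apply: evbounded_near (c_nil_cons ws) _; exact: evbounded_cst.
rewrite /size2 /= -/(size2 ws) => wn; apply: evbounded_near (c_cons l w ws) _.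
have cb ws' : (size2 ws' <= size w + size2 ws)%N -> evbounded (c ^~ ws').
  by move=> h; apply: IHc; lia.
have fb w' : (size w' <= size w + size2 ws)%N -> evbounded (f ^~ w').
  by move=> h; apply: IHf; lia.
apply: evboundedD; first apply: evboundedD.
- by apply: evboundedM => //; apply: cb; rewrite /size2 /=.
- apply: (evbounded_splits (F := fun N a x b =>
    N%:R^-1 * c N (a :: ((l ++ x) :: b) :: ws) +
     (f N a * c N (((l ++ x) :: b) :: ws) + f N ((l ++ x) :: b) * c N (a :: ws)) +
     - (N%:R^-1 * c N [:: a; (l ++ x) :: b]) * c N ws)) => a x b wE.
  have ab : (size a + size b < size w)%N by rewrite wE size_cat /=; lia.
  apply: evboundedD; first apply: evboundedD.
  + by apply: evboundedM => //; apply: cb; rewrite /size2 /= -/(size2 ws); lia.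
  + apply: evboundedD; apply: evboundedM; (apply: fb || apply: cb);
      rewrite /size2 /= -?/(size2 ws); lia.
  + apply: evboundedM; last by apply: cb; lia.
    under eq_fun do rewrite -mulN1r; apply: evboundedM; first exact: evbounded_cst.
    by apply: evboundedM => //; apply: cb; rewrite /size2 /=; lia.
pose F N (u1 : seq (seq (seq L))) e (u2 : seq (seq (seq L))) := \sum_(s <- splits e)
    (N%:R^-1 * c N (((l ++ s.1.2) :: s.2 ++ s.1.1 ++ w) :: u1 ++ u2) +
     f N ((l ++ s.1.2) :: s.2 ++ s.1.1 ++ w) * c N (u1 ++ u2)).
apply: (evbounded_splits (F := F)) => ws1 e ws2 wsE; rewrite /F.
have eu : (size2 ws = size e + size2 (ws1 ++ ws2))%N.
  by rewrite wsE /size2 !map_cat !sumn_cat /=; lia.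
apply: (evbounded_splits (F := fun N a x b =>
    N%:R^-1 * c N (((l ++ x) :: b ++ a ++ w) :: ws1 ++ ws2) +
     f N ((l ++ x) :: b ++ a ++ w) * c N (ws1 ++ ws2))) => a x b eE.
have ab : (size e = size a + (size b).+1)%N by rewrite eE size_cat.
apply: evboundedD; apply: evboundedM => //.
- by apply: cb; rewrite -[size2 (_ :: _)]/(size _ + size2 _)%N /= !size_cat; lia.
- by apply: fb; rewrite /= !size_cat; lia.
- by apply: cb; lia.
Qed.

Let f_bounded w : evbounded (f ^~ w).
Proof. by have [h _] := bounded (size w); exact: h. Qed.

Let c_bounded ws : evbounded (c ^~ ws).
Proof. by have [_ h] := bounded (size2 ws); exact: h. Qed.

Variables (om : seq (seq L) -> C) (kappa : seq (seq L) -> seq (seq L) -> C).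
Hypothesis om_nil : om [::] = 1.
Hypothesis om_cons : forall l w, om (l :: w) =
  tau l * om w + \sum_(s <- splits w) om s.1.1 * om ((l ++ s.1.2) :: s.2).
Hypothesis kappa_nil : forall v : seq (seq L), kappa [::] v = 0.
Hypothesis kappa_cons : forall l w (v : seq (seq L)), kappa (l :: w) v = tau l * kappa w v +
  \sum_(s <- splits w) (om s.1.1 * kappa ((l ++ s.1.2) :: s.2) v +
     om ((l ++ s.1.2) :: s.2) * kappa s.1.1 v) +
  \sum_(s <- splits v) om ((l ++ s.1.2) :: s.2 ++ s.1.1 ++ w).

(** In the limit of the loop equation for the mean, the covariance of the two traces
    of a splitting is divided by N^2 and drops out: the means factorize. *)
Lemma cvg_first_moment w : (fun N => f N w : C^o) @ \oo --> (om w : C^o).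
Proof.
move: {2}(size w) (leqnn (size w)) => n; elim: n w => [|n IH] [|l w] //= wn.
- by rewrite om_nil; apply: cvg_near_cst; exact: f_nil.
- by rewrite om_nil; apply: cvg_near_cst; exact: f_nil.
rewrite om_cons; apply: cvg_near_eq (f_cons l w) _.
apply: cvgD; first by apply: cvgM; [exact: t_cvg | exact: IH].
apply: (cvg_splits (F := fun N a x b => f N a * f N ((l ++ x) :: b) +
    N%:R^-1 * (N%:R^-1 * c N [:: a; (l ++ x) :: b]))
  (G := fun a x b => om a * om ((l ++ x) :: b))) => a x b wE.
have ab : (size w = size a + (size b).+1)%N by rewrite wE size_cat.
rewrite -[X in _ --> X]addr0; apply: cvgD.
  by apply: cvgM; apply: IH => /=; lia.
by apply: cvg0_inv_bounded; apply: evboundedM.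
Qed.

(** Third central moments enter with a factor 1/N only, so the bounds on them close
    the recursion on the covariances. *)
Lemma cvg_covariance w (v : seq (seq L)) : (fun N => c N [:: w; v] : C^o) @ \oo --> (kappa w v : C^o).
Proof.
move: {2}(size w) (leqnn (size w)) => n; elim: n w => [|n IH] [|l w] //= wn.
- by rewrite kappa_nil; apply: cvg_near_cst; exact: c_nil_cons.
- by rewrite kappa_nil; apply: cvg_near_cst; exact: c_nil_cons.
rewrite kappa_cons; apply: cvg_near_eq (c_cons l w [:: v]) _.
apply: cvgD; first apply: cvgD.
- by apply: cvgM; [exact: t_cvg | exact: IH].
- apply: (cvg_splits (F := fun N a x b =>
    N%:R^-1 * c N [:: a; (l ++ x) :: b; v] +
     (f N a * c N [:: (l ++ x) :: b; v] + f N ((l ++ x) :: b) * c N [:: a; v]) +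
     - (N%:R^-1 * c N [:: a; (l ++ x) :: b]) * c N [:: v])
    (G := fun a x b => om a * kappa ((l ++ x) :: b) v + om ((l ++ x) :: b) * kappa a v))
    => a x b wE.
  have ab : (size w = size a + (size b).+1)%N by rewrite wE size_cat.
  rewrite -[X in _ --> X]addr0 -[X in _ --> X + _]add0r.
  apply: cvgD; first apply: cvgD.
  + exact: cvg0_inv_bounded.
  + by apply: cvgD; apply: cvgM; try exact: cvg_first_moment; apply: IH => /=; lia.
  + under eq_fun do rewrite mulNr -mulrA; rewrite -oppr0; apply: cvgN.
    by apply: cvg0_inv_bounded; exact: evboundedM.
under eq_fun do rewrite big_seq1.
apply: (cvg_splits (F := fun N a x b =>
    N%:R^-1 * c N [:: (l ++ x) :: b ++ a ++ w] +
     f N ((l ++ x) :: b ++ a ++ w) * c N [::])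
    (G := fun a x b => om ((l ++ x) :: b ++ a ++ w))) => a x b _.
rewrite -[X in _ --> X]add0r; apply: cvgD; first exact: cvg0_inv_bounded.
rewrite -[X in _ --> X]mulr1; apply: cvgM; first exact: cvg_first_moment.
by apply: cvg_near_cst; exact: c_nil.
Qed.

End Asymptotics.

(** * Trace moments in a fixed dimension *)

Section FixedDimension.
Context d (T : measurableType d) (R : realType) (P : probability T R).
Variables (N : nat) (X : T -> 'M[R[i]]_N).
Hypotheses (N0 : (0 < N)%N) (hX : complex_gaussian_matrix P X).
Variables (L : Type) (ev : seq L -> 'M[R[i]]_N).
Hypothesis evM : forall l l', ev (l ++ l') = ev l *m ev l'.
Implicit Types (l : seq L) (w : seq (seq L)) (ws : seq (seq (seq L))).
Local Notation E := (cexpectation P).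

Definition wtr w t : R[i] := wtrace (X t) (map ev w).
Definition moment w : R[i] := E (wtr w).
Definition wtr_prod ws : T -> R[i] :=
  centered_prod X [seq (map ev w, moment w) | w <- ws].
Definition cmoment ws : R[i] := E (wtr_prod ws).

Lemma polyfun_wtr w : polyfun P X (wtr w).
Proof. exact: polyfun_wtrace. Qed.

Lemma polyfun_wtr_prod ws : polyfun P X (wtr_prod ws).
Proof. exact: polyfun_centered_prod. Qed.

Let pc f : polyfun P X f -> cintegrable P f. Proof. exact: polyfun_cint. Qed.

Lemma wtr_prod_nil t : wtr_prod [::] t = 1.
Proof. by rewrite /wtr_prod /centered_prod big_nil. Qed.

Lemma wtr_prod_cons w ws t : wtr_prod (w :: ws) t = (wtr w t - moment w) * wtr_prod ws t.
Proof. by rewrite /wtr_prod /centered_prod /= big_cons. Qed.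

Lemma wtr_prod_cat ws ws' t : wtr_prod (ws ++ ws') t = wtr_prod ws t * wtr_prod ws' t.
Proof. by rewrite /wtr_prod /centered_prod map_cat big_cat. Qed.

Lemma cmoment_nil : cmoment [::] = 1.
Proof.
rewrite /cmoment (_ : wtr_prod [::] = fun=> 1) ?cexp_cst //.
by apply/funext => t; rewrite wtr_prod_nil.
Qed.

Lemma exp_wtr_prod w ws :
  E (fun t => wtr w t * wtr_prod ws t) = cmoment (w :: ws) + moment w * cmoment ws.
Proof.
have pp := polyfun_wtr_prod ws.
rewrite /cmoment -(cexpZ (moment w) (pc pp)) -cexpD.
- congr (cexpectation P _); apply/funext => t; rewrite wtr_prod_cons; ring.
- exact/pc/polyfun_wtr_prod.
- exact/cintZ/pc.
Qed.

Lemma cmoment1 w : cmoment [:: w] = 0.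
Proof.
have := exp_wtr_prod w [::]; under eq_fun do rewrite wtr_prod_nil mulr1.
by rewrite cmoment_nil mulr1 -[LHS]/(moment w) -[LHS]add0r => /addIr.
Qed.

Lemma exp_wtr2_prod a b ws : E (fun t => wtr a t * wtr b t * wtr_prod ws t) =
  cmoment [:: a, b & ws] + moment a * cmoment (b :: ws) +
  (moment b * cmoment (a :: ws) + moment a * moment b * cmoment ws).
Proof.
have -> : (fun t => wtr a t * wtr b t * wtr_prod ws t) = (fun t =>
    wtr a t * wtr_prod (b :: ws) t + moment b * (wtr a t * wtr_prod ws t)).
  by apply/funext => t; rewrite wtr_prod_cons; ring.
have pa ws' : polyfun P X (fun t => wtr a t * wtr_prod ws' t).
  by apply: polyfunM; [exact: polyfun_wtr | exact: polyfun_wtr_prod].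
rewrite cexpD; [|exact/pc/pa|exact/cintZ/pc/pa].
rewrite (cexpZ (moment b) (pc (pa ws))) !exp_wtr_prod; ring.
Qed.

Lemma cmoment_nil_cons ws : cmoment ([::] :: ws) = 0.
Proof.
have e0 : moment [::] = N%:R.
  by rewrite /moment /wtr; under eq_fun do rewrite /= wtrace_nil; exact: cexp_cst.
rewrite /cmoment (_ : wtr_prod _ = fun=> 0) ?cexp_cst //.
by apply/funext => t; rewrite wtr_prod_cons /wtr e0 /= wtrace_nil subrr mul0r.
Qed.

(** The loop equation with both traces of a split term expanded around their means.
    Letters are words, so that merging two letters is concatenation. *)
Lemma exp_loop l w ws : E (fun t => wtr (l :: w) t * wtr_prod ws t) =
  N%:R^-1 * \tr (ev l) * (cmoment (w :: ws) + moment w * cmoment ws) +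
  (\sum_(s <- splits w) N%:R^-1 *
     (cmoment [:: s.1.1, ((l ++ s.1.2) :: s.2) & ws] +
      moment s.1.1 * cmoment (((l ++ s.1.2) :: s.2) :: ws) +
      (moment ((l ++ s.1.2) :: s.2) * cmoment (s.1.1 :: ws) +
       moment s.1.1 * moment ((l ++ s.1.2) :: s.2) * cmoment ws)) +
   \sum_(u <- splits ws) \sum_(s <- splits u.1.2) N%:R^-1 *
     (cmoment (((l ++ s.1.2) :: s.2 ++ s.1.1 ++ w) :: u.1.1 ++ u.2) +
      moment ((l ++ s.1.2) :: s.2 ++ s.1.1 ++ w) * cmoment (u.1.1 ++ u.2))).
Proof.
have pw w' ws' : polyfun P X (fun t => wtr w' t * wtr_prod ws' t).
  by apply: polyfunM; [exact: polyfun_wtr | exact: polyfun_wtr_prod].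
have pw2 a b ws' : polyfun P X (fun t => wtr a t * wtr b t * wtr_prod ws' t).
  by apply: polyfunM; [apply: polyfunM; exact: polyfun_wtr | exact: polyfun_wtr_prod].
rewrite [LHS](loop_equation N0 hX).
have -> : (fun t =>
  N%:R^-1 * \tr (ev l) * (wtrace (X t) (map ev w) *
     centered_prod X [seq (map ev w, moment w) | w <- ws] t) +
  (\sum_(s <- splits (map ev w)) N%:R^-1 *
     (wtrace (X t) s.1.1 * wtrace (X t) (ev l *m s.1.2 :: s.2) *
        centered_prod X [seq (map ev w, moment w) | w <- ws] t) +
   \sum_(u <- splits [seq (map ev w, moment w) | w <- ws])
     \sum_(s <- splits u.1.2.1) N%:R^-1 *
       (wtrace (X t) (ev l *m s.1.2 :: s.2 ++ s.1.1 ++ map ev w) *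
        (centered_prod X u.1.1 t * centered_prod X u.2 t)))) = (fun t =>
  N%:R^-1 * \tr (ev l) * (wtr w t * wtr_prod ws t) +
  (\sum_(s <- splits w) N%:R^-1 *
     (wtr s.1.1 t * wtr ((l ++ s.1.2) :: s.2) t * wtr_prod ws t) +
   \sum_(u <- splits ws) \sum_(s <- splits u.1.2) N%:R^-1 *
       (wtr ((l ++ s.1.2) :: s.2 ++ s.1.1 ++ w) t * wtr_prod (u.1.1 ++ u.2) t))).
  apply/funext => t; congr (_ + (_ + _)).
    rewrite (sum_splits_map ev (fun a x b => N%:R^-1 *
      (wtrace (X t) a * wtrace (X t) (ev l *m x :: b) * wtr_prod ws t))).
    by apply: eq_bigr => s _; rewrite /wtr /= evM.
  rewrite (sum_splits_map (fun w => (map ev w, moment w)) (fun a x b =>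
    \sum_(s <- splits x.1) N%:R^-1 *
       (wtrace (X t) (ev l *m s.1.2 :: s.2 ++ s.1.1 ++ map ev w) *
        (centered_prod X a t * centered_prod X b t)))).
  apply: eq_bigr => u _ /=.
  rewrite (sum_splits_map ev (fun a x b => N%:R^-1 *
       (wtrace (X t) (ev l *m x :: b ++ a ++ map ev w) *
        (wtr_prod u.1.1 t * wtr_prod u.2 t)))).
  by apply: eq_bigr => s _; rewrite /wtr /= evM !map_cat wtr_prod_cat.
have ps1 : polyfun P X (fun t => \sum_(s <- splits w) N%:R^-1 *
     (wtr s.1.1 t * wtr ((l ++ s.1.2) :: s.2) t * wtr_prod ws t)).
  apply: polyfun_sum => s; apply: polyfunM; [exact: polyfun_cst | exact: pw2].
have ps2 u : polyfun P X (fun t => \sum_(s <- splits (u : _ * _ * _).1.2) N%:R^-1 *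
       (wtr ((l ++ s.1.2) :: s.2 ++ s.1.1 ++ w) t * wtr_prod (u.1.1 ++ u.2) t)).
  apply: polyfun_sum => s; apply: polyfunM; [exact: polyfun_cst | exact: pw].
rewrite cexpD; [|exact/cintZ/pc/pw|apply: cintD; apply: pc => //; exact: polyfun_sum].
rewrite cexpD; [|exact: pc|apply: pc; exact: polyfun_sum].
congr (_ + (_ + _)).
- by rewrite (cexpZ _ (pc (pw w ws))) exp_wtr_prod.
- rewrite cexp_sum; last by move=> s; exact/cintZ/pc/pw2.
  by apply: eq_bigr => s _; rewrite (cexpZ _ (pc (pw2 _ _ _))) exp_wtr2_prod.
rewrite cexp_sum; last by move=> u; exact/pc/ps2.
apply: eq_bigr => u _; rewrite cexp_sum; last by move=> s; exact/cintZ/pc/pw.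
by apply: eq_bigr => s _; rewrite (cexpZ _ (pc (pw _ _))) exp_wtr_prod.
Qed.

Definition nmoment w : R[i] := N%:R^-1 * moment w.

Lemma nmoment_nil : nmoment [::] = 1.
Proof.
rewrite /nmoment /moment /wtr; under eq_fun do rewrite /= wtrace_nil.
by rewrite cexp_cst mulVf // pnatr_eq0 -lt0n.
Qed.

Lemma nmoment_cons l w : nmoment (l :: w) = N%:R^-1 * \tr (ev l) * nmoment w +
  \sum_(s <- splits w) (nmoment s.1.1 * nmoment ((l ++ s.1.2) :: s.2) +
    N%:R^-1 * (N%:R^-1 * cmoment [:: s.1.1; (l ++ s.1.2) :: s.2])).
Proof.
have := exp_loop l w [::]; under eq_fun do rewrite wtr_prod_nil mulr1.
rewrite -[LHS]/(moment (l :: w)) cmoment_nil !cmoment1 big_nil addr0 => e.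
rewrite /nmoment e mulrDr mulr_sumr; congr (_ + _); first by ring.
by apply: eq_bigr => s _; rewrite !cmoment1; ring.
Qed.

(** The products of two means in exp_loop cancel against the equation for the mean
    of T(l w), the case of no other trace. *)
Lemma cmoment_cons l w ws : cmoment ((l :: w) :: ws) =
  N%:R^-1 * \tr (ev l) * cmoment (w :: ws) + \sum_(s <- splits w)
    (N%:R^-1 * cmoment (s.1.1 :: ((l ++ s.1.2) :: s.2) :: ws) +
     (nmoment s.1.1 * cmoment (((l ++ s.1.2) :: s.2) :: ws) +
      nmoment ((l ++ s.1.2) :: s.2) * cmoment (s.1.1 :: ws)) +
     - (N%:R^-1 * cmoment [:: s.1.1; (l ++ s.1.2) :: s.2]) * cmoment ws) +
  \sum_(u <- splits ws) \sum_(s <- splits u.1.2)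
    (N%:R^-1 * cmoment (((l ++ s.1.2) :: s.2 ++ s.1.1 ++ w) :: u.1.1 ++ u.2) +
     nmoment ((l ++ s.1.2) :: s.2 ++ s.1.1 ++ w) * cmoment (u.1.1 ++ u.2)).
Proof.
have e1 := exp_loop l w ws; rewrite exp_wtr_prod in e1.
have e0 := exp_loop l w [::]; rewrite exp_wtr_prod in e0.
rewrite cmoment_nil !cmoment1 big_nil addr0 mulr1 !add0r mulr1 in e0.
have -> : cmoment ((l :: w) :: ws) =
  (cmoment ((l :: w) :: ws) + moment (l :: w) * cmoment ws) - moment (l :: w) * cmoment ws.
  by ring.
rewrite e1 e0 [X in _ - X]mulrDl mulr_suml.
rewrite -[X in _ = _ + X]addr0.
set S1 := \sum_(s <- splits w) _; set S2 := \sum_(u <- splits ws) _.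
set S0 := \sum_(s <- splits w) _; set S3 := \sum_(s <- splits w) _.
set S4 := \sum_(u <- splits ws) _.
have -> : S4 = S2.
  by apply: eq_bigr => u _; apply: eq_bigr => s _; rewrite /nmoment; ring.
have -> : S3 = S1 - S0.
  rewrite /S3 /S1 /S0 -sumrB; apply: eq_bigr => s _.
  by rewrite /nmoment !cmoment1; ring.
ring.
Qed.

End FixedDimension.

(** * Convergence of the covariances *)

Lemma cvg_inv_nat (R : realType) :
  (fun N : nat => N%:R^-1 : R[i]^o) @ \oo --> (0 : R[i]^o).
Proof.
apply/cvgrPdist_le => e e0.
have e_real : (complex.Re e)%:C%C = e by rewrite RRe_real // gtr0_real.
have e'0 : 0 < complex.Re e by rewrite -ltcR e_real.
near=> N; rewrite sub0r normrN normrV ?normr_nat; last first.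
  by rewrite unitfE pnatr_eq0 -lt0n; near: N; exact: nbhs_infty_gt.
have N0 : (0 < N)%N by near: N; exact: nbhs_infty_gt.
have eN : (complex.Re e)^-1 <= N%:R.
  near: N; exists (Num.bound (complex.Re e)^-1) => // k /= kb.
  apply: ltW; apply: lt_le_trans (archi_boundP _) _; first by rewrite invr_ge0 ltW.
  by rewrite ler_nat.
rewrite -e_real -(rmorph_nat (real_complex R)) -fmorphV lecR.
by rewrite invf_ple // posrE ?ltr0n.
Unshelve. all: by end_near. Qed.

Section Adjoint.
Variables (C : numClosedFieldType) (N : nat).
Implicit Types (A B X D : 'M[C]_N).

Lemma adjmxM A B : adjmx (A *m B) = adjmx B *m adjmx A.
Proof. by rewrite /adjmx trmx_mul map_mxM. Qed.

Lemma adjmxK A : adjmx (adjmx A) = A.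
Proof. by apply/matrixP => i j; rewrite !mxE conjCK. Qed.

Lemma mxtrace_adj A : \tr (adjmx A) = (\tr A)^*.
Proof. by rewrite /mxtrace rmorph_sum; apply: eq_bigr => k _; rewrite !mxE. Qed.

Lemma adjmx_wishart X D : adjmx (wishart X D) = wishart X (adjmx D).
Proof. by rewrite /wishart !adjmxM adjmxK mulmxA. Qed.

(** This turns the conjugate in the covariance into an ordinary trace, to which the
    loop equation applies. *)
Lemma wtrace_adj X (w : seq 'M[C]_N) :
  (wtrace X w)^* = wtrace X (rev (map (@adjmx C N) w)).
Proof.
rewrite /wtrace -mxtrace_adj; congr (\tr _).
elim: w => [|D w IH]; first by rewrite wword_nil /adjmx trmx1 map_mx1.
rewrite map_cons rev_cons -cats1 wword_cat wword_cons adjmxM IH adjmx_wishart.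
by rewrite wword_cons wword_nil mulmx1.
Qed.

End Adjoint.

Unset Implicit Arguments.
Set Strict Implicit.
Set Printing Implicit Defensive.

Theorem theorem5p7 (R : realType) (p : nat)
  (disp : nat -> measure_display) (T : forall N, measurableType (disp N))
  (P : forall N, probability (T N) R)
  (X : forall N, T N -> 'M[R[i]]_N)
  (D : forall N, 'I_p -> 'M[R[i]]_N)
  (A : algType R[i]) (star : A -> A) (psi : {scalar A}) (d : 'I_p -> A)
  (hstar : star_algebra star)
  (hgen : star_generated star d)
  (hpsi : tracial_state star psi)
  (hX : forall N, complex_gaussian_matrix (P N) (X N))
  (hD : converges_in_distribution D star psi d)
  (n m : nat) (i : 'I_(n + m) -> 'I_p) :
  (fun N => k2 (P N)
     (fun t => \tr (\prod_(k < n) wishart (X N t) (D N (i (lshift m k)))))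
     (fun t => (\tr (\prod_(k < m) wishart (X N t) (D N (i (rshift n k)))))^*))
  @ \oo -->
  (cyc_ip star psi
     (cyc_map psi (pfock_vacuum star psi (fun k => d (i (lshift m k)))))
     (cyc_map psi (pfock_vacuum star psi (fun k => d (i (rshift n k)))))
   : R[i]^o).
Proof.
(* Letters are words in the D_i and their adjoints: the loop equation multiplies
   letters, and convergence of all *-moments is available for such words. *)
pose ev N (l : seq ('I_p * bool)) : 'M[R[i]]_N :=
  \prod_(e <- l) (if e.2 then adjmx (D N e.1) else D N e.1).
pose av (l : seq ('I_p * bool)) : A :=
  \prod_(e <- l) (if e.2 then star (d e.1) else d e.1).
have evM N l l' : ev N (l ++ l') = ev N l *m ev N l' by rewrite /ev big_cat.
have avM l l' : av (l ++ l') = av l * av l' by rewrite /av big_cat.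
pose w1 := [seq [:: (i (lshift m k), false)] | k <- enum 'I_n].
pose w2 := rev [seq [:: (i (rshift n k), true)] | k <- enum 'I_m].
have pos : \forall N \near \oo, (0 < N)%N by exact: nbhs_infty_gt.
have wE (q : nat) (j : 'I_q -> 'I_p) N (M : 'M[R[i]]_N) : \prod_(k < q) wishart M (D N (j k)) =
    wword M (map (ev N) [seq [:: (j k, false)] | k <- enum 'I_q]).
  rewrite /wword 2!big_map enumT [index_enum _]unlock; apply: eq_bigr => k _.
  by rewrite /ev big_seq1.
have limE : fock_cov star psi (map av w1) (map av w2) =
  cyc_ip star psi
     (cyc_map psi (pfock_vacuum star psi (fun k => d (i (lshift m k)))))
     (cyc_map psi (pfock_vacuum star psi (fun k => d (i (rshift n k))))).
  have starK : involutive star by case: hstar.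
  have pvE q (dd : 'I_q -> A) : pfock_vacuum star psi dd = pvec star psi (map dd (enum 'I_q)).
    by rewrite /pvec foldr_map.
  rewrite /fock_cov !pvE; congr (cyc_ip star psi (cyc_map psi (pvec star psi _))
    (cyc_map psi (pvec star psi _))).
    by rewrite -map_comp; apply: eq_map => k /=; rewrite /av big_seq1.
  rewrite /w2 [map av _]map_rev revK -!map_comp; apply: eq_map => k /=.
  by rewrite /av big_seq1 starK.
rewrite -limE.
(* Integration by parts requires a nonempty matrix, hence holds for all large N only. *)
apply: (cvg_near_eq (v := fun N => cmoment (P N) (X N) (ev N) [:: w1; w2])).
  near=> N; have N0 : (0 < N)%N by near: N.
  have e1 : (fun t => \tr (\prod_(k < n) wishart (X N t) (D N (i (lshift m k))))) =
      wtr (X N) (ev N) w1.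
    by apply/funext => t; rewrite wE.
  have e2 : (fun t => (\tr (\prod_(k < m) wishart (X N t) (D N (i (rshift n k)))))^*) =
      wtr (X N) (ev N) w2.
    apply/funext => t; rewrite wE [LHS]wtrace_adj /wtr /w2 map_rev.
    congr (wtrace _ (rev _)); rewrite -!map_comp; apply: eq_map => k /=.
    by rewrite /ev !big_seq1.
  rewrite e1 e2 /k2.
  have := exp_wtr2_prod N0 (hX N) (ev N) w1 w2 [::].
  under eq_fun do rewrite wtr_prod_nil mulr1.
  rewrite !(cmoment1 N0 (hX N)) cmoment_nil !mulr0 mulr1 addr0 add0r.
  move=> ->; exact: addrK.
apply: (@cvg_covariance _ (@cvg_inv_nat R) _
  (fun N l => N%:R^-1 * \tr (ev N l))
  (fun N => nmoment (P N) (X N) (ev N))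
  (fun N => cmoment (P N) (X N) (ev N)) _ _ _ _ _
  (fun l => psi (av l)) _ (fun w => vmoment psi (map av w))
  (fun w v => fock_cov star psi (map av w) (map av v)) _ _ _ _ w1 w2).
- by near=> N; apply: nmoment_nil => //; near: N.
- by near=> N; apply: cmoment_nil => //; near: N.
- by move=> ws; near=> N; apply: cmoment_nil_cons => //; near: N.
- by move=> l w; near=> N; apply: nmoment_cons => //; near: N.
- by move=> l w ws; near=> N; apply: cmoment_cons => //; near: N.
- by move=> l; exact: hD.
- exact: vmoment_nil.
- move=> l w; rewrite /= vmoment_cons.
  rewrite (sum_splits_map av (fun a x b => vmoment psi a * vmoment psi (av l * x :: b))).
  by congr +%R; apply: eq_bigr => s _; rewrite /= avM.
- by move=> v; exact: fock_cov_nil.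
- move=> l w v; rewrite /= fock_cov_cons //.
  rewrite (sum_splits_map av (fun a x b => vmoment psi a * fock_cov star psi (av l * x :: b) (map av v)
    + vmoment psi (av l * x :: b) * fock_cov star psi a (map av v))).
  rewrite (sum_splits_map av (fun a x b => vmoment psi (av l * x :: b ++ a ++ map av w))).
  move: (fock_cov star psi) (vmoment psi) => K O; congr (_ + _ + _).
  + by apply: eq_bigr => s _; rewrite /= avM.
  + by apply: eq_bigr => s _; rewrite /= avM !map_cat.
Unshelve. all: by end_near. Qed.
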